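(* Let $X$, $\mathcal H_\alpha$, $\{k_x^\alpha\}_{x\in X}$, $\nu_\alpha$ be as described in the context, and assume: (Scaling) $d\nu_\alpha(x)=c(\alpha)\,d\nu(x)$ for all $\alpha$, where $c(\alpha)>0$ and $\nu$ is a Radon measure on $X$ independent of $\alpha$; (Localization) for every $x\in X$ and every neighborhood $U$ of $x$, $\int_{X\setminus U}|\langle k_x^\alpha,k_y^\alpha\rangle_\alpha|^2\,d\nu_\alpha(y)\to 0$ as $\alpha\to\infty$. Then the following hold. (A) For every $1\le p<\infty$ and every $\sigma\in L^p(X,\nu)$, the Berezin transforms satisfy $\widetilde\sigma_\alpha\to\sigma$ in $L^p(X,\nu)$ as $\alpha\to\infty$. (B) (Compact form.) Suppose that $X$ is compact, that each $\mathcal H_\alpha$ is finite-dimensional, and that $c(\alpha)=\dim\mathcal H_\alpha$. Let $\sigma\in L^1(X,\nu)$ be real-valued. If either (1) $\sigma$ is bounded and $\psi$ is a real-valued continuous function on $[\operatorname{ess\,inf}\sigma,\operatorname{ess\,sup}\sigma]$, or (2) $\sigma\ge 0$, $\psi\in C([0,\infty))$ is real-valued, and $\lim_{t\to\infty}\psi(t)/t$ exists and is finite, then $$\frac{1}{c(\alpha)}\operatorname{Tr}\bigl(\psi(T_\sigma^\alpha)\bigr)\longrightarrow\int_X\psi(\sigma(x))\,d\nu(x)\qquad(\alpha\to\infty).$$ (C) (Locally compact form.) Suppose that $\sigma,\eta\in L^1(X,\nu)\cap L^2(X,\nu)$ are real-valued, $\eta\ge 0$, and $T_\sigma^\alpha$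 and $T_\eta^\alpha$ commute for every $\alpha$. If either (1) $\sigma$ is bounded and $\psi$ is a real-valued continuous function on $[\operatorname{ess\,inf}\sigma,\operatorname{ess\,sup}\sigma]$, or (2) $\sigma\ge 0$, $\psi\in C([0,\infty))$ is real-valued, and $\lim_{t\to\infty}\psi(t)/t$ exists and is finite, then $$\frac{1}{c(\alpha)}\operatorname{Tr}\bigl(T_\eta^\alpha\psi(T_\sigma^\alpha)\bigr)\longrightarrow\int_X\eta(x)\psi(\sigma(x))\,d\nu(x)\qquad(\alpha\to\infty).$$
   Context: $X$ is a locally compact Hausdorff space. For each value of a parameter $\alpha$ (limits are taken as $\alpha\to\infty$), $\mathcal H_\alpha$ is a Hilbert space with inner product $\langle\cdot,\cdot\rangle_\alpha$, and $\{k_x^\alpha:x\in X\}\subset\mathcal H_\alpha$ is a normalized continuous Parseval frame with frame Radon measure $\nu_\alpha$ on $X$: $\|k_x^\alpha\|_\alpha=1$ for all $x$, the functions $x\mapsto\langle f,k_x^\alpha\rangle_\alpha$ are Borel measurable, and $f=\int_X\langle f,k_x^\alpha\rangle_\alpha k_x^\alpha\,d\nu_\alpha(x)$ weakly for every $f\in\mathcal H_\alpha$, i.e. $\langle f,g\rangle_\alpha=\int_X\langle f,k_x^\alpha\rangle_\alpha\langle k_x^\alpha,g\rangle_\alpha\,d\nu_\alpha(x)$ for all $f,g$. For $\sigma\in L^1(X,\nu)$ the Toeplitz operator on $\mathcal H_\alpha$ is the weakly defined operator $T_\sigma^\alpha f=\int_X\sigma(x)\langle f,k_x^\alpha\rangle_\alpha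 k_x^\alpha\,d\nu_\alpha(x)$. It is trace class, and self-adjoint when $\sigma$ is real-valued; $\psi(T_\sigma^\alpha)$ is defined by functional calculus. The Berezin transform of $\sigma$ is $\widetilde\sigma_\alpha(x)=\int_X\sigma(y)|\langle k_x^\alpha,k_y^\alpha\rangle_\alpha|^2\,d\nu_\alpha(y)$. The essential infimum and supremum are taken with respect to $\nu$. *)

(* Defs.v *)
From HB Require Import structures.
From mathcomp Require Import all_boot all_order all_algebra finmap.
From mathcomp Require Import all_classical all_reals all_analysis.
From mathcomp Require Import ess_sup_inf complex.

Set Implicit Arguments.
Unset Strict Implicit.
Unset Printing Implicit Defensive.

Import Order.TTheory GRing.Theory Num.Theory.
Import numFieldNormedType.Exports.
Import ComplexField.Normc.

Local Open Scope classical_set_scope.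
Local Open Scope ring_scope.
Local Open Scope complex_scope.

Section Hilbert.
Variable R : realType.

(* The inner product is linear in its first argument.  Completeness is that
   of the underlying [completeNormedModType]. *)
Record hilbertSpace := HilbertSpace {
  hilbert_sort :> completeNormedModType R[i];
  hdot : {dot hilbert_sort for (@Num.conj R[i])};
  hdot_norm : forall v : hilbert_sort, `|v| ^+ 2 = hdot v v
}.

Definition has_dim (H : hilbertSpace) (n : nat) : Prop :=
  exists f : {linear H -> 'rV[R[i]]_n}, bijective f.

Section Operators.
Variable H : hilbertSpace.
Implicit Types (S T : H -> H) (z : R[i]) (psi : R -> R).

Definition bounded_operator S : Prop := linear S /\ continuous S.

Definition spectrum T : set R[i] :=
  [set z | ~ exists S, [/\ bounded_operator S,
             forall f, S (T f - z *: f) = f &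
             forall f, T (S f) - z *: S f = f]].

Definition poly_operator (p : {poly R}) T (f : H) : H :=
  \sum_(j < size p) (p`_j)%:C *: iter j T f.

(* Continuous functional calculus of a bounded self-adjoint T: psi(T) is the
   operator-norm limit of p_n(T) for real polynomials p_n converging to psi
   uniformly on the spectrum of T, which is a subset of the real line. *)
Definition is_fun_calculus T psi S : Prop :=
  bounded_operator S /\
  exists p : nat -> {poly R},
    (forall e : R, 0 < e -> \forall n \near \oo,
       forall t : R, spectrum T t%:C -> `|(p n).[t] - psi t| <= e) /\
    (forall e : R, 0 < e -> \forall n \near \oo,
       forall f : H, `|poly_operator (p n) T f - S f| <= e%:C * `|f|).

Definition fun_calculus T psi : H -> H :=
  xget (fun=> 0) [set S | is_fun_calculus T psi S].

Definition orthonormal_basis (E : set H) : Prop :=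
  (forall u v : H, E u -> E v -> hdot H u v = (u == v)%:R) /\
  (forall f : H, (forall e, E e -> hdot H f e = 0) -> f = 0).

(* H need not be separable: the sum of the diagonal coefficients over an
   orthonormal basis is the limit along the finite subsets of the basis. *)
Definition is_trace S (t : R[i]) : Prop :=
  forall E : set H, orthonormal_basis E ->
  forall eps : R, 0 < eps ->
  exists2 F0 : {fset H}, [set` F0] `<=` E &
    forall F : {fset H}, [set` F0] `<=` [set` F] -> [set` F] `<=` E ->
      `|\sum_(e <- F) hdot H (S e) e - t| <= eps%:C.

Definition trace S : R[i] := xget 0 [set t | is_trace S t].

End Operators.

Section ComplexIntegral.
Context d (T : measurableType d) (mu : {measure set T -> \bar R}).

Definition cmeasurable (f : T -> R[i]) : Prop :=
  measurable_fun setT (fun x => complex.Re (f x)) /\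
  measurable_fun setT (fun x => complex.Im (f x)).

Definition cintegrable (f : T -> R[i]) : Prop :=
  mu.-integrable setT (fun x => (complex.Re (f x))%:E) /\
  mu.-integrable setT (fun x => (complex.Im (f x))%:E).

Definition cintegral (f : T -> R[i]) : R[i] :=
  (\int[mu]_x complex.Re (f x)) +i* (\int[mu]_x complex.Im (f x)).

Definition cLnorm (p : R) (f : T -> R[i]) : \bar R :=
  Lnorm mu p%:E (fun x => (normc (f x))%:E).

Definition inLp (p : R) (f : T -> R[i]) : Prop :=
  cmeasurable f /\ (cLnorm p f < +oo)%E.

(* h is the weak integral of the vector-valued function F. *)
Definition is_weak_integral (H : hilbertSpace) (F : T -> H) (h : H) : Prop :=
  forall g : H, cintegrable (fun x => hdot H (F x) g) /\
    hdot H h g = cintegral (fun x => hdot H (F x) g).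

Definition weak_integral (H : hilbertSpace) (F : T -> H) : H :=
  xget 0 [set h | is_weak_integral F h].

Definition toeplitz (H : hilbertSpace) (k : T -> H) (sigma : T -> R[i])
    (f : H) : H :=
  weak_integral (fun x => (sigma x * hdot H f (k x)) *: k x).

Definition berezin (H : hilbertSpace) (k : T -> H) (sigma : T -> R[i])
    (x : T) : R[i] :=
  cintegral (fun y => sigma y * `|hdot H (k x) (k y)| ^+ 2).

(* The two alternative hypotheses on a real-valued symbol sigma and on psi,
   with boundedness and nonnegativity of sigma understood mu-almost
   everywhere.  psi is a total function, but continuity is only asked on the
   interval given by each alternative. *)
Definition admissible (sigma : T -> R) (psi : R -> R) : Prop :=
  ((exists M : R, \forall x \ae mu, `|sigma x| <= M) /\
   {within [set t : R | (ess_inf mu (EFin \o sigma) <= t%:E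
                          <= ess_sup mu (EFin \o sigma))%E],
     continuous psi}) \/
  [/\ \forall x \ae mu, 0 <= sigma x,
      {within `[0, +oo[, continuous psi}
    & exists l : R, psi t / t @[t --> +oo] --> l].

End ComplexIntegral.
End Hilbert.

Notation borel X := (g_sigma_algebraType (@open X)).

(* Outer regular on Borel sets and inner regular on open sets. *)
Definition radon_measure (R : realType) (X : ptopologicalType)
    (mu : {measure set (borel X) -> \bar R}) : Prop :=
  [/\ forall K : set X, compact K -> (mu K < +oo)%E,
      forall B : set (borel X), measurable B ->
        mu B = ereal_inf [set mu U | U in [set U : set X | open U /\ B `<=` U]]
    & forall U : set X, open U ->
        mu U = ereal_sup [set mu K | K in
                 [set K : set X | compact K /\ K `<=` U]]].

Definition normalized_parseval_frame (R : realType) (X : ptopologicalType)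
    (H : hilbertSpace R) (k : X -> H)
    (mu : {measure set (borel X) -> \bar R}) : Prop :=
  [/\ radon_measure mu,
      forall x, `|k x| = 1,
      forall f : H, cmeasurable (fun x : borel X => hdot H f (k x))
    & forall f : H,
        is_weak_integral mu (fun x : borel X => hdot H f (k x) *: k x) f].

(* Main.v *)
(** Put K_a(x, y) = |<k_x, k_y>|^2, so that the Berezin transform of a real
    symbol s is B_a s(x) = <T_s k_x, k_x>, the integral of s(y) K_a(x, y), where
    K_a(x, .) is a probability density for nu_a.  Each B_a is a contraction of
    L^1(nu), and of L^p(nu) by Jensen's inequality.  Localization gives
    B_a 1_U -> 1 pointwise on an open set U of finite measure, and contractivity
    turns this into L^1 convergence; outer regularity and density extend it to
    L^1, and truncation to L^p.

    For the traces, Tr(T_eta S) is the integral of eta(x) <S P k_x, k_x> for nu_a,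
    where P is the projection onto the orthogonal complement of ker T_eta.  The
    functional calculus bounds the difference between psi(T_s) k_x and
    psi(s(x)) k_x by the norm of (T_s - s(x)) k_x, whose square is at most
    phi(x) = B_a(s^2)(x) - 2 s(x) B_a s(x) + s(x)^2, and the integral of phi tends
    to 0 by the convergence of Berezin transforms.  All that is used of psi is
    that for each e > 0 there is C with
    |psi t - psi u| <= e (1 + |u|) + C |t - u|, which holds both for a continuous
    function on a segment and for a continuous function on [0, +oo[ such that
    psi(t)/t converges.  When s is only integrable and nu is finite, (t - a)^2 is
    replaced by (t - a)^2 / (1 + t), and s by a truncation. *)
Require Import Defs.
From HB Require Import structures.
From mathcomp Require Import all_boot all_order all_algebra finmap.
From mathcomp Require Import all_classical all_reals all_analysis.
From mathcomp Require Import ess_sup_inf complex measurable_realfun.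
From mathcomp Require Import ring lra.

Set Implicit Arguments.
Unset Strict Implicit.
Unset Printing Implicit Defensive.

Import Order.TTheory GRing.Theory Num.Theory.
Import numFieldNormedType.Exports.
Import ComplexField.Normc.
Local Open Scope classical_set_scope.
Local Open Scope ring_scope.
Local Open Scope complex_scope.

(** * Hilbert spaces *)

Section HilbertGeometry.
Variables (R : realType) (H : hilbertSpace R).
Implicit Types (u v w f g : H) (a b t : R) (z : R[i]).

(** Neither [H] is separable nor the measure sigma-finite, and the kernel is only known to be
    measurable in each variable separately, so Fubini's theorem cannot be applied to K_a. The
    contraction property and the trace formula are read off from orthonormal bases instead. Finite
    sums of coefficient functions have explicit integrals by the Parseval identity, and a Toeplitz
    operator with a nonnegative integrable symbol kills all but countably many vectors of any basis,
    so Fatou and dominated convergence apply along a sequence of finite subsets. The projection P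
    gives every P k_x an expansion in that countable part.

    The functional calculus rests on one positivity statement: a polynomial that is nonnegative on
    the spectrum gives a nonnegative form. Every scalar inequality on the spectrum then becomes an
    inequality between quadratic forms at k_x.

    Limits along the parameter are tested on sequences, since the convergence theorems for integrals
    are about sequences. As [psi] is controlled only on an interval, [psi \o sigma] may fail to be
    measurable; a version equal to it almost everywhere takes its place. *)

Definition rip u v : R := complex.Re (hdot H u v).
Definition sqn u : R := rip u u.

Lemma hdotDl u v w : hdot H (u + v) w = hdot H u w + hdot H v w.
Proof. exact: linearDl. Qed.
Lemma hdotZl z u v : hdot H (z *: u) v = z * hdot H u v.
Proof. exact: linearZl_LR. Qed.
Lemma hdotZr z u v : hdot H u (z *: v) = conjc z * hdot H u v.
Proof. by rewrite linearZr_LR. Qed.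
Lemma hdotC u v : hdot H u v = conjc (hdot H v u).
Proof. by rewrite hermC expr0 mul1r. Qed.

Lemma ripC u v : rip u v = rip v u.
Proof. by rewrite /rip hdotC; case: (hdot H v u). Qed.
Lemma ripDl u v w : rip (u + v) w = rip u w + rip v w.
Proof. by rewrite /rip hdotDl; case: (hdot H u w); case: (hdot H v w). Qed.
Lemma ripDr u v w : rip w (u + v) = rip w u + rip w v.
Proof. by rewrite !(ripC w) ripDl. Qed.
Lemma ripZl a u v : rip (a%:C *: u) v = a * rip u v.
Proof. by rewrite /rip hdotZl; case: (hdot H u v) => x y /=; ring. Qed.
Lemma ripZr a u v : rip u (a%:C *: v) = a * rip u v.
Proof. by rewrite !(ripC u) ripZl. Qed.
Lemma ripNl u v : rip (- u) v = - rip u v.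
Proof. by have := ripZl (-1) u v; rewrite rmorphN1 scaleN1r => ->; ring. Qed.
Lemma ripNr u v : rip u (- v) = - rip u v.
Proof. by rewrite !(ripC u) ripNl. Qed.
Lemma ripBl u v w : rip (u - v) w = rip u w - rip v w.
Proof. by rewrite ripDl ripNl. Qed.
Lemma ripBr u v w : rip w (u - v) = rip w u - rip w v.
Proof. by rewrite ripDr ripNr. Qed.
Lemma rip0l u : rip 0 u = 0.
Proof. by have := ripBl 0 0 u; rewrite subrr => ->; rewrite subrr. Qed.
Lemma rip0r u : rip u 0 = 0.
Proof. by rewrite ripC rip0l. Qed.

Lemma rip_iZl u v : rip ('i *: u) v = - complex.Im (hdot H u v).
Proof. by rewrite /rip hdotZl; case: (hdot H u v) => x y /=; ring. Qed.
Lemma rip_iZr u v : rip u ('i *: v) = complex.Im (hdot H u v).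
Proof. by rewrite /rip hdotZr; case: (hdot H u v) => x y /=; ring. Qed.

(** The real part is a symmetric bilinear form over the reals, which suits quadratic arguments; this
    identity recovers the imaginary part whenever the full inner product is needed. *)
Lemma hdotE u v : hdot H u v = rip u v +i* rip u ('i *: v).
Proof. by rewrite rip_iZr /rip; case: (hdot H u v). Qed.

Lemma hdot_sqn u : hdot H u u = (sqn u)%:C.
Proof.
have : 0 <= hdot H u u by rewrite -hdot_norm exprn_ge0.
by move=> /ger0_Im; rewrite /sqn /rip; case: (hdot H u u) => x y /= ->.
Qed.

Lemma sqn_ge0 u : 0 <= sqn u.
Proof.
have : 0 <= hdot H u u by rewrite -hdot_norm exprn_ge0.
by rewrite hdot_sqn lecR.
Qed.

Lemma hnormE u : `|u| = (Num.sqrt (sqn u))%:C.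
Proof.
apply/eqP; rewrite -(@eqrXn2 _ 2) ?normr_ge0 ?lecR ?sqrtr_ge0 //.
by rewrite hdot_norm hdot_sqn -rmorphXn /= sqr_sqrtr ?sqn_ge0.
Qed.

Lemma sqn0 : sqn 0 = 0. Proof. exact: rip0l. Qed.

Lemma sqn_eq0 u : sqn u = 0 -> u = 0.
Proof. by move=> e; apply/eqP; rewrite -normr_eq0 hnormE e sqrtr0. Qed.

Lemma sqnD u v : sqn (u + v) = sqn u + 2 * rip u v + sqn v.
Proof. by rewrite /sqn !(ripDl, ripDr) (ripC v u); ring. Qed.
Lemma sqnB u v : sqn (u - v) = sqn u - 2 * rip u v + sqn v.
Proof. by rewrite /sqn !(ripBl, ripBr) (ripC v u); ring. Qed.
Lemma sqnN u : sqn (- u) = sqn u.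
Proof. by rewrite /sqn ripNl ripNr opprK. Qed.
Lemma sqnBC u v : sqn (u - v) = sqn (v - u).
Proof. by rewrite -opprB sqnN. Qed.
Lemma sqnZ z u : sqn (z *: u) = normc z ^+ 2 * sqn u.
Proof.
rewrite /sqn /rip hdotZl hdotZr hdot_sqn.
case: z => x y /=; rewrite sqr_sqrtr ?addr_ge0 ?sqr_ge0 //; ring.
Qed.
Lemma sqnZr a u : sqn (a%:C *: u) = a ^+ 2 * sqn u.
Proof. by rewrite /sqn ripZl ripZr; ring. Qed.

Lemma sqnD_le u v : sqn (u + v) <= 2 * sqn u + 2 * sqn v.
Proof. by have := sqn_ge0 (u - v); rewrite sqnB sqnD; lra. Qed.

(** Common source of the Cauchy-Schwarz inequalities for vectors, for positive forms and for the
    frame form, and of the estimate on minimizing sequences. The sign of [c] is deduced from the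
    hypothesis. *)
Lemma quadratic_disc a b (c : R) :
  (forall t, 0 <= a + 2 * b * t + c * t ^+ 2) -> b ^+ 2 <= a * c.
Proof.
move=> h; have [c0|c0] := eqVneq c 0.
  have [->|b0] := eqVneq b 0; first by rewrite c0; lra.
  (* With [c = 0] this point makes the affine function equal to -1. *)
  have := h (- (a + 1) / (2 * b)); rewrite c0 mul0r addr0.
  have -> : a + 2 * b * (- (a + 1) / (2 * b)) = -1 by field.
  by lra.
have cp : 0 < c.
  rewrite lt_neqAle eq_sym c0 /= leNgt; apply/negP => cn.
  (* For negative [c], this [t] is so large that the values at [t] and [-t] have a negative sum. *)
  pose t := (1 + `|a| + `|b|) / (- c) + 1.
  have tp : 1 <= t.
    by rewrite lerDr divr_ge0 // ?oppr_ge0 ?(ltW cn) // !addr_ge0.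
  have e1 : c * t = - (1 + `|a| + `|b|) + c by rewrite /t; field.
  have := h t; have := h (-t); have := ler_norm a; rewrite !expr2.
  have : t * (c * t) = t * (- (1 + `|a| + `|b|) + c) by rewrite e1.
  have := normr_ge0 b; have := normr_ge0 a; nra.
have := h (- b / c).
have -> : a + 2 * b * (- b / c) + c * (- b / c) ^+ 2 = (a * c - b ^+ 2) / c by field.
by rewrite pmulr_lge0 ?invr_gt0 // subr_ge0.
Qed.

Lemma rip_CS u v : rip u v ^+ 2 <= sqn u * sqn v.
Proof.
apply: quadratic_disc => t.
by have := sqn_ge0 (u + t%:C *: v); rewrite sqnD ripZr sqnZr; nra.
Qed.

(** The free weight [t] lets one factor be made small at the expense of the other, without square
    roots. *)
Lemma rip_AMGM t u v : 0 < t -> 2 * rip u v <= t * sqn u + t^-1 * sqn v.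
Proof.
move=> t0; have := sqn_ge0 (t%:C *: u - v).
rewrite sqnB ripZl sqnZr => h.
have -> : t * sqn u + t^-1 * sqn v = t^-1 * (t ^+ 2 * sqn u + sqn v).
  by field; rewrite gt_eqF.
rewrite ler_pdivlMl //; lra.
Qed.

Lemma rip_le u v : 2 * rip u v <= sqn u + sqn v.
Proof. by have := sqn_ge0 (u - v); rewrite sqnB; lra. Qed.

(** Norm convergence, stated with the real squared norm because the norm of [H] takes its values in
    [R[i]]. *)
Definition scvg (s : nat -> H) u :=
  forall e : R, 0 < e -> exists N, forall n, (N <= n)%N -> sqn (s n - u) <= e.

Lemma hilbert_complete (s : nat -> H) :
  (forall e : R, 0 < e -> exists N, forall n m, (N <= n)%N -> (N <= m)%N ->
     sqn (s n - s m) <= e) -> exists u, scvg s u.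
Proof.
move=> hs.
have cs : cvg (s @ \oo).
  apply/cauchy_cvgP; apply/cauchy_ballP => e e0.
  (* A nonnegative element of [R[i]] is real, so epsilon may be replaced by a real number. *)
  have ee : e = (complex.Re e)%:C.
    by move: (ger0_Im (ltW e0)); case: (e) => x y /= ->.
  rewrite ee ltcR in e0; set r := complex.Re e in ee e0.
  have [|N hN] := hs (r ^+ 2 / 2); first by rewrite divr_gt0 ?exprn_gt0.
  exists (s @` [set n | (N <= n)%N], s @` [set n | (N <= n)%N]).
    by split; exists N => // n /= nN; exists n.
  move=> [x y] /= [[n nN <-] [m mN <-]].
  rewrite -ball_normE /ball_ /= hnormE ee ltcR.
  rewrite -(@ltr_pXn2r _ 2) ?nnegrE ?sqrtr_ge0 ?(ltW e0) // sqr_sqrtr ?sqn_ge0 //.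
  apply: le_lt_trans (hN _ _ nN mN) _; rewrite ltr_pdivrMr //.
  have : 0 < r ^+ 2 by rewrite exprn_gt0.
  lra.
exists (lim (s @ \oo)) => e e0.
have /cvgrPdist_le/(_ (Num.sqrt e)%:C) := cs.
rewrite ltcR sqrtr_gt0 => /(_ e0) [N _ hN]; exists N => n nN.
have := hN n nN; rewrite hnormE lecR ler_sqrt => [h|]; last exact: ltW.
by rewrite sqnBC.
Qed.

Lemma scvg_rip (s : nat -> H) u g : scvg s u -> (fun n => rip (s n) g) @ \oo --> rip u g.
Proof.
move=> su; apply/cvgrPdist_le => e e0.
have [|N hN] := su (e ^+ 2 / (1 + sqn g)).
  by rewrite divr_gt0 ?exprn_gt0 //; have := sqn_ge0 g; lra.
exists N => // n /= nN; rewrite -ripBl.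
rewrite -(@ler_pXn2r _ 2) ?nnegrE ?(ltW e0) // real_normK ?num_real //.
apply: le_trans (rip_CS _ _) _.
have := hN n nN; rewrite sqnBC ler_pdivlMr; last by have := sqn_ge0 g; lra.
have := sqn_ge0 (u - s n); nra.
Qed.

Lemma scvg_lin (s s' : nat -> H) u u' z :
  scvg s u -> scvg s' u' -> scvg (fun n => z *: s n + s' n) (z *: u + u').
Proof.
move=> su su' e e0.
have c0 := sqr_ge0 (normc z).
have [|N hN] := su (e / (4 * (1 + normc z ^+ 2))); first by rewrite divr_gt0 //; lra.
have [|M hM] := su' (e / 4); first by lra.
exists (N + M)%N => n nN.
have {}hN := hN n (leq_trans (leq_addr _ _) nN).
have {}hM := hM n (leq_trans (leq_addl _ _) nN).
rewrite opprD addrACA -scalerBr.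
apply: le_trans (sqnD_le _ _) _; rewrite sqnZ.
move: hN; rewrite ler_pdivlMr; last by lra.
have := sqn_ge0 (s n - u); nra.
Qed.

Lemma scvg_unique (s : nat -> H) u v : scvg s u -> scvg s v -> u = v.
Proof.
move=> su sv; apply/eqP; rewrite -subr_eq0; apply/eqP/sqn_eq0/eqP.
rewrite eq_le sqn_ge0 andbT leNgt; apply/negP => p.
have [|N hN] := su (sqn (u - v) / 8); first by lra.
have [|M hM] := sv (sqn (u - v) / 8); first by lra.
have {}hN := hN _ (leq_addr M N).
have {}hM := hM _ (leq_addl N M).
have := sqnD_le (u - s (N + M)%N) (s (N + M)%N - v).
rewrite addrA subrK (sqnBC u (s _)); lra.
Qed.

Lemma scvg_sqn (s : nat -> H) u : scvg s u -> (fun n => sqn (s n)) @ \oo --> sqn u.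
Proof.
move=> su.
have h1 : (fun n => sqn (s n - u)) @ \oo --> (0 : R).
  apply/cvgrPdist_le => e e0; have [N hN] := su e e0.
  exists N => // n /= nN; rewrite sub0r normrN ger0_norm ?sqn_ge0 //; exact: hN.
have h2 : rip (s n) u @[n --> \oo] --> rip u u by exact: scvg_rip su.
have h3 : 2 * rip (s n) u @[n --> \oo] --> 2 * rip u u.
  by apply: cvgM h2; exact: cvg_cst.
have -> : (fun n => sqn (s n)) =
  (fun n => sqn (s n - u) + 2 * rip (s n) u - sqn u).
  by apply/funext => n; rewrite sqnB /sqn; ring.
have -> : nbhs (sqn u) = nbhs (0 + 2 * rip u u - sqn u).
  by congr nbhs; rewrite /sqn; ring.
by apply: cvgB; [exact: cvgD h1 h3|exact: cvg_cst].
Qed.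

Definition closed_subspace (M : set H) :=
  [/\ M 0, forall z u v, M u -> M v -> M (z *: u + v)
    & forall s u, scvg s u -> (forall n, M (s n)) -> M u].

End HilbertGeometry.

(** * Symmetric operators, variational problems and boundedness *)

Section HilbertOperators.
Variables (R : realType) (H : hilbertSpace R).
Implicit Types (u v w f g : H) (a b t : R) (z : R[i]) (A S T : H -> H).

Lemma linE S : linear S <-> forall z u v, S (z *: u + v) = z *: S u + S v.
Proof. by []. Qed.
Lemma linD S u v : linear S -> S (u + v) = S u + S v.
Proof. by move=> /linE/(_ 1 u v); rewrite !scale1r. Qed.
Lemma lin0 S : linear S -> S 0 = 0.
Proof. by move=> /linE/(_ (-1) 0 0); rewrite scaler0 addr0 scaleN1r addNr. Qed.
Lemma linZ S z u : linear S -> S (z *: u) = z *: S u.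
Proof. by move=> l; rewrite -[z *: u]addr0 (linE S).1 // lin0 // addr0. Qed.
Lemma linN S u : linear S -> S (- u) = - S u.
Proof. by move=> l; rewrite -scaleN1r linZ // scaleN1r. Qed.
Lemma linB S u v : linear S -> S (u - v) = S u - S v.
Proof. by move=> l; rewrite linD // linN. Qed.
Lemma lin_sum S (I : Type) (r : seq I) (P : pred I) (F : I -> H) : linear S ->
  S (\sum_(i <- r | P i) F i) = \sum_(i <- r | P i) S (F i).
Proof.
by move=> l; apply: (big_morph S) => [u v|]; [exact: linD|exact: lin0].
Qed.

(** For a complex linear [S], symmetry of the real part already implies self-adjointness, by
    [symmetric_hdot]. *)
Definition symmetric_op S := forall u v, rip (S u) v = rip u (S v).

Lemma symmetric_hdot S u v : linear S -> symmetric_op S ->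
  hdot H (S u) v = hdot H u (S v).
Proof. by move=> l s; rewrite !hdotE !s linZ. Qed.

Lemma rip_ext u v : (forall g, rip u g = rip v g) -> u = v.
Proof.
move=> e; apply/eqP; rewrite -subr_eq0; apply/eqP/sqn_eq0.
by have := ripBl u v (u - v); rewrite e addrN.
Qed.

(* The solution is the minimizer of [rip (A u) u - 2 * L u] over [M]. *)
Lemma variational (M : set H) A (L : H -> R) (c D : R) :
  closed_subspace M -> linear A -> symmetric_op A -> 0 < c ->
  (forall u, M u -> c * sqn u <= rip (A u) u) -> 0 <= D ->
  (forall u v, L (u + v) = L u + L v) ->
  (forall a u, L (a%:C *: u) = a * L u) ->
  (forall u, L u ^+ 2 <= D * sqn u) ->
  exists2 u, M u & forall g, M g -> rip (A u) g = L g.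
Proof.
move=> [M0 Ml Mc] lA sA c0 cA D0 LD LZ LB.
pose q u := rip (A u) u.
pose J u := q u - 2 * L u.
have qD u v t : q (u + t%:C *: v) = q u + 2 * t * rip (A u) v + t ^+ 2 * q v.
  rewrite /q linD // linZ // !(ripDl, ripDr, ripZl, ripZr).
  by rewrite (ripC (A v) u) -sA; ring.
have JD u v t : J (u + t%:C *: v) =
    J u + 2 * t * (rip (A u) v - L v) + t ^+ 2 * q v.
  by rewrite /J qD LD LZ; ring.
have MD u v t : M u -> M v -> M (u + t%:C *: v).
  by move=> Mu Mv; rewrite addrC; exact: Ml.
have Jlb u : M u -> - (D / c) <= J u.
  move=> Mu; rewrite /J; have := cA _ Mu; rewrite -/(q u).
  have sD := LB u.
  have h : 2 * L u <= c * sqn u + D / c.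
    have sp := sqn_ge0 u.
    rewrite -subr_ge0 -(pmulr_rge0 _ c0).
    have -> : c * (c * sqn u + D / c - 2 * L u) =
        c ^+ 2 * sqn u + D - 2 * c * L u by field; rewrite gt_eqF.
    have [/eqP s0|s0] := eqVneq (sqn u) 0.
      move: sD; rewrite (eqP s0) mulr0 => L0.
      have -> : L u = 0 by apply/eqP; rewrite -sqrf_eq0 eq_le L0 sqr_ge0.
      by lra.
    have {}sp : 0 < sqn u by rewrite lt_neqAle eq_sym s0.
    rewrite -(pmulr_rge0 _ sp).
    have : 0 <= (c * sqn u - L u) ^+ 2 by rewrite sqr_ge0.
    nra.
  by lra.
pose E := [set J u | u in M].
have hE : has_inf E.
  split; first by exists (J 0), 0.
  by exists (- (D / c)) => _ [u Mu <-]; exact: Jlb.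
pose j := inf E.
have jle u : M u -> j <= J u.
  by move=> Mu; apply: ge_inf; [exact: hE.2|exists u].
have /choice[s hs] : forall n : nat, exists u, M u /\ J u <= j + n.+1%:R^-1.
  move=> n; have [_ [u Mu <-] h] := inf_adherent (ltac:(by rewrite invr_gt0 ltr0n) : 0 < n.+1%:R^-1 :> R) hE.
  by exists u; split => //; exact: ltW.
have inv_small (e : R) : 0 < e -> exists N, forall n, (N <= n)%N -> n.+1%:R^-1 <= e.
  move=> e0; have [N _ hN] := near_infty_natSinv_lt (PosNum e0).
  by exists N => n nN; exact/ltW/hN.
(* Parallelogram identity: [J] at the midpoint of [u] and [v] is at least the infimum [j]. This
   makes minimizing sequences Cauchy. *)
have qB u v : M u -> M v -> q (u - v) <= 2 * (J u + J v) - 4 * j.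
  move=> Mu Mv; have Mm : M (u + (- 2^-1)%:C *: (u - v)).
    by apply: (MD) => //; have := MD _ _ (-1) Mu Mv; rewrite rmorphN1 scaleN1r.
  have := jle _ Mm; rewrite JD.
  have := JD u (u - v) (-1); rewrite rmorphN1 scaleN1r opprB addrC subrK.
  lra.
have [|u su] := @hilbert_complete _ _ s.
  move=> e e0; have [|N hN] := inv_small (c * e / 4); first by rewrite !mulr_gt0.
  exists N => n m nN mN.
  have Mnm : M (s n - s m).
    by have := MD _ _ (-1) (hs n).1 (hs m).1; rewrite rmorphN1 scaleN1r.
  rewrite -(ler_pM2l c0); apply: le_trans (cA _ Mnm) _.
  apply: le_trans (qB _ _ (hs n).1 (hs m).1) _.
  have := hN _ nN; have := hN _ mN; have := (hs n).2; have := (hs m).2; move: (n.+1%:R^-1) (m.+1%:R^-1) => x1 x2; lra.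
have Mu : M u by apply: Mc su _ => n; exact: (hs n).1.
exists u => // g Mg; apply/eqP; rewrite -subr_eq0; apply/eqP.
have qg : 0 <= q g by apply: le_trans (cA _ Mg); rewrite mulr_ge0 ?sqn_ge0 ?ltW.
(* On the line through [s n] in the direction [g], [J] stays above [J (s n) - 1/(n + 1)]; the
   discriminant of this quadratic bounds the derivative of [J] at [s n]. *)
have bnd n : (rip (A (s n)) g - L g) ^+ 2 <= n.+1%:R^-1 * q g.
  apply: quadratic_disc => t.
  have := jle _ (MD _ _ t (hs n).1 Mg); rewrite JD; have := (hs n).2; move: (n.+1%:R^-1) => x1; lra.
have lim1 : (fun n => rip (s n) (A g) - L g) @ \oo --> rip u (A g) - L g.
  by apply: cvgB; [exact: scvg_rip|exact: cvg_cst].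
have lim0 : (fun n => rip (s n) (A g) - L g) @ \oo --> (0 : R).
  apply/cvgrPdist_le => e e0.
  have q1 : 0 < 1 + q g by lra.
  have [|N hN] := inv_small (e ^+ 2 / (1 + q g)); first by rewrite divr_gt0 ?exprn_gt0.
  exists N => // n /= nN; rewrite sub0r normrN -sA.
  rewrite -(@ler_pXn2r _ 2) ?nnegrE ?(ltW e0) // real_normK ?num_real //.
  apply: le_trans (bnd n) _; have := hN _ nN; rewrite ler_pdivlMr //.
  have : 0 <= n.+1%:R^-1 :> R by rewrite invr_ge0 ler0n.
  move: (n.+1%:R^-1) => x1.
  nra.
by rewrite sA; exact: (cvg_unique _ lim1 lim0).
Qed.

Lemma closed_subspaceT : closed_subspace (setT : set H).
Proof. by []. Qed.

Lemma riesz (L : H -> R) (D : R) : 0 <= D ->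
  (forall u v, L (u + v) = L u + L v) ->
  (forall a u, L (a%:C *: u) = a * L u) ->
  (forall u, L u ^+ 2 <= D * sqn u) ->
  exists u, forall g, rip u g = L g.
Proof.
move=> D0 LD LZ LB.
have [||||u _ hu] := @variational setT id L 1 D closed_subspaceT _ _ _ _ D0 LD LZ LB => //.
  by move=> u _; rewrite mul1r.
by exists u => g; exact: hu.
Qed.

(** The symmetric case of Lax-Milgram: coercivity gives injectivity, and the variational problem for
    [rip f] gives a preimage of [f]. It is the source of all resolvents below. *)
Lemma coercive_inverse A (c : R) : linear A -> symmetric_op A -> 0 < c ->
  (forall u, c * sqn u <= rip (A u) u) ->
  exists S, [/\ linear S, forall f, A (S f) = f, forall f, S (A f) = f
    & forall f, sqn (S f) <= c ^- 2 * sqn f].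
Proof.
move=> lA sA c0 cA.
have inj u v : A u = A v -> u = v.
  move=> e; apply/eqP; rewrite -subr_eq0; apply/eqP/sqn_eq0.
  have := cA (u - v); rewrite linB // e subrr rip0l.
  have := sqn_ge0 (u - v); nra.
have /choice[S hS] : forall f, exists u, A u = f.
  move=> f.
  have [|||u _ hu] := @variational setT A (rip f) c (sqn f) closed_subspaceT lA sA c0
    (fun u _ => cA u) (sqn_ge0 f).
  - by move=> u v; exact: ripDr.
  - by move=> a u; exact: ripZr.
  - by move=> u; exact: rip_CS.
  by exists u; apply: rip_ext => g; exact: hu.
exists S; split=> // [|f|f].
- by apply/linE => z u v; apply: inj; rewrite (linE A).1 // !hS.
- by apply: inj; rewrite hS.
have := cA (S f); rewrite hS => h.
have := rip_AMGM f (S f) (ltac:(by rewrite invr_gt0) : 0 < c^-1).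
rewrite invrK => h2; rewrite -(ler_pM2l c0).
have -> : c * (c ^- 2 * sqn f) = c^-1 * sqn f by field; rewrite gt_eqF.
lra.
Qed.

Lemma projection_exists (M : set H) : closed_subspace M ->
  exists P, [/\ linear P, forall f, M (P f) &
    forall f g, M g -> rip (f - P f) g = 0].
Proof.
move=> cM; have [M0 Ml Mc] := cM.
have /choice[P hP] : forall f, exists u, M u /\ forall g, M g -> rip (f - u) g = 0.
  move=> f.
  have [|||||||u Mu hu] := @variational M id (rip f) 1 (sqn f) cM _ _ _ _ (sqn_ge0 f) => //.
  - by move=> u _; rewrite mul1r.
  - by move=> u v; exact: ripDr.
  - by move=> a u; exact: ripZr.
  - by move=> u; exact: rip_CS.
  by exists u; split => // g Mg; rewrite ripBl hu // addrN.
have MB u v : M u -> M v -> M (u - v).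
  by move=> Mu Mv; rewrite addrC -scaleN1r; exact: Ml.
have uniq f u v : M u -> M v -> (forall g, M g -> rip (f - u) g = 0) ->
    (forall g, M g -> rip (f - v) g = 0) -> u = v.
  move=> Mu Mv hu hv; apply/eqP; rewrite -subr_eq0; apply/eqP/sqn_eq0.
  have := hu _ (MB _ _ Mu Mv); have := hv _ (MB _ _ Mu Mv).
  by rewrite /sqn !ripBl; lra.
exists P; split=> [|f|f g Mg]; [apply/linE => z u v|exact: (hP f).1|exact: (hP f).2].
apply: (uniq (z *: u + v)); [exact: (hP _).1| | |].
- by apply: Ml; [exact: (hP u).1|exact: (hP v).1].
- by move=> g; exact: (hP _).2.
move=> g Mg; rewrite opprD addrACA -scalerBr ripDl (hP v).2 // addr0.
(* [M] is a complex subspace, so the vanishing of the real part on [M] forces the whole inner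
   product to vanish there. *)
rewrite /rip hdotZl hdotE (hP u).2 // (hP u).2 ?mulr0 //.
by rewrite -[_ *: g]addr0; exact: Ml.
Qed.

Lemma lin_bounded_op S (C : R) : linear S -> (forall f, sqn (S f) <= C * sqn f) ->
  bounded_operator S.
Proof.
move=> lS bS; split=> // x; apply/cvgrPdist_le => e e0.
have ee : e = (complex.Re e)%:C.
  by move: (ger0_Im (ltW e0)); case: (e) => p q /= ->.
rewrite ee ltcR in e0; set r := complex.Re e in ee e0.
have C1 : 0 < 1 + `|C| by have := normr_ge0 C; lra.
have d0 : 0 < Num.sqrt (r ^+ 2 / (1 + `|C|)) by rewrite sqrtr_gt0 divr_gt0 ?exprn_gt0.
rewrite -ltcR in d0.
near=> y.
have : `|x - y| <= (Num.sqrt (r ^+ 2 / (1 + `|C|)))%:C by near: y; apply: cvgr_dist_le.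
rewrite !hnormE ee !lecR ler_sqrt ?divr_ge0 ?sqr_ge0 ?(ltW C1) // => h.
rewrite -(@ler_pXn2r _ 2) ?nnegrE ?sqrtr_ge0 ?(ltW e0) // sqr_sqrtr ?sqn_ge0 //.
rewrite -linB //; apply: le_trans (bS _) _.
move: h; rewrite ler_pdivlMr //; apply: le_trans.
rewrite mulrC ler_wpM2l ?sqn_ge0 //; have := ler_norm C; lra.
Unshelve. all: by end_near. Qed.

Lemma bounded_opP S : bounded_operator S ->
  exists2 C : R, 0 < C & forall f, sqn (S f) <= C * sqn f.
Proof.
move=> [lS cS].
have /cvgrPdist_le/(_ 1 ltr01) := cS 0; rewrite lin0 //.
move=> /nbhs_ballP[d d0 hd].
have dd : d = (complex.Re d)%:C.
  by move: (ger0_Im (ltW d0)); case: (d) => p q /= ->.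
rewrite /= dd ltcR in d0; set r := complex.Re d in dd d0.
have key g : sqn g < r ^+ 2 -> sqn (S g) <= 1.
  move=> hg; have := hd g; rewrite /= -ball_normE /= !sub0r !normrN !hnormE dd ltcR.
  rewrite -(@ltr_pXn2r _ 2) ?nnegrE ?sqrtr_ge0 ?(ltW d0) // sqr_sqrtr ?sqn_ge0 //.
  move=> /(_ hg); rewrite -[1]/(1%:C) lecR -{1}sqrtr1 ler_sqrt ?ler01 //.
exists (4 / r ^+ 2); first by rewrite divr_gt0 ?exprn_gt0.
move=> f; have [s0|s0] := eqVneq (sqn f) 0.
  by rewrite (sqn_eq0 s0) lin0 // sqn0 mulr0.
have sp : 0 < sqn f by rewrite lt_neqAle eq_sym s0 sqn_ge0.
pose t := r / (2 * Num.sqrt (sqn f)).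
have tp : 0 < t by rewrite divr_gt0 // mulr_gt0 // sqrtr_gt0.
have t2 : t ^+ 2 * sqn f = r ^+ 2 / 4.
  rewrite /t -{2}(sqr_sqrtr (ltW sp)); field.
  by rewrite gt_eqF // sqrtr_gt0.
have := key (t%:C *: f); rewrite linZ // !sqnZr t2.
have r2 : 0 < r ^+ 2 by rewrite exprn_gt0.
move=> /(_ ltac:(lra)) h.
rewrite -(ler_pM2l (exprn_gt0 2 tp)) mulrCA t2 (le_trans h) //.
by rewrite le_eqVlt; apply/orP; left; apply/eqP; field; rewrite gt_eqF.
Qed.

End HilbertOperators.

(** * Continuous functional calculus *)

Section PolynomialCalculus.
Variables (R : realType) (H : hilbertSpace R) (T : H -> H).
Hypotheses (lT : linear T) (sT : symmetric_op T).
Implicit Types (u v w f g : H) (a b t : R) (z : R[i]) (p q : {poly R[i]}).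

(** Complex coefficients are allowed so that a polynomial can be split into linear factors. *)
Definition cpoly_op p f : H := \sum_(j < size p) p`_j *: iter j T f.

Lemma cpoly_op_widen p N f : (size p <= N)%N ->
  cpoly_op p f = \sum_(j < N) p`_j *: iter j T f.
Proof.
move=> pN; rewrite /cpoly_op (big_ord_widen _ (fun j => p`_j *: iter j T f) pN).
rewrite big_mkcond /=; apply: eq_bigr => j _; case: ltnP => // pj.
by rewrite nth_default // scale0r.
Qed.

Lemma cpoly_opD p q f : cpoly_op (p + q) f = cpoly_op p f + cpoly_op q f.
Proof.
pose N := maxn (size p) (size q).
rewrite (@cpoly_op_widen (p + q) N) ?size_polyD //.
rewrite (@cpoly_op_widen p N) ?leq_maxl // (@cpoly_op_widen q N) ?leq_maxr //.
by rewrite -big_split /=; apply: eq_bigr => j _; rewrite coefD scalerDl.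
Qed.

Lemma cpoly_opZ z p f : cpoly_op (z *: p) f = z *: cpoly_op p f.
Proof.
rewrite (@cpoly_op_widen (z *: p) (size p)) ?size_scale_leq // scaler_sumr.
by apply: eq_bigr => j _; rewrite coefZ scalerA.
Qed.

Lemma cpoly_opC z f : cpoly_op z%:P f = z *: f.
Proof.
rewrite (@cpoly_op_widen _ 1) ?size_polyC ?leq_b1 //.
by rewrite big_ord_recl big_ord0 addr0 coefC eqxx.
Qed.

Lemma cpoly_opMX p f : cpoly_op (p * 'X) f = cpoly_op p (T f).
Proof.
rewrite (@cpoly_op_widen _ (size p).+1); last first.
  by have [->|p0] := eqVneq p 0; [rewrite mul0r size_poly0|rewrite size_mulX].
rewrite big_ord_recl coefMX eqxx scale0r add0r.
by apply: eq_bigr => j _; rewrite coefMX /= -iterSr.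
Qed.

Lemma iter_linear j : linear (iter j T).
Proof.
apply/linE; elim: j => [//|j ih] z u v /=.
by rewrite ih (linE T).1.
Qed.

Lemma cpoly_op_linear p : linear (cpoly_op p).
Proof.
apply/linE => z u v; rewrite /cpoly_op scaler_sumr -big_split /=.
apply: eq_bigr => j _; rewrite ((linE _).1 (iter_linear j)) scalerDr.
by rewrite !scalerA mulrC.
Qed.

Lemma cpoly_op_comm p f : cpoly_op p (T f) = T (cpoly_op p f).
Proof.
rewrite lin_sum //; apply: eq_bigr => j _.
by rewrite linZ // -iterSr.
Qed.

Lemma cpoly_opM p q f : cpoly_op (p * q) f = cpoly_op p (cpoly_op q f).
Proof.
elim/poly_ind: p q f => [|p c ih] q f.
  by rewrite mul0r -polyC0 !cpoly_opC !scale0r.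
rewrite mulrDl cpoly_opD -mulrA (mulrC 'X) ih cpoly_opMX mul_polyC cpoly_opZ.
by rewrite cpoly_opD cpoly_opC cpoly_opMX cpoly_op_comm.
Qed.

(** The negation of this property says that 0 is an approximate eigenvalue of [A]. *)
Definition bounded_below (A : H -> H) :=
  exists2 c : R, 0 < c & forall f, c * sqn f <= sqn (A f).

Lemma bounded_below_prod (r : seq R[i]) (z0 : R[i]) : z0 != 0 ->
  (forall z, z \in r -> bounded_below (fun f => T f - z *: f)) ->
  bounded_below (cpoly_op (z0 *: \prod_(z <- r) ('X - z%:P))).
Proof.
move=> z0n; elim: r => [|z r ih] h.
  exists (normc z0 ^+ 2).
    rewrite exprn_gt0 // lt_neqAle eq_sym; apply/andP; split.
      by apply: contra z0n => /eqP/eq0_normc ->.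
    by rewrite -lecR; exact: (normr_ge0 z0).
  by move=> f; rewrite big_nil -polyC1 cpoly_opZ cpoly_opC scale1r sqnZ.
have [c c0 hc] := ih (fun y yr => h y (mem_behead (s := z :: r) yr)).
have [d d0 hd] := h z (mem_head _ _).
exists (c * d); first exact: mulr_gt0.
move=> f; rewrite big_cons cpoly_opZ [_ * \prod_(_ <- _) _]mulrC cpoly_opM -cpoly_opZ.
have -> : cpoly_op ('X - z%:P) f = T f - z *: f.
  have -> : 'X - z%:P = 1%:P * 'X + (- z)%:P by rewrite polyC1 mul1r polyCN.
  by rewrite cpoly_opD cpoly_opMX !cpoly_opC scale1r scaleNr.
apply: le_trans (hc _).
by rewrite -mulrA ler_wpM2l // ltW.
Qed.

Lemma rip_i u v : rip ('i *: u) v = - rip u ('i *: v).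
Proof. by rewrite rip_iZl rip_iZr. Qed.

Lemma symmetric_rip_i f : rip (T f) ('i *: f) = 0.
Proof.
have h : rip (T f) ('i *: f) = - rip (T f) ('i *: f).
  by rewrite {1}sT linZ // ripC rip_i.
by lra.
Qed.

(** Since [T - a] is symmetric, the cross term with [i b f] vanishes and the squared norm of
    [(T - a - i b) f] is that of [(T - a) f] plus [b^2] times that of [f]. *)
Lemma imag_bounded_below a b : b != 0 ->
  bounded_below (fun f => T f - (a +i* b) *: f).
Proof.
move=> b0; exists (b ^+ 2); first by rewrite exprn_even_gt0.
move=> f; have -> : T f - (a +i* b) *: f = (T f - a%:C *: f) - b%:C *: ('i *: f).
  rewrite scalerA -addrA -opprD -scalerDl; congr (_ - _ *: _).
  by apply/eqP; rewrite eq_complex /=; apply/andP; split; apply/eqP; ring.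
rewrite sqnB ripZr ripBl symmetric_rip_i ripZl rip_iZr hdot_sqn /=.
have -> : sqn (b%:C *: ('i *: f)) = b ^+ 2 * sqn f.
  by rewrite sqnZr sqnZ /= sqr_sqrtr ?addr_ge0 ?sqr_ge0 //; ring.
by have := sqn_ge0 (T f - a%:C *: f); lra.
Qed.

Lemma spectrum_of_not_bounded_below z :
  ~ bounded_below (fun f => T f - z *: f) -> spectrum T z.
Proof.
move=> nb [S [bS S1 S2]]; apply: nb.
have [C C0 hC] := bounded_opP bS.
exists C^-1; first by rewrite invr_gt0.
by move=> f; rewrite ler_pdivrMl // -{1}(S1 f).
Qed.

(** Half of the spectral mapping theorem: a product of linear factors that is not bounded below has
    a factor [T - z] that is not, and such a [z] has to be real. *)
Lemma root_in_spectrum q : q != 0 -> ~ bounded_below (cpoly_op q) ->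
  exists2 t : R, root q t%:C & spectrum T t%:C.
Proof.
move=> q0 nb; have [r er] := closed_field_poly_normal q.
have l0 : lead_coef q != 0 by rewrite lead_coef_eq0.
have [z zr hz] : exists2 z, z \in r & ~ bounded_below (fun f => T f - z *: f).
  apply: contrapT => h; apply: nb; rewrite er; apply: bounded_below_prod => // z zr.
  by apply: contrapT => nz; apply: h; exists z.
have rz : root q z by rewrite er rootZ // root_prod_XsubC.
case: z zr hz rz => a b zr hz rz.
have [b0|b0] := eqVneq b 0; last by case: hz; exact: imag_bounded_below.
by rewrite b0 in hz rz; exists a => //; exact: spectrum_of_not_bounded_below.
Qed.

Local Notation rc := (real_complex R).

Lemma poly_operatorE (p : {poly R}) f :
  poly_operator p T f = cpoly_op (map_poly rc p) f.
Proof.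
rewrite /poly_operator /cpoly_op size_map_poly.
by apply: eq_bigr => j _; rewrite coef_map.
Qed.

Lemma poly_operator_linear (p : {poly R}) : linear (poly_operator p T).
Proof. by apply/linE => z u v; rewrite !poly_operatorE; exact: (linE _).1 (cpoly_op_linear _) z u v. Qed.
Lemma poly_operatorD (p q : {poly R}) f :
  poly_operator (p + q) T f = poly_operator p T f + poly_operator q T f.
Proof. by rewrite !poly_operatorE rmorphD cpoly_opD. Qed.
Lemma poly_operatorM (p q : {poly R}) f :
  poly_operator (p * q) T f = poly_operator p T (poly_operator q T f).
Proof. by rewrite !poly_operatorE rmorphM cpoly_opM. Qed.
Lemma poly_operatorC a f : poly_operator a%:P T f = a%:C *: f.
Proof. by rewrite poly_operatorE map_polyC cpoly_opC. Qed.
Lemma poly_operatorX f : poly_operator 'X T f = T f.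
Proof.
by rewrite poly_operatorE map_polyX -['X]mul1r cpoly_opMX -polyC1 cpoly_opC scale1r.
Qed.
Lemma poly_operatorN (p : {poly R}) f :
  poly_operator (- p) T f = - poly_operator p T f.
Proof.
rewrite -mulN1r -polyC1 -polyCN poly_operatorM poly_operatorC.
by rewrite rmorphN1 scaleN1r.
Qed.
Lemma poly_operatorB (p q : {poly R}) f :
  poly_operator (p - q) T f = poly_operator p T f - poly_operator q T f.
Proof. by rewrite poly_operatorD poly_operatorN. Qed.

Lemma poly_operator_sym (p : {poly R}) : symmetric_op (poly_operator p T).
Proof.
elim/poly_ind: p => [|p c ih] u v.
  by rewrite -polyC0 !poly_operatorC ripZl ripZr.
rewrite !(poly_operatorD, poly_operatorM, poly_operatorX, poly_operatorC).
rewrite ripDl ripDr ripZl ripZr ih sT.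
congr (rip _ _ + _); rewrite -[LHS]poly_operatorX -[in RHS](poly_operatorX v).
by rewrite -!poly_operatorM mulrC.
Qed.

Hypothesis bT : bounded_operator T.

Lemma poly_operator_bounded (p : {poly R}) :
  exists2 C : R, 0 < C & forall f, sqn (poly_operator p T f) <= C * sqn f.
Proof.
have [D D0 hD] := bounded_opP bT.
elim/poly_ind: p => [|p c [C C0 ih]].
  by exists 1 => // f; rewrite -polyC0 poly_operatorC sqnZr; have := sqn_ge0 f; lra.
have c2 := sqr_ge0 c.
exists (2 * (C * D) + 2 * c ^+ 2).
  by have := mulr_gt0 C0 D0; lra.
move=> f; rewrite poly_operatorD poly_operatorM poly_operatorC poly_operatorX.
apply: le_trans (sqnD_le _ _) _; rewrite sqnZr.
have := ih (T f); have := ler_wpM2l (ltW C0) (hD f); lra.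
Qed.

Lemma form_CS (B : H -> H) f g : linear B -> symmetric_op B ->
  (forall f, 0 <= rip (B f) f) -> rip (B f) g ^+ 2 <= rip (B f) f * rip (B g) g.
Proof.
move=> lB sB pB; apply: quadratic_disc => t.
have := pB (f + t%:C *: g); rewrite linD // linZ // !(ripDl, ripDr, ripZl, ripZr).
by rewrite (ripC (B g) f) -sB; lra.
Qed.

(** The infimum [lam] of the numerical range is an approximate eigenvalue. Indeed [B = p(T) - lam]
    has a nonnegative form, and Cauchy-Schwarz for it bounds the fourth power of the norm of [B f]
    by [<B f, f> <B B f, B f>], which is small for nearly minimizing unit vectors. The vector [f0]
    makes the unit sphere nonempty. *)
Lemma numerical_bound (p : {poly R}) (f0 : H) : f0 != 0 ->
  exists lam : R, (forall f, lam * sqn f <= rip (poly_operator p T f) f) /\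
    ~ bounded_below (poly_operator (p - lam%:P) T).
Proof.
move=> f00; set A := poly_operator p T.
have lA : linear A := poly_operator_linear p.
have [C C0 hC] := poly_operator_bounded p.
pose E := [set rip (A f) f | f in [set f | sqn f = 1]].
have unit f : f != 0 -> exists c : R, 0 < c /\ c ^+ 2 * sqn f = 1.
  move=> fn; have sp : 0 < sqn f.
    rewrite lt_neqAle eq_sym sqn_ge0 andbT.
    by apply/negP => /eqP/sqn_eq0/eqP; exact/negP.
  exists (Num.sqrt (sqn f))^-1; rewrite invr_gt0 sqrtr_gt0; split => //.
  by rewrite exprVn sqr_sqrtr ?sqn_ge0 // mulVf // gt_eqF.
have hE : has_inf E.
  split.
    have [c [c0 hc]] := unit _ f00; exists (rip (A (c%:C *: f0)) (c%:C *: f0)).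
    by exists (c%:C *: f0) => //=; rewrite sqnZr.
  exists (- ((C + 1) / 2)) => _ [f /= f1 <-].
  have := rip_le (- A f) f; rewrite ripNl sqnN; have := hC f; rewrite f1 -/A; lra.
pose lam := inf E; exists lam.
have lb f : lam * sqn f <= rip (A f) f.
  have [->|fn] := eqVneq f 0; first by rewrite sqn0 rip0r mulr0.
  have [c [c0 hc]] := unit _ fn.
  have : lam <= rip (A (c%:C *: f)) (c%:C *: f).
    by apply: ge_inf; [exact: hE.2|exists (c%:C *: f) => //=; rewrite sqnZr].
  rewrite linZ // ripZl ripZr => h.
  have c2 : 0 < c ^+ 2 by rewrite exprn_gt0.
  by rewrite -(ler_pM2l c2) mulrCA hc mulr1; move: h; rewrite mulrA -expr2.
split => //; move=> [d d0 hd].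
set B := poly_operator (p - lam%:P) T in hd.
have lB : linear B := poly_operator_linear _.
have sB : symmetric_op B := poly_operator_sym _.
have BE f : rip (B f) f = rip (A f) f - lam * sqn f.
  by rewrite /B poly_operatorB poly_operatorC ripBl ripZl.
have pB f : 0 <= rip (B f) f by rewrite BE subr_ge0.
have [D D0 hD] := poly_operator_bounded (p - lam%:P).
have K0 : 0 < (D ^+ 2 + D) / 2 by have := exprn_gt0 2 D0; lra.
(* On unit vectors [<B B f, B f>] is at most [(D^2 + D) / 2], while a lower bound [d] for [B] would
   force the product in Cauchy-Schwarz to be at least [d^2]; this tolerance contradicts it. *)
have [_ [f f1 <-] hf] := inf_adherent
  (ltac:(by rewrite divr_gt0 ?exprn_gt0 //) : 0 < d ^+ 2 / ((D ^+ 2 + D) / 2)) hE.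
have h1 := form_CS f (B f) lB sB pB.
have h2 := hD (B f); have h3 := hD f; rewrite -/B in h2 h3.
have h4 := rip_le (B (B f)) (B f).
have h5 := hd f; rewrite f1 in h3 h5.
rewrite -[rip (B f) (B f)]/(sqn (B f)) in h1.
have h6 : rip (B f) f < d ^+ 2 / ((D ^+ 2 + D) / 2).
  by rewrite BE f1; move: hf; rewrite -/lam -/A; move: (d ^+ 2 / _) => y; lra.
have h7 : rip (B (B f)) (B f) <= (D ^+ 2 + D) / 2.
  have := ler_wpM2l (ltW D0) h3; rewrite expr2; lra.
rewrite ltr_pdivlMr // in h6.
have h8 := pB f.
have h9 : d ^+ 2 <= sqn (B f) ^+ 2.
  by rewrite ler_pXn2r ?nnegrE ?sqn_ge0 ?(ltW d0) //; lra.
by have := ler_wpM2l h8 h7; lra.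
Qed.

(** The infimum of the numerical range of [p(T)] is the value of [p] at a point of the spectrum, by
    [numerical_bound] and [root_in_spectrum]. *)
Lemma poly_operator_ge0 (p : {poly R}) f :
  (forall t, spectrum T t%:C -> 0 <= p.[t]) ->
  0 <= rip (poly_operator p T f) f.
Proof.
move=> pp; have [->|f0] := eqVneq f 0; first by rewrite rip0r.
have mapn (q : {poly R}) : q != 0 -> map_poly rc q != 0 by rewrite map_poly_eq0.
have rootE (q : {poly R}) t : root (map_poly rc q) t%:C -> q.[t] = 0.
  by rewrite /root horner_map => /eqP/complexI.
have main (q : {poly R}) lam : q - lam%:P != 0 ->
    ~ bounded_below (poly_operator (q - lam%:P) T) ->
    exists2 t, q.[t] = lam & spectrum T t%:C.
  move=> qn nb; have [|t rt st] := root_in_spectrum (mapn _ qn).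
    by move=> bb; apply: nb; case: bb => c c0 hc; exists c => // g;
      rewrite poly_operatorE.
  exists t => //; have := rootE _ _ rt; rewrite hornerD hornerN hornerC => /eqP.
  by rewrite subr_eq0 => /eqP.
have [lam [h1 h2]] := numerical_bound p f0.
have [t tE st] : exists2 t, p.[t] = lam & spectrum T t%:C.
  have [/eqP|n0] := eqVneq (p - lam%:P) 0; last exact: main.
  rewrite subr_eq0 => /eqP ->.
  (* When [p] is constant, [p - lam] has no distinguished root; the polynomial ['X] shows that the
     spectrum is not empty. *)
  have [mu [_ h4]] := numerical_bound 'X f0.
  have [|t _ st] := main 'X mu _ h4; first by rewrite polyXsubC_eq0.
  by exists t => //; rewrite hornerC.
apply: le_trans (h1 f); rewrite mulr_ge0 ?sqn_ge0 // -tE; exact: pp.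
Qed.

(** Positivity of [e^2 - p^2] on the spectrum, transported to the operator. *)
Lemma poly_operator_norm (p : {poly R}) (e : R) f :
  (forall t, spectrum T t%:C -> `|p.[t]| <= e) ->
  sqn (poly_operator p T f) <= e ^+ 2 * sqn f.
Proof.
move=> pe; have := @poly_operator_ge0 ((e ^+ 2)%:P - p * p) f.
rewrite poly_operatorB poly_operatorC poly_operatorM ripBl ripZl.
rewrite poly_operator_sym subr_ge0; apply=> t st.
rewrite hornerD hornerN hornerM hornerC subr_ge0 -expr2 -real_normK ?num_real //.
by rewrite ler_pXn2r ?nnegrE ?pe // (le_trans _ (pe _ st)).
Qed.

End PolynomialCalculus.

(** * Moduli of continuity with linear growth *)

Section Modulus.
Variable R : realType.
Implicit Types (D : set R) (psi : R -> R) (a b e s t : R).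

Definition modulus D psi := forall e, 0 < e -> exists2 C : R, 0 <= C &
  forall t s, D t -> D s -> `|psi t - psi s| <= e * (1 + `|s|) + C * `|t - s|.

Lemma within_continuousE D psi : {within D, continuous psi} ->
  forall x, D x -> forall e, 0 < e -> exists2 d, 0 < d &
    forall y, D y -> `|x - y| < d -> `|psi x - psi y| <= e.
Proof.
move=> /subspace_continuousP cD x Dx e e0.
have /cvgrPdist_le/(_ e e0) := cD x Dx.
move=> /nbhs_ballP[d /= d0 hd]; exists d => // y Dy xy; exact: hd.
Qed.

(** If every constant [n] failed, there would be pairs at distance O(1/n) whose images stay more
    than [e] apart; a limit point of the first components contradicts continuity there. *)
Lemma segment_modulus a b psi : a <= b -> {within `[a, b], continuous psi} ->
  forall e, 0 < e -> exists2 C : R, 0 <= C &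
    forall t s, t \in `[a, b] -> s \in `[a, b] -> `|psi t - psi s| <= e + C * `|t - s|.
Proof.
move=> ab cpsi e e0; apply: contrapT => hC.
have [cM _ hM] := EVT_max ab cpsi; have [cm _ hm] := EVT_min ab cpsi.
pose B := psi cM - psi cm.
have /choice[ts hts] : forall n : nat, exists ts : R * R,
    [/\ ts.1 \in `[a, b], ts.2 \in `[a, b] &
        e + n%:R * `|ts.1 - ts.2| < `|psi ts.1 - psi ts.2|].
  move=> n; apply: contrapT => hn; apply: hC; exists n%:R => // t s ht hs.
  by rewrite leNgt; apply/negP => h; apply: hn; exists (t, s).
pose t_ n := (ts n).1.
have dist n : n%:R * `|(ts n).1 - (ts n).2| <= B.
  have [h1 h2 h3] := hts n.
  have : `|psi (ts n).1 - psi (ts n).2| <= B.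
    have := hM _ h1; have := hM _ h2; have := hm _ h1; have := hm _ h2.
    by rewrite ler_norml /B; lra.
  by move: (_ * _) h3 => x; lra.
have [f fi /cvg_ex[l fl]] : exists2 f : nat -> nat, increasing_seq f & cvgn (t_ \o f).
  apply: bolzano_weierstrass; exists (`|a| + `|b|); split; first exact: num_real.
  move=> x hx n _ /=; have [h1 _ _] := hts n; apply: ltW.
  apply: le_lt_trans hx; rewrite -/(t_ n) in h1.
  move: h1; rewrite in_itv /= => /andP[h1 h2].
  rewrite ler_norml; have := ler_norm b; have := ler_norm (- a).
  have := normr_ge0 b; have := normr_ge0 a; rewrite normrN; lra.
have lab : l \in `[a, b].
  have : `[a, b]%classic l.
    apply: (@closed_cvg _ _ \oo _ (t_ \o f) `[a, b]%classic _ _ _ fl).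
      exact: itv_closed.
    by apply: nearW => n /=; have [] := hts (f n).
  by [].
have [d d0 hd] := within_continuousE cpsi lab (ltac:(by rewrite divr_gt0) : 0 < e / 2).
have fn n : (n <= f n)%N.
  elim: n => // n ih; apply: leq_ltn_trans ih _.
  by have /increasing_seqP/(_ n) := fi.
have /cvgrPdist_lt/(_ (d / 2) (ltac:(by rewrite divr_gt0))) [N _ hN] := fl.
have d2 : 0 < d / 2 by rewrite divr_gt0.
(* Late enough for closeness to [l], and for [dist] to put the two points of the pair within [d / 2]
   of each other. *)
pose n := (N + (Num.truncn (B / (d / 2))).+1)%N.
have nN : (N <= n)%N by exact: leq_addr.
have [h1 h2 h3] := hts (f n).
have h4 := dist (f n).
have h5 : `|(ts (f n)).1 - (ts (f n)).2| < d / 2.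
  rewrite ltNge; apply/negP => h.
  have h6 : B / (d / 2) < (f n)%:R.
    apply: lt_le_trans (truncnS_gt _) _.
    by rewrite ler_nat; apply: leq_trans (fn n); exact: leq_addl.
  rewrite ltr_pdivrMr // in h6.
  have := ler_wpM2l (ler0n R (f n)) h.
  by move: h4 h6; move: (_ * `|_|) (_ * (d / 2)) => x y; lra.
have h6 := hN n nN; rewrite /= -/(t_ (f n)) in h6.
have h7 : `|l - (ts (f n)).1| < d by apply: lt_trans h6 _; lra.
have h8 : `|l - (ts (f n)).2| < d.
  apply: le_lt_trans (ler_distD (ts (f n)).1 _ _) _; rewrite /t_ in h6; lra.
have h9 := hd _ h1 h7; have h10 := hd _ h2 h8.
have h11 := ler_distD (psi l) (psi (ts (f n)).1) (psi (ts (f n)).2).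
rewrite (distrC _ (psi l)) in h11.
have : 0 <= (f n)%:R * `|(ts (f n)).1 - (ts (f n)).2| by rewrite mulr_ge0.
by move: (_ * `|_|) h3 => x; lra.
Qed.

Lemma modulus_segment a b psi : a <= b -> {within `[a, b], continuous psi} ->
  modulus `[a, b] psi.
Proof.
move=> ab cpsi e e0; have [C C0 hC] := segment_modulus ab cpsi e0.
exists C => // t s ht hs; apply: le_trans (hC _ _ ht hs) _.
by rewrite lerD2r mulrDr mulr1 lerDl mulr_ge0 // ltW.
Qed.

(** Subtracting the asymptote leaves [phi t = psi t - l t], which is o(t): it is at most [e / 8 * t]
    beyond [A], and compactness handles the segment [[0, A + 1]]. The extra unit ensures that two
    points at distance less than 1 lie both in that segment or both beyond [A]. *)
Lemma modulus_ray psi (l : R) : {within `[0, +oo[, continuous psi} ->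
  psi t / t @[t --> +oo] --> l -> modulus `[0, +oo[ psi.
Proof.
have above (A u : R) : A + 1 < u -> A <= u by lra.
have nearby (A u v d : R) : A + 1 < u -> u <= v + d -> d < 1 -> A <= v by lra.
move=> cpsi pl e e0.
pose phi t := psi t - l * t.
have e8 : 0 < e / 8 by lra.
have [A A1 hA] : exists2 A : R, 1 <= A & forall t, A <= t -> `|phi t| <= e / 8 * t.
  have /cvgrPdist_le/(_ _ e8)[A0 [_ hA0]] := pl.
  exists (1 + `|A0|); first by have := normr_ge0 A0; lra.
  move=> t At; have t0 : 0 < t by have := normr_ge0 A0; lra.
  have := hA0 t (ltac:(have := ler_norm A0; lra)).
  have -> : l - psi t / t = - (phi t / t) by rewrite /phi; field; rewrite gt_eqF.
  by rewrite normrN normrM normfV (gtr0_norm t0) ler_pdivrMr.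
have sub : `[0, A + 1] `<=` `[0, +oo[.
  by move=> x /=; rewrite !in_itv /= => /andP[-> _].
have cp : {within `[0, A + 1], continuous psi}.
  exact: continuous_subspaceW cpsi.
have [C C0 hC] := segment_modulus (ltac:(lra) : 0 <= A + 1) cp e8.
have A10 : `[0, A + 1]%classic 0 by rewrite /= in_itv /=; lra.
pose B := `|psi 0| + e / 8 + C * (A + 1) + `|l| * (A + 1).
have l0 := normr_ge0 l.
have B0 : 0 <= B.
  rewrite /B !addr_ge0 ?mulr_ge0 //; lra.
have phiB t : 0 <= t -> `|phi t| <= B + e / 8 * t.
  move=> t0; have [tA|tA] := leP t (A + 1); last first.
    by have := hA t (ltac:(lra)); lra.
  have := hC t 0 (ltac:(by rewrite in_itv /= t0)) (ltac:(rewrite in_itv /=; lra)).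
  rewrite subr0 (ger0_norm t0) => h.
  have h2 := ler_normB (psi t) (l * t); rewrite normrM (ger0_norm t0) in h2.
  have h3 := ler_normD (psi t - psi 0) (psi 0); rewrite subrK in h3.
  have := ler_wpM2l C0 tA; have := ler_wpM2l l0 tA.
  rewrite /phi /B; have : 0 <= e / 8 * t by rewrite mulr_ge0 // ltW.
  by lra.
clearbody B.
exists (C + `|l| + `|l| + 2 * B + e); first by lra.
move=> t s /=; rewrite !in_itv /= !andbT => t0 s0; rewrite (ger0_norm s0).
have d0 := normr_ge0 (t - s).
have [tA|tA] := boolP ((t <= A + 1) && (s <= A + 1)).
  move/andP: tA => [tA sA].
  have := hC t s (ltac:(by rewrite in_itv /= t0)) (ltac:(by rewrite in_itv /= s0)).
  have := mulr_ge0 (ltW e0) s0; have := mulr_ge0 l0 d0; have := mulr_ge0 B0 d0.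
  have := mulr_ge0 (ltW e0) d0; lra.
have h1 := ler_normB (phi t) (phi s).
have h2 := ler_normD (phi t - phi s) (l * (t - s)).
have E : phi t - phi s + l * (t - s) = psi t - psi s by rewrite /phi; ring.
rewrite E normrM in h2.
have td : t <= s + `|t - s| by have := ler_norm (t - s); lra.
have sd : s <= t + `|t - s| by rewrite distrC; have := ler_norm (s - t); lra.
have et := ler_wpM2l (ltW e0) td.
have C0d := mulr_ge0 C0 d0; have B0d := mulr_ge0 B0 d0; have l0d := mulr_ge0 l0 d0.
have e0d := mulr_ge0 (ltW e0) d0; have e0s := mulr_ge0 (ltW e0) s0.
(* For points at distance at least 1, the bounded part of [phi] is paid for by the summand [2 * B]
   of the constant. *)
have [d1|d1] := leP 1 `|t - s|.
  have := phiB t t0; have := phiB s s0; have := ler_wpM2l B0 d1; lra.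
have [h3 h4] : A <= t /\ A <= s.
  move: tA; rewrite negb_and -!ltNge => /orP[] hA1.
    by split; [exact: above|exact: nearby hA1 td d1].
  by split; [exact: nearby hA1 sd d1|exact: above].
by have := hA t h3; have := hA s h4; lra.
Qed.

End Modulus.

(** * Weierstrass approximation by Bernstein polynomials *)

Section Weierstrass.
Variable R : realType.
Implicit Types (g : nat -> R) (A B c e s t x : R) (n : nat).

(* [(bernstein n g).[x]] is the expectation of [g] under the binomial law of
   parameters [n] and [x]. *)
Fixpoint bernstein n g : {poly R} :=
  if n is m.+1 then (1 - 'X) * bernstein m g + 'X * bernstein m (g \o S)
  else (g 0%N)%:P.

(** For a binomial variable K of parameters [n] and [x], the mean of [(K - c)^2] is its squared bias
    plus its variance [n x (1 - x)]. Conditioning on the first trial replaces [c] by [c - 1] on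
    success, which is the induction. *)
Lemma bernstein_dist n g A B c s x : 0 <= x <= 1 ->
  (forall k, (k <= n)%N -> `|g k - s| <= A + B * (k%:R - c) ^+ 2) ->
  `|(bernstein n g).[x] - s| <= A + B * ((n%:R * x - c) ^+ 2 + n%:R * x * (1 - x)).
Proof.
move=> /andP[x0 x1]; elim: n g c => [|n ih] g c h /=.
  by rewrite hornerC; apply: le_trans (h 0%N _) _ => //; lra.
have h1 := ih g c (fun k kn => h k (leqW kn)).
have h2 : `|(bernstein n (g \o S)).[x] - s| <=
    A + B * ((n%:R * x - (c - 1)) ^+ 2 + n%:R * x * (1 - x)).
  apply: ih => k kn; apply: le_trans (h k.+1 kn) _.
  by rewrite -natr1; have -> : k%:R + 1 - c = k%:R - (c - 1) :> R by ring.
rewrite !(hornerD, hornerM, hornerN, hornerX, hornerC).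
set b1 := (bernstein n g).[x] in h1 *; set b2 := (bernstein n _).[x] in h2 *.
have -> : (1 - x) * b1 + x * b2 - s = (1 - x) * (b1 - s) + x * (b2 - s) by ring.
apply: le_trans (ler_normD _ _) _; rewrite !normrM (ger0_norm x0).
rewrite (ger0_norm (ltac:(lra) : 0 <= 1 - x)).
apply: le_trans (lerD (ler_wpM2l (ltac:(lra) : 0 <= 1 - x) h1) (ler_wpM2l x0 h2)) _.
rewrite -natr1 le_eqVlt; apply/orP; left; apply/eqP; ring.
Qed.

Lemma weierstrass (a b : R) (psi : R -> R) : a < b ->
  (forall e, 0 < e -> exists2 C : R, 0 <= C & forall t s,
     t \in `[a, b] -> s \in `[a, b] -> `|psi t - psi s| <= e + C * `|t - s|) ->
  exists p : nat -> {poly R}, forall e, 0 < e -> \forall n \near \oo,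
    forall t, t \in `[a, b] -> `|(p n).[t] - psi t| <= e.
Proof.
move=> ab hpsi; have ba : 0 < b - a by lra.
exists (fun n => bernstein n.+1 (fun k => psi (a + (b - a) * (k%:R / n.+1%:R)))
          \Po ((b - a)^-1 *: ('X - a%:P))) => e e0.
have e4 : 0 < e / 4 by lra.
have [C C0 hC] := hpsi _ e4.
(* Chosen so that [C (b - a) y <= e / 4 + K y^2]: the Lipschitz term becomes a variance term, which
   is O(1/m). *)
pose K := (C * (b - a)) ^+ 2 / e.
have K0 : 0 <= K by rewrite divr_ge0 ?sqr_ge0 // ltW.
have [N _ hN] := near_infty_natSinv_lt (PosNum (divr_gt0 e4 (ltac:(lra) : 0 < 1 + K))).
exists N => // n nN t tab; have {hN}/= := hN n nN.
set m : R := n.+1%:R => hN.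
have m0 : 0 < m by rewrite ltr0n.
rewrite horner_comp.
have -> : ((b - a)^-1 *: ('X - a%:P)).[t] = (b - a)^-1 * (t - a).
  by rewrite hornerZ hornerXsubC.
set x := (b - a)^-1 * (t - a).
move: (tab); rewrite in_itv /= => /andP[ta tb].
have x01 : 0 <= x <= 1.
  by rewrite /x mulr_ge0 ?invr_ge0 ?ler_pdivrMl //=; lra.
have xE : t = a + (b - a) * x by rewrite /x; field; rewrite gt_eqF.
have key := @bernstein_dist n.+1 (fun k => psi (a + (b - a) * (k%:R / m))) (e / 2)
  (K / m ^+ 2) (m * x) (psi t) x x01.

apply: le_trans (key _) _.
  move=> k kn; have k01 : 0 <= k%:R / m <= 1.
    by rewrite divr_ge0 ?ler_pdivrMr ?mul1r ?ler_nat // ltW.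
  apply: le_trans (hC _ _ _ tab) _.
    rewrite in_itv /=; move/andP: k01 => [k0 k1].
    have := mulr_ge0 (ltW ba) k0; have := ler_wpM2l (ltW ba) k1.
    by move: (_ * _) => y; lra.
  rewrite [X in _ - X]xE.
  have -> : a + (b - a) * (k%:R / m) - (a + (b - a) * x) = (b - a) * ((k%:R - m * x) / m).
    by field; rewrite gt_eqF.
  set d := k%:R - m * x.
  rewrite normrM (gtr0_norm ba).
  have -> : K / m ^+ 2 * d ^+ 2 = K * (d / m) ^+ 2 by field; rewrite gt_eqF.
  rewrite -[(d / m) ^+ 2]real_normK ?num_real //; move: `|d / m| => y.
  rewrite /K; have := sqr_ge0 (C * (b - a) * y - e / 2).
  have -> : (C * (b - a)) ^+ 2 / e * y ^+ 2 = (C * (b - a) * y) ^+ 2 / e by field; rewrite gt_eqF.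
  rewrite mulrA; move: (C * (b - a) * y) => w hw.
  have : w <= w ^+ 2 / e + e / 4.
    rewrite -(ler_pM2l e0); have -> : e * (w ^+ 2 / e + e / 4) = w ^+ 2 + e ^+ 2 / 4 by field; rewrite gt_eqF.
    by nra.
  by lra.
rewrite addrN expr0n add0r /=.
have -> : K / m ^+ 2 * (m * x * (1 - x)) = K * (x * (1 - x)) * m^-1 by field; rewrite gt_eqF.
have : m^-1 * (1 + K) <= e / 4 by rewrite -ler_pdivlMr ?ltW //; lra.
have xx : x * (1 - x) <= 1 by move/andP: x01 => [x0 x1]; nra.
have mi : 0 < m^-1 by rewrite invr_gt0.
have hy : K * (x * (1 - x)) <= K by rewrite ler_piMr.
have hz := ler_wpM2r (ltW mi) hy.
clear key hN; clearbody K x m; move: (K * (x * _)) hz => y; lra.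
Qed.

End Weierstrass.

(** * Existence of the functional calculus and the inequalities it transports *)

Section FunctionalCalculus.
Variables (R : realType) (H : hilbertSpace R) (T : H -> H).
Hypotheses (lT : linear T) (sT : symmetric_op T) (bT : bounded_operator T).
Implicit Types (u v f g : H) (a b e t s c : R) (S : H -> H) (psi : R -> R).

Lemma hnorm_leE u v e : 0 <= e ->
  (`|u| <= e%:C * `|v|) = (sqn u <= e ^+ 2 * sqn v).
Proof.
move=> e0; rewrite !hnormE -rmorphM /= lecR -[in RHS](sqr_sqrtr (sqn_ge0 u)).
rewrite -[sqn v in RHS](sqr_sqrtr (sqn_ge0 v)) -exprMn.
by rewrite ler_pXn2r // nnegrE ?mulr_ge0 ?sqrtr_ge0.
Qed.

(** For [t] below the lower bound of the form, [T - t] is coercive and thus has a bounded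
    inverse. *)
Lemma spectrum_lower m t : (forall f, m * sqn f <= rip (T f) f) ->
  spectrum T t%:C -> m <= t.
Proof.
move=> hm; rewrite leNgt => st; apply/negP => tm; apply: st.
have lA : linear (fun f => T f - t%:C *: f).
  apply/linE => z u v; rewrite (linE T).1 // scalerDr opprD addrACA scalerBr.
  by rewrite !scalerA mulrC.
have sA : symmetric_op (fun f => T f - t%:C *: f).
  by move=> u v; rewrite ripBl ripBr ripZl ripZr sT.
have [|u|S [lS S1 S2 S3]] := coercive_inverse lA sA (c := m - t).
- by rewrite subr_gt0.
- by rewrite ripBl ripZl; have := hm u; rewrite /sqn; lra.
by exists S; split => //; exact: lin_bounded_op S3.
Qed.

Lemma spectrum_upper m t : (forall f, rip (T f) f <= m * sqn f) ->
  spectrum T t%:C -> t <= m.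
Proof.
move=> hm; rewrite leNgt => st; apply/negP => tm; apply: st.
have lA : linear (fun f => t%:C *: f - T f).
  apply/linE => z u v; rewrite (linE T).1 // scalerDr opprD addrACA scalerBr.
  by rewrite !scalerA mulrC.
have sA : symmetric_op (fun f => t%:C *: f - T f).
  by move=> u v; rewrite ripBl ripBr ripZl ripZr sT.
have [|u|S [lS S1 S2 S3]] := coercive_inverse lA sA (c := t - m).
- by rewrite subr_gt0.
- by rewrite ripBl ripZl; have := hm u; rewrite /sqn; lra.
have lN : linear (fun f => - S f).
  by apply/linE => z u v; rewrite (linE S).1 // opprD scalerN.
exists (fun f => - S f); split => [|f|f].
- by apply: (lin_bounded_op (C := (t - m) ^- 2)) => // f; rewrite sqnN.
- by rewrite -linN // opprB S2.
rewrite (linN _ lT) scalerN opprK addrC; exact: S1.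
Qed.

(** By [poly_operator_norm] the operators [p n (T)] are Cauchy in operator norm. Their limit
    satisfies the defining property, so [xget] does not return its default value. *)
Lemma fun_calculus_exists psi (p : nat -> {poly R}) :
  (forall e, 0 < e -> \forall n \near \oo,
     forall t, spectrum T t%:C -> `|(p n).[t] - psi t| <= e) ->
  is_fun_calculus T psi (fun_calculus T psi).
Proof.
move=> hp; apply: xgetPex.
have cau e : 0 < e -> exists N, forall n m f, (N <= n)%N -> (N <= m)%N ->
    sqn (poly_operator (p n) T f - poly_operator (p m) T f) <= e ^+ 2 * sqn f.
  move=> e0; have [N _ hN] := hp _ (ltac:(by rewrite divr_gt0) : 0 < e / 2).
  exists N => n m f nN mN; rewrite -poly_operatorB //.
  apply: poly_operator_norm => // t st.
  have := hN n nN t st; have := hN m mN t st; rewrite hornerD hornerN.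
  rewrite !ler_norml; lra.
have /choice[S hS] : forall f, exists u, scvg (fun n => poly_operator (p n) T f) u.
  move=> f; apply: hilbert_complete => e e0.
  have f1 : 0 < 1 + sqn f by have := sqn_ge0 f; lra.
  have [|N hN] := cau (Num.sqrt (e / (1 + sqn f))).
    by rewrite sqrtr_gt0 divr_gt0.
  exists N => n m nN mN; apply: le_trans (hN _ _ f nN mN) _.
  rewrite sqr_sqrtr ?divr_ge0 ?(ltW f1) ?(ltW e0) //.
  by rewrite mulrAC ler_pdivrMr // ler_wpM2l ?(ltW e0) //; lra.
have lim e : 0 < e -> exists N, forall n f, (N <= n)%N ->
    sqn (poly_operator (p n) T f - S f) <= e ^+ 2 * sqn f.
  move=> e0; have [N hN] := cau (e / 2) (ltac:(by rewrite divr_gt0)).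
  exists N => n f nN; have [s0|s0] := eqVneq (sqn f) 0.
    rewrite (sqn_eq0 s0).
    have z m : poly_operator (p m) T 0 = 0 by rewrite lin0 //; exact: poly_operator_linear.
    have S0 : S 0 = 0.
      apply: (scvg_unique (hS 0)) => d d0; exists 0%N => m _.
      by rewrite z subrr sqn0 ltW.
    by rewrite z S0 subrr sqn0 mulr0.
  have sp : 0 < sqn f by rewrite lt_neqAle eq_sym s0 sqn_ge0.
  (* The index [M] depends on [f], but it only selects the intermediate polynomial [p (N + M)]; the
     resulting estimate keeps the uniform index [N]. *)
  have [|M hM] := hS f (e ^+ 2 / 4 * sqn f).
    by rewrite !mulr_gt0 ?exprn_gt0.
  have h1 := hM _ (leq_addl N M); have h2 := hN n _ f nN (leq_addr M N).
  rewrite -[poly_operator (p n) T f](subrK (poly_operator (p (N + M)%N) T f)) -addrA.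
  apply: le_trans (sqnD_le _ _) _.
  have e2 : (e / 2) ^+ 2 = e ^+ 2 / 4 by field.
  by rewrite e2 in h2; lra.
have lS : linear S.
  apply/linE => z u v; apply: (scvg_unique (hS _)).
  have := scvg_lin z (hS u) (hS v) => h e /h[N hN]; exists N => n nN.
  by rewrite ((linE _).1 (poly_operator_linear lT (p n))); exact: hN.
exists S; split.
  have [N hN] := lim 1 ltr01.
  have [C C0 hC] := poly_operator_bounded lT bT (p N).
  apply: (lin_bounded_op (C := 2 * C + 2)) => // f.
  have := hN N f (leqnn N); have := hC f.
  have := sqnD_le (poly_operator (p N) T f) (S f - poly_operator (p N) T f).
  rewrite addrC subrK (sqnBC (S f)); lra.
exists p; split => // e e0; have [N hN] := lim e e0.
exists N => // n nN f; rewrite hnorm_leE ?(ltW e0) //.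
exact: hN.
Qed.

Lemma fun_calculus_modulus D psi a b : modulus D psi -> `[a, b] `<=` D ->
  (forall f, a * sqn f <= rip (T f) f) -> (forall f, rip (T f) f <= b * sqn f) ->
  is_fun_calculus T psi (fun_calculus T psi).
Proof.
move=> mpsi abD ha hb.
have sab t : spectrum T t%:C -> t \in `[a, b].
  by move=> st; rewrite in_itv /= (spectrum_lower ha st) (spectrum_upper hb st).
have [ab|ab] := ltP a b; last first.
  (* Here the spectrum contains at most the point [a], so constant polynomials converge on it. *)
  apply: (@fun_calculus_exists _ (fun=> (psi a)%:P)) => e e0; apply: nearW => _ t st.
  have := sab t st; rewrite in_itv /= => /andP[t1 t2].
  have -> : t = a by lra.
  by rewrite hornerC subrr normr0; exact: ltW.
have [e e0|p hp] := @weierstrass R a b psi ab.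
  pose K := 1 + `|a| + `|b|; have K0 : 0 < K.
    by rewrite /K; have := normr_ge0 a; have := normr_ge0 b; lra.
  have [C C0 hC] := mpsi _ (divr_gt0 e0 K0).
  exists C => // t s ht hs; apply: le_trans (hC t s _ _) _; [exact: abD|exact: abD|].
  rewrite lerD2r mulrAC ler_pdivrMr // ler_wpM2l ?(ltW e0) //.
  rewrite /K -addrA lerD2l; move: hs; rewrite in_itv /= => /andP[h1 h2].
  rewrite ler_norml; have := ler_norm b; have := ler_norm (- a).
  have := normr_ge0 b; have := normr_ge0 a; rewrite normrN; lra.
apply: (fun_calculus_exists (p := p)) => e e0.
by have := hp e e0; apply: filterS => n hn t st; apply: hn; exact: sab.
Qed.

Section Estimates.
Variables (S : H -> H) (psi : R -> R).
Hypothesis cS : is_fun_calculus T psi S.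

Lemma fun_calculus_approx e : 0 < e -> exists2 p : {poly R},
  forall t, spectrum T t%:C -> `|p.[t] - psi t| <= e &
  forall f, sqn (poly_operator p T f - S f) <= e ^+ 2 * sqn f.
Proof.
move=> e0; have [_ [p [p1 p2]]] := cS.
have [N _ hN] := p1 e e0; have [M _ hM] := p2 e e0.
exists (p (N + M)%N) => [|f]; first exact: (hN _ (leq_addr _ _)).
by rewrite -hnorm_leE ?(ltW e0) //; exact: (hM _ (leq_addl _ _)).
Qed.

Lemma fun_calculus_rip e p f g : 0 < e ->
  (forall f, sqn (poly_operator p T f - S f) <= e ^+ 2 * sqn f) ->
  2 * rip (poly_operator p T f - S f) g <= e * (sqn f + sqn g).
Proof.
move=> e0 hp.
have := rip_AMGM (poly_operator p T f - S f) g (ltac:(by rewrite invr_gt0) : 0 < e^-1).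
rewrite invrK => h; apply: le_trans h _; rewrite mulrDr lerD2r.
by rewrite ler_pdivrMl // mulrA -expr2.
Qed.

Lemma fun_calculus_sym : symmetric_op S.
Proof.
suff le u v : rip (S u) v <= rip u (S v).
  by move=> u v; apply/eqP; rewrite eq_le le /= (ripC (S u)) (ripC u).
apply/ler_addgt0Pr => e e0.
pose d := e / (1 + sqn u + sqn v).
have K0 : 0 < 1 + sqn u + sqn v by have := sqn_ge0 u; have := sqn_ge0 v; lra.
have d0 : 0 < d by rewrite divr_gt0.
have [p _ hp] := fun_calculus_approx d0.
have h1 := fun_calculus_rip (- u) v d0 hp.
have h2 := fun_calculus_rip v u d0 hp.
rewrite (linN _ (poly_operator_linear lT p)) (linN _ cS.1.1) in h1.
rewrite sqnN !ripBl !ripNl (poly_operator_sym lT sT) in h1.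
rewrite !ripBl (ripC _ u) (ripC (S v)) in h2.
have : d * (1 + sqn u + sqn v) = e by rewrite /d divfK // gt_eqF.
have := mulr_ge0 (ltW d0) (sqn_ge0 u); lra.
Qed.

(** The scalar inequality becomes one between squared norms by positivity of
    [2A + 2e^2 + 2B(t - s)^2 - (p - c)^2] on the spectrum. The factors 5 and 4 are the price of
    replacing [psi] by a polynomial [p] at distance [e]: with [e^2 = A / 6], [4A + 6e^2 = 5A]. *)
Lemma fun_calculus_sqn_le A B s c f : 0 < A -> 0 <= B ->
  (forall t, spectrum T t%:C -> (psi t - c) ^+ 2 <= A + B * (t - s) ^+ 2) ->
  sqn (S f - c%:C *: f) <= 5 * A * sqn f + 4 * B * sqn (T f - s%:C *: f).
Proof.
move=> A0 B0 h.
pose e := Num.sqrt (A / 6); have e0 : 0 < e by rewrite sqrtr_gt0 divr_gt0.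
have e2 : e ^+ 2 = A / 6 by rewrite sqr_sqrtr // divr_ge0 // ltW.
have [p p1 p2] := fun_calculus_approx e0.
pose X1 : {poly R} := 'X - s%:P.
pose q := (2 * A + 2 * e ^+ 2)%:P + (2 * B)%:P * (X1 * X1) - (p - c%:P) * (p - c%:P).
have := @poly_operator_ge0 _ _ _ lT sT bT q f.
have -> : rip (poly_operator q T f) f =
    (2 * A + 2 * e ^+ 2) * sqn f + 2 * B * sqn (T f - s%:C *: f)
    - sqn (poly_operator p T f - c%:C *: f).
  rewrite /q (poly_operatorB lT) poly_operatorD !(poly_operatorM lT) !poly_operatorC.
  rewrite ripBl ripDl !ripZl (poly_operator_sym lT sT X1) (poly_operator_sym lT sT (p - _)).
  rewrite !(poly_operatorB lT) !poly_operatorC poly_operatorX.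
  by [].
move=> /(_ _) hq.
have {hq} : 0 <= (2 * A + 2 * e ^+ 2) * sqn f + 2 * B * sqn (T f - s%:C *: f)
    - sqn (poly_operator p T f - c%:C *: f).
  apply: hq => t st.
  rewrite /q /X1 !(hornerD, hornerN, hornerM, hornerC, hornerX) -!expr2.
  have p1s : (p.[t] - psi t) ^+ 2 <= e ^+ 2.
    by rewrite -[(_ - psi t) ^+ 2]real_normK ?num_real // ler_pXn2r ?nnegrE ?(ltW e0) ?p1.
  have := h t st; move: p1s.
  have := sqr_ge0 ((psi t - c) - (p.[t] - psi t)).
  have -> : p.[t] - c = (psi t - c) + (p.[t] - psi t) by ring.
  move: (psi t - c) (p.[t] - psi t) (t - s) => x y w; rewrite !expr2; lra.
have := sqnD_le (S f - poly_operator p T f) (poly_operator p T f - c%:C *: f).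
rewrite addrA subrK (sqnBC (S f)); have := p2 f; rewrite e2; lra.
Qed.

(** Transports [|psi t - c| <= A + B t + C (t - s)^2 / (1 + t)] to quadratic forms. Writing
    [f = (1 + T) g] clears the denominator, because [(t - s)^2 / (1 + t)] equals
    [(1 + t) - 2(1 + s) + (1 + s)^2 / (1 + t)], whose last term becomes [(1 + s)^2 <f, g>].
    Polynomial approximation turns [A] into [3A]. *)
Lemma fun_calculus_form_le A B C s c f g : f = g + T g -> 0 < A -> 0 <= B -> 0 <= C ->
  (forall t, spectrum T t%:C -> 0 <= t /\
     `|psi t - c| * (1 + t) <= (A + B * t) * (1 + t) + C * (t - s) ^+ 2) ->
  `|rip (S f) f - c * sqn f| <= 3 * A * sqn f + B * rip (T f) f +
    C * (rip (T f) f + sqn f - 2 * (1 + s) * sqn f + (1 + s) ^+ 2 * rip f g).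
Proof.
move=> fg A0 B0 C0 h.
have [p p1 p2] := fun_calculus_approx A0.
pose X1 : {poly R} := 'X + 1%:P.
have fE : f = poly_operator X1 T g.
  by rewrite fg /X1 poly_operatorD poly_operatorX poly_operatorC scale1r addrC.
(* The values 1 and -1 of [sg] give the two halves of the absolute value. *)
have key (sg : R) : sg ^+ 2 = 1 ->
    sg * (rip (poly_operator p T f) f - c * sqn f) <= 2 * A * sqn f + B * rip (T f) f +
    C * (rip (T f) f + sqn f - 2 * (1 + s) * sqn f + (1 + s) ^+ 2 * rip f g).
  move=> sg2.
  pose r := (2 * A)%:P + B%:P * 'X - sg%:P * (p - c%:P).
  pose w := X1 - (2 * (1 + s))%:P.
  pose q := X1 * (r * X1) + C%:P * (X1 * (w * X1)) + (C * (1 + s) ^+ 2)%:P * X1.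
  have : 0 <= rip (poly_operator q T g) g.
    apply: (poly_operator_ge0 lT sT bT) => t st.
    have [t0 ht] := h t st; have pt := p1 t st.
    rewrite /q /r /w /X1 !(hornerD, hornerN, hornerM, hornerC, hornerX).
    set E := (X in 0 <= X).
    have -> : E = (1 + t) * (((2 * A + B * t) - sg * (p.[t] - c)) * (1 + t)
        + C * (t - s) ^+ 2) by rewrite /E; ring.
    have h1 : sg * (p.[t] - c) <= A + `|psi t - c|.
      have sgn : `|sg| = 1.
        by apply/eqP; rewrite -(@eqrXn2 _ 2) // expr1n real_normK ?num_real // sg2.
      apply: le_trans (ler_norm _) _; rewrite normrM sgn mul1r.
      by apply: le_trans (ler_distD (psi t) _ _) _; rewrite lerD2r.
    rewrite mulr_ge0 //; first by lra.
    have := ler_wpM2r (ltac:(lra) : 0 <= 1 + t) h1.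
    by move: (`|_ - c|) (C * _) ht => x y; nra.
  rewrite /q !poly_operatorD // !ripDl !(poly_operatorM lT (C%:P)) !(poly_operatorM lT (_ %:P) X1).
  rewrite !poly_operatorC // !ripZl !(poly_operatorM lT X1) !(poly_operator_sym lT sT X1 _ g).
  rewrite !(poly_operatorM lT r) !(poly_operatorM lT w) -!fE (ripC g).
  rewrite /r /w /X1 !(poly_operatorB lT, poly_operatorD, poly_operatorM lT, poly_operatorC, poly_operatorX).
  rewrite !(ripBl, ripDl, ripZl) -/(sqn f) mul1r; lra.
have h1 := fun_calculus_rip f f A0 p2.
have h2 := fun_calculus_rip (- f) f A0 p2.
rewrite (linN _ (poly_operator_linear lT p)) (linN _ cS.1.1) sqnN !ripBl !ripNl in h2.
rewrite ripBl in h1.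
have h3 := key 1 (expr1n _ _); have h4 := key (-1) (ltac:(by rewrite sqrrN expr1n)).
by rewrite ler_norml; move: (C * _) (B * _) h3 h4 => x y; lra.
Qed.

End Estimates.
End FunctionalCalculus.

(** * Traces *)

Section OrthonormalBases.
Variables (R : realType) (H : hilbertSpace R).
Implicit Types (u v f g e : H) (E : set H) (F G : {fset H}) (S : H -> H).

Lemma orthonormal_basis_exists : exists E, orthonormal_basis E.
Proof.
pose P E := forall u v, E u -> E v -> hdot H u v = (u == v)%:R.
have [E [PE mE]] : exists E, P E /\ forall B, E `<` B -> ~ P B.
  apply: Zorn_bigcup => C CP Ct u v [U CU Uu] [V CV Vv].
  by have [UV|VU] := Ct _ _ CU CV; [apply: (CP V) => //; exact: UV|
    apply: (CP U) => //; exact: VU].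
exists E; split => // f hf; apply: contrapT => f0.
have sp : 0 < sqn f.
  by rewrite lt_neqAle eq_sym sqn_ge0 andbT; apply/negP => /eqP/sqn_eq0.
pose g := (Num.sqrt (sqn f))^-1%:C *: f.
have g1 : hdot H g g = 1.
  rewrite hdot_sqn /g sqnZr exprVn sqr_sqrtr ?sqn_ge0 // mulVf ?gt_eqF //.
have gE u : E u -> hdot H g u = 0 by move=> Eu; rewrite hdotZl hf // mulr0.
have gn : ~ E g by move=> Eg; have := gE _ Eg; rewrite g1 => /eqP; rewrite oner_eq0.
apply: (mE (E `|` [set g])).
  by split; [move=> u Eu; left|move=> /(_ g (or_intror erefl))].
move=> u v [Eu|->] [Ev|->]; [exact: PE| | |by rewrite g1 eqxx].
  have /negbTE -> : u != g by apply/eqP => ug; apply: gn; rewrite -ug.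
  by rewrite hdotC gE // conjc0.
have /negbTE -> : g != v by apply/eqP => ug; apply: gn; rewrite ug.
by rewrite gE.
Qed.

(** Since [is_trace] quantifies over all bases, uniqueness depends on the existence of one; on it,
    compare along the union of the two finite sets. *)
Lemma trace_unique S (t t' : R[i]) : is_trace S t -> is_trace S t' -> t = t'.
Proof.
move=> ht ht'; have [E onE] := orthonormal_basis_exists.
apply/eqP; rewrite -subr_eq0 -normr_le0; apply/ler_addgt0Pr => e e0.
rewrite add0r; have ee : e = (complex.Re e)%:C.
  by move: (ger0_Im (ltW e0)); case: (e) => x y /= ->.
rewrite ee ltcR in e0 *; set r := complex.Re e in e0 *.
have r2 : 0 < r / 2 by rewrite divr_gt0.
have [F0 F0E h] := ht E onE _ r2; have [F1 F1E h'] := ht' E onE _ r2.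
have sE : [set` (F0 `|` F1)%fset] `<=` E.
  by move=> u /=; rewrite in_fsetU => /orP[/F0E|/F1E].
have {}h := h (F0 `|` F1)%fset (ltac:(by move=> u /= uF; rewrite in_fsetU uF)) sE.
have {}h' := h' (F0 `|` F1)%fset (ltac:(by move=> u /= uF; rewrite in_fsetU uF orbT)) sE.
have -> : r%:C = (r / 2)%:C + (r / 2)%:C by rewrite -rmorphD /=; congr (_%:C); field.
rewrite distrC in h; apply: le_trans (ler_distD _ _ _) (lerD h h').
Qed.

Lemma is_trace_trace S (t : R[i]) : is_trace S t -> trace S = t.
Proof.
move=> ht; apply: (trace_unique (S := S)) => //.
by rewrite /trace; case: xgetP => [y -> //|/(_ t)].
Qed.

Section Expansion.
Variable E : set H.
Hypothesis onE : orthonormal_basis E.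

Definition fset_proj F f : H := \sum_(e <- F) hdot H f e *: e.
Definition fset_mass F f : R := \sum_(e <- F) normc (hdot H f e) ^+ 2.

Lemma fset_proj_hdot F f e : [set` F] `<=` E -> e \in F ->
  hdot H (fset_proj F f) e = hdot H f e.
Proof.
move=> FE eF; rewrite /fset_proj linear_sumlz (big_fsetD1 e) //=.
have Ee : E e := FE _ eF.
rewrite hdotZl (onE.1 e e Ee Ee) eqxx mulr1.
rewrite big_seq big1 ?addr0 // => u; rewrite !inE => /andP[/negbTE ue uF].
by rewrite hdotZl (onE.1 _ _ (FE _ uF) Ee) ue mulr0.
Qed.

Lemma fset_proj_perp F f e : [set` F] `<=` E -> E e -> e \notin F ->
  hdot H (fset_proj F f) e = 0.
Proof.
move=> FE Ee eF; rewrite /fset_proj linear_sumlz big_seq big1 // => u uF.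
rewrite /= hdotZl (onE.1 _ _ (FE _ uF) Ee).
by have /negbTE -> : u != e; [apply: contraNneq eF => <-|rewrite mulr0].
Qed.

Lemma normc_sqr z : normc z ^+ 2 = complex.Re z ^+ 2 + complex.Im z ^+ 2 :> R.
Proof. by case: z => a b /=; rewrite sqr_sqrtr // addr_ge0 ?sqr_ge0. Qed.

Lemma rip_fset_proj F f g :
  rip g (fset_proj F f) = \sum_(e <- F) complex.Re (conjc (hdot H f e) * hdot H g e).
Proof.
rewrite /fset_proj; elim/big_ind2 : _ => [|x a y b <- <-|e _].
- exact: rip0r.
- exact: ripDr.
- by rewrite /rip hdotZr.
Qed.

Lemma rip_fset_mass F f : rip f (fset_proj F f) = fset_mass F f.
Proof.
rewrite rip_fset_proj; apply: eq_bigr => e _.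
by rewrite normc_sqr; case: (hdot H f e) => a b /=; ring.
Qed.

Lemma rip_fset_projW F G f : [set` F] `<=` [set` G] -> [set` G] `<=` E ->
  rip (fset_proj G f) (fset_proj F f) = fset_mass F f.
Proof.
move=> FG GE; rewrite -rip_fset_mass !rip_fset_proj big_seq [RHS]big_seq.
by apply: eq_bigr => e /FG eG; rewrite fset_proj_hdot.
Qed.

Lemma sqn_fset_proj F f : [set` F] `<=` E -> sqn (fset_proj F f) = fset_mass F f.
Proof. by move=> FE; rewrite /sqn rip_fset_projW. Qed.

Lemma sqn_sub_fset_proj F f : [set` F] `<=` E ->
  sqn (f - fset_proj F f) = sqn f - fset_mass F f.
Proof. by move=> FE; rewrite sqnB rip_fset_mass sqn_fset_proj //; ring. Qed.

Lemma sqn_fset_projB F G f : [set` F] `<=` [set` G] -> [set` G] `<=` E ->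
  sqn (fset_proj G f - fset_proj F f) = fset_mass G f - fset_mass F f.
Proof.
move=> FG GE; rewrite sqnB rip_fset_projW // !sqn_fset_proj //; first by ring.
exact: subset_trans FG GE.
Qed.

Lemma fset_mass_le F f : [set` F] `<=` E -> fset_mass F f <= sqn f.
Proof.
by move=> FE; have := sqn_ge0 (f - fset_proj F f); rewrite sqn_sub_fset_proj // subr_ge0.
Qed.

Lemma fset_massW F G f : [set` F] `<=` [set` G] -> [set` G] `<=` E ->
  fset_mass F f <= fset_mass G f.
Proof.
move=> FG GE; have := sqn_ge0 (fset_proj G f - fset_proj F f).
by rewrite sqn_fset_projB // subr_ge0.
Qed.

(** The masses increase and are bounded by [sqn f], so the partial expansions are Cauchy. The limit
    is the projection of [f] onto the closed span of the union of the [F n]. *)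
Lemma fset_proj_cvg (F : nat -> {fset H}) f :
  (forall n, [set` F n] `<=` E) ->
  (forall n m, (n <= m)%N -> [set` F n] `<=` [set` F m]) ->
  exists g, [/\ scvg (fun n => fset_proj (F n) f) g,
    forall n e, e \in F n -> hdot H g e = hdot H f e &
    forall e, E e -> (forall n, e \notin F n) -> hdot H g e = 0].
Proof.
move=> FE Fm; pose b n := fset_mass (F n) f.
have bb : has_sup (range b).
  split; first by exists (b 0%N), 0%N.
  by exists (sqn f) => _ [n _ <-]; exact: fset_mass_le.
have [|g sg] := @hilbert_complete _ _ (fun n => fset_proj (F n) f).
  move=> e e0; have [_ [N _ <-] hN] := sup_adherent e0 bb.
  exists N => n m; wlog nm : n m / (n <= m)%N => [hw nN mN|nN mN].
    by have /orP[nm|mn] := leq_total n m; [exact: hw|rewrite sqnBC; exact: hw].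
  rewrite sqnBC sqn_fset_projB //; last exact: Fm.
  have : b N <= b n by apply: fset_massW => //; exact: Fm.
  have : b m <= sup (range b) by apply: ub_le_sup; [exact: bb.2|exists m].
  by rewrite -/(b m) -/(b n); move: hN; move: (sup _) (b n) (b m) (b N) => *; lra.
have lim e z : (\forall n \near \oo, hdot H (fset_proj (F n) f) e = z) -> hdot H g e = z.
  move=> hn.
  have lim1 : (fun n => rip (fset_proj (F n) f) e) @ \oo --> rip g e by exact: scvg_rip.
  have lim2 : (fun n => rip (fset_proj (F n) f) ('i *: e)) @ \oo --> rip g ('i *: e).
    exact: scvg_rip.
  have lim3 : (fun n => rip (fset_proj (F n) f) e) @ \oo --> complex.Re z.
    by apply: cvg_near_cst; apply: filterS hn => n hn; rewrite /rip hn.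
  have lim4 : (fun n => rip (fset_proj (F n) f) ('i *: e)) @ \oo --> complex.Im z.
    by apply: cvg_near_cst; apply: filterS hn => n hn; rewrite rip_iZr hn.
  have e1 : rip g e = complex.Re z by exact: (cvg_unique _ lim1 lim3).
  have e2 : rip g ('i *: e) = complex.Im z by exact: (cvg_unique _ lim2 lim4).
  by rewrite hdotE e1 e2; case: (z).
exists g; split => // [N e eF|e Ee eF]; apply: lim.
  by exists N => // n /= nN; rewrite fset_proj_hdot //; exact: (Fm _ _ nN).
by apply: nearW => n; rewrite fset_proj_perp.
Qed.

(** A countable part of the basis is enough once it contains every basis vector not orthogonal to
    [f]; this is how an uncountable basis is handled. *)
Lemma orthonormal_expansion (F : nat -> {fset H}) f :
  (forall n, [set` F n] `<=` E) ->
  (forall n m, (n <= m)%N -> [set` F n] `<=` [set` F m]) ->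
  (forall e, E e -> hdot H f e <> 0 -> exists n, e \in F n) ->
  scvg (fun n => fset_proj (F n) f) f.
Proof.
move=> FE Fm Fc; have [g [sg g1 g2]] := fset_proj_cvg f FE Fm.
suff gf : g = f by rewrite gf in sg.
apply/eqP; rewrite -subr_eq0; apply/eqP; apply: onE.2 => e Ee.
suff -> : hdot H (g - f) e = hdot H g e - hdot H f e.
  have [[n eF]|nF] := pselect (exists n, e \in F n).
    by rewrite (g1 _ _ eF) subrr.
  rewrite g2 // => [|n]; last by apply/negP => eF; apply: nF; exists n.
  apply/eqP; rewrite subr_eq0 eq_sym; apply/eqP.
  by apply: contrapT => /(Fc _ Ee).
by rewrite hdotDl -scaleN1r hdotZl mulN1r.
Qed.

End Expansion.
End OrthonormalBases.

(** * Integrals of real functions *)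

Section RealIntegrals.
Context d (T : measurableType d) (R : realType).
Implicit Types (mu : {measure set T -> \bar R}) (f g h : T -> R) (a b e : R).

Definition itg mu f := mu.-integrable setT (EFin \o f).

Lemma itg_measurable mu f : itg mu f -> measurable_fun setT f.
Proof. by move=> /measurable_int/measurable_EFinP. Qed.

Lemma itg_dom mu f g : measurable_fun setT f -> itg mu g ->
  (forall x, `|f x| <= g x) -> itg mu f.
Proof.
move=> mf ig fg; apply: (le_integrable measurableT _ _ ig).
  exact/measurable_EFinP.
by move=> x _ /=; rewrite lee_fin (le_trans (fg x)) // ler_norm.
Qed.

Lemma itgD mu f g : itg mu f -> itg mu g -> itg mu (fun x => f x + g x).
Proof. by move=> i1 i2; have := integrableD measurableT i1 i2. Qed.
Lemma itgB mu f g : itg mu f -> itg mu g -> itg mu (fun x => f x - g x).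
Proof. by move=> i1 i2; have := integrableB measurableT i1 i2. Qed.
Lemma itgZ mu a f : itg mu f -> itg mu (fun x => a * f x).
Proof. by move=> i1; have := integrableZl measurableT a i1. Qed.
Lemma itg_norm mu f : itg mu f -> itg mu (fun x => `|f x|).
Proof. by move=> i; have := integrable_norm i. Qed.
Lemma itg0 mu : itg mu (fun=> 0).
Proof. exact: integrable0. Qed.

Lemma itg_bounded_mul mu f g (M : R) : itg mu f -> measurable_fun setT g ->
  (forall x, `|g x| <= M) -> itg mu (fun x => f x * g x).
Proof.
move=> i mg gM; apply: (@itg_dom mu _ (fun x => M * `|f x|)).
- by apply: measurable_funM => //; exact: itg_measurable i.
- exact: itgZ (itg_norm i).
by move=> x; rewrite normrM mulrC ler_wpM2r.
Qed.

Lemma RintD mu f g : itg mu f -> itg mu g ->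
  \int[mu]_x (f x + g x) = \int[mu]_x f x + \int[mu]_x g x.
Proof. exact: RintegralD. Qed.
Lemma RintB mu f g : itg mu f -> itg mu g ->
  \int[mu]_x (f x - g x) = \int[mu]_x f x - \int[mu]_x g x.
Proof. exact: RintegralB. Qed.
Lemma RintZ mu a f : itg mu f -> \int[mu]_x (a * f x) = a * \int[mu]_x f x.
Proof. exact: RintegralZl. Qed.
Lemma Rint_le mu f g : itg mu f -> itg mu g -> (forall x, f x <= g x) ->
  \int[mu]_x f x <= \int[mu]_x g x.
Proof. by move=> i1 i2 fg; exact: le_Rintegral. Qed.
Lemma Rint_ge0 mu f : (forall x, 0 <= f x) -> 0 <= \int[mu]_x f x.
Proof. by move=> f0; exact: Rintegral_ge0. Qed.
Lemma Rint_norm mu f : itg mu f -> `|\int[mu]_x f x| <= \int[mu]_x `|f x|.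
Proof. exact: le_normr_Rintegral. Qed.

Lemma Rint_ereal mu f : itg mu f -> (\int[mu]_x (f x)%:E)%E = (\int[mu]_x f x)%:E.
Proof. by move=> i; rewrite fineK //; exact: integrable_fin_num. Qed.

Lemma itg_sum mu (I : Type) (r : seq I) (F : I -> T -> R) :
  (forall i, itg mu (F i)) -> itg mu (fun x => \sum_(i <- r) F i x).
Proof.
move=> iF; elim: r => [|i r ih].
  by under eq_fun do rewrite big_nil; exact: itg0.
by under eq_fun do rewrite big_cons; exact: itgD.
Qed.

Lemma Rint_sum mu (I : Type) (r : seq I) (F : I -> T -> R) :
  (forall i, itg mu (F i)) ->
  \int[mu]_x (\sum_(i <- r) F i x) = \sum_(i <- r) \int[mu]_x F i x.
Proof.
move=> iF; elim: r => [|i r ih].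
  rewrite big_nil (@eq_Rintegral _ _ _ mu setT (fun=> 0)); last first.
    by move=> x _; rewrite big_nil.
  by rewrite /Rintegral integral0.
rewrite big_cons -ih -RintD //; last exact: itg_sum.
by apply: eq_Rintegral => x _; rewrite big_cons.
Qed.

Lemma itg_ae mu f g : itg mu g -> measurable_fun setT f ->
  (\forall x \ae mu, f x = g x) -> itg mu f.
Proof.
move=> ig mf fg; have mg := itg_measurable ig.
apply/integrableP; split; first exact/measurable_EFinP.
have /integrableP[_] := ig; congr (_ < _)%E; apply: ae_eq_integral => //.
- by apply: measurableT_comp => //; exact/measurable_EFinP.
- by apply: measurableT_comp => //; exact/measurable_EFinP.
by apply: filterS fg => x e _ /=; rewrite e.
Qed.

Lemma Rint_ae mu f g : measurable_fun setT f -> measurable_fun setT g ->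
  (\forall x \ae mu, f x = g x) -> \int[mu]_x f x = \int[mu]_x g x.
Proof.
move=> mf mg fg; congr fine; apply: ae_eq_integral => //.
- exact/measurable_EFinP.
- exact/measurable_EFinP.
by apply: filterS fg => x e _ /=; rewrite e.
Qed.

Lemma itg_dom_ae mu f g : measurable_fun setT f -> itg mu g ->
  (\forall x \ae mu, `|f x| <= g x) -> itg mu f.
Proof.
move=> mf ig fg; have mg := itg_measurable ig.
(* Clamping [f] between [-|g|] and [|g|] alters it on a null set only and makes the domination hold
   everywhere. *)
apply: (itg_ae (g := fun x => Num.min (Num.max (f x) (- `|g x|)) `|g x|)) => //.
  apply: (@itg_dom mu _ (fun x => `|g x|)); last 2 first.
  - exact: itg_norm.
  - move=> x; have := normr_ge0 (g x); rewrite ler_norml ge_min lexx orbT andbT.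
    by rewrite le_min le_max lexx orbT /=; lra.
  apply: measurable_minr; last by apply: measurableT_comp.
  by apply: measurable_maxr => //; apply: measurableT_comp => //; exact: measurableT_comp.
apply: filterS fg => x; rewrite ler_norml => /andP[h1 h2].
have gn := ler_norm (g x).
rewrite max_l; last by lra.
by rewrite min_l //; lra.
Qed.

Lemma Rint_le_ae mu f g : itg mu f -> itg mu g -> (\forall x \ae mu, f x <= g x) ->
  \int[mu]_x f x <= \int[mu]_x g x.
Proof.
move=> i1 i2 fg; have m1 := itg_measurable i1; have m2 := itg_measurable i2.
have mm : measurable_fun setT (fun x => Num.min (f x) (g x)) by exact: measurable_minr.
have ae : \forall x \ae mu, f x = Num.min (f x) (g x).
  by apply: filterS fg => x h; rewrite min_l.
rewrite (Rint_ae m1 mm ae); apply: Rint_le => //.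
  by apply: (itg_ae i1 mm); apply: filterS ae => x; exact: esym.
by move=> x; rewrite ge_min lexx orbT.
Qed.

Lemma Rint_ge0_ae mu f : itg mu f -> (\forall x \ae mu, 0 <= f x) -> 0 <= \int[mu]_x f x.
Proof.
move=> i f0; have := Rint_le_ae (itg0 mu) i f0.
by rewrite {1}/Rintegral integral0.
Qed.

Lemma Rint_dct mu (F : nat -> T -> R) f g :
  (forall n, measurable_fun setT (F n)) -> (forall x, F ^~ x @ \oo --> f x) ->
  itg mu g -> (forall n x, `|F n x| <= g x) ->
  itg mu f /\ (fun n => \int[mu]_x F n x) @ \oo --> \int[mu]_x f x.
Proof.
move=> mF cF ig Fg.
have mf : measurable_fun setT f by apply: (measurable_fun_cvg (h := F)) => // x _.
have [|||||i1 _ i3] := @dominated_convergence _ _ _ mu setT measurableT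
  (fun n => EFin \o F n) (EFin \o f) (EFin \o g).
- by move=> n; exact/measurable_EFinP.
- exact/measurable_EFinP.
- by apply: aeW => x _; apply: cvg_EFin; [exact: nearW|exact: cF].
- exact: ig.
- by apply: aeW => x n _ /=; rewrite lee_fin.
split => //; have fin : (\int[mu]_x (EFin \o f) x)%E \is a fin_num by exact: integrable_fin_num.
by apply: fine_cvg; rewrite fineK.
Qed.

End RealIntegrals.

(** * Continuous frames and Toeplitz operators *)

Section Frames.
Context d (T : measurableType d) (R : realType) (mu : {measure set T -> \bar R}).
Variables (H : hilbertSpace R) (k : T -> H).
Implicit Types (u v f g e : H) (a b : R) (z : R[i]) (x y : T) (s : T -> R).

(* The real part of [<f, k_x> <k_x, g>]; its imaginary part is
   [fdot f ('i *: g) x]. *)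
Definition fdot f g x : R :=
  rip f (k x) * rip g (k x) + rip ('i *: f) (k x) * rip ('i *: g) (k x).

(** Real parts lose nothing: the imaginary part of each condition is the condition for a vector
    multiplied by ['i]. *)
Definition real_frame := [/\ forall x, sqn (k x) = 1,
  forall f, measurable_fun setT (fun x => rip f (k x)),
  forall f g, itg mu (fdot f g) &
  forall f g, \int[mu]_x fdot f g x = rip f g].

Lemma fdotC f g x : fdot f g x = fdot g f x.
Proof. by rewrite /fdot; ring. Qed.
Lemma fdotDl u v g x : fdot (u + v) g x = fdot u g x + fdot v g x.
Proof. by rewrite /fdot scalerDr !ripDl; ring. Qed.
Lemma fdotZl a f g x : fdot (a%:C *: f) g x = a * fdot f g x.
Proof. by rewrite /fdot scalerA (mulrC 'i) -scalerA !ripZl; ring. Qed.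
Lemma fdotDr u v g x : fdot g (u + v) x = fdot g u x + fdot g v x.
Proof. by rewrite !(fdotC g) fdotDl. Qed.
Lemma fdotZr a f g x : fdot g (a%:C *: f) x = a * fdot g f x.
Proof. by rewrite !(fdotC g) fdotZl. Qed.
Lemma iiZ f : 'i *: ('i *: f) = - f.
Proof.
rewrite scalerA -scaleN1r; congr (_ *: _).
by apply/eqP; rewrite eq_complex /=; apply/andP; split; apply/eqP; ring.
Qed.
Lemma fdotiZ f g x : fdot ('i *: f) g x = - fdot f ('i *: g) x.
Proof. by rewrite /fdot !iiZ !ripNl; ring. Qed.
Lemma fdot_ge0 f x : 0 <= fdot f f x.
Proof. by rewrite /fdot -!expr2 addr_ge0 ?sqr_ge0. Qed.

Lemma fdot_hdot f g x : hdot H f (k x) * hdot H (k x) g = fdot f g x +i* fdot f ('i *: g) x.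
Proof.
rewrite (hdotC (k x) g) !(hdotE _ (k x)) /fdot iiZ ripNl.
have E u : rip u ('i *: k x) = - rip ('i *: u) (k x) by rewrite rip_i opprK.
by rewrite !E; apply/eqP; rewrite eq_complex /=; apply/andP; split; apply/eqP; ring.
Qed.

Lemma fdot_normc f x : fdot f f x = normc (hdot H f (k x)) ^+ 2.
Proof.
rewrite normc_sqr -/(rip f (k x)) -rip_iZr /fdot.
have -> : rip f ('i *: k x) = - rip ('i *: f) (k x) by rewrite rip_i opprK.
by ring.
Qed.

Lemma fdot_CS f g x : fdot f g x ^+ 2 <= fdot f f x * fdot g g x.
Proof.
apply: quadratic_disc => t; have := fdot_ge0 (f + t%:C *: g) x.
by rewrite !(fdotDl, fdotDr, fdotZl, fdotZr) (fdotC g); lra.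
Qed.

Lemma fdot_AMGM f g x : 2 * `|fdot f g x| <= fdot f f x + fdot g g x.
Proof.
have h1 := fdot_ge0 (f - g) x; have h2 := fdot_ge0 (f + g) x.
have E : f - g = f + (-1)%:C *: g by rewrite rmorphN1 scaleN1r.
rewrite E !(fdotDl, fdotDr, fdotZl, fdotZr) (fdotC g) in h1.
rewrite !(fdotDl, fdotDr) (fdotC g) in h2.
by rewrite -ler_pdivlMl // ler_norml; lra.
Qed.

Lemma fset_mass_fdot (F : {fset H}) x :
  fset_mass F (k x) = \sum_(e <- F) fdot e e x.
Proof.
apply: eq_bigr => e _; rewrite fdot_normc hdotC.
by case: (hdot H e (k x)) => p q /=; rewrite sqrrN.
Qed.

Hypothesis fr : real_frame.

Lemma frame_norm x : sqn (k x) = 1. Proof. by have [] := fr. Qed.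
Lemma frame_itg f g : itg mu (fdot f g). Proof. by have [] := fr. Qed.
Lemma frame_rip f g : \int[mu]_x fdot f g x = rip f g. Proof. by have [] := fr. Qed.
Lemma fdot_measurable f g : measurable_fun setT (fdot f g).
Proof. exact: itg_measurable (frame_itg f g). Qed.

Lemma fdot_le f x : fdot f f x <= sqn f.
Proof.
have := sqn_ge0 (f - hdot H f (k x) *: k x).
rewrite sqnB sqnZ frame_norm fdot_normc {1}/rip hdotZr normc_sqr.
by case: (hdot H f (k x)) => p q /=; lra.
Qed.

Lemma fdot_bound f g x : `|fdot f g x| <= (sqn f + sqn g) / 2.
Proof. by have := fdot_AMGM f g x; have := fdot_le f x; have := fdot_le g x; lra. Qed.

Lemma itg_fdot s f g : itg mu s -> itg mu (fun x => s x * fdot f g x).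
Proof.
move=> i; apply: (itg_bounded_mul (M := (sqn f + sqn g) / 2)) => //.
- exact: fdot_measurable.
- exact: fdot_bound.
Qed.

Lemma fdot_int_sq s f u : itg mu s ->
  (\int[mu]_x (s x * fdot f u x)) ^+ 2 <= (\int[mu]_x `|s x|) ^+ 2 * sqn f * sqn u.
Proof.
move=> i; have ni := itg_norm i.
have K0 : 0 <= \int[mu]_x `|s x| by apply: Rint_ge0.
rewrite -mulrA -[X in X <= _]real_normK ?num_real //.
apply: (@le_trans _ _ ((\int[mu]_x `|s x| * Num.sqrt (sqn f * sqn u)) ^+ 2)); last first.
  by rewrite exprMn [Num.sqrt _ ^+ 2]sqr_sqrtr ?mulr_ge0 ?sqn_ge0.
rewrite ler_pXn2r ?nnegrE ?mulr_ge0 ?sqrtr_ge0 //.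
apply: le_trans (Rint_norm (itg_fdot f u i)) _.
rewrite mulrC -RintZ //; apply: Rint_le.
- exact: itg_norm (itg_fdot f u i).
- exact: itgZ.
move=> x; rewrite normrM mulrC ler_wpM2r //.
rewrite -(@ler_pXn2r _ 2) ?nnegrE ?sqrtr_ge0 // sqr_sqrtr ?mulr_ge0 ?sqn_ge0 //.
rewrite real_normK ?num_real //; apply: le_trans (fdot_CS _ _ _) _.
by rewrite ler_pM ?fdot_ge0 ?fdot_le.
Qed.

Definition toep s : H -> H := toeplitz mu k (fun x => (s x)%:C).

(** The functional [g] to the integral of [s * fdot f g] is bounded by [fdot_int_sq], so Riesz
    provides the weak integral and [toeplitz] is not the default value of [xget]. *)
Lemma toeplitz_weak s f : itg mu s ->
  is_weak_integral mu (fun x => ((s x)%:C * hdot H f (k x)) *: k x) (toep s f).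
Proof.
move=> i; apply: (@xgetPex _ 0).
pose L g := \int[mu]_x (s x * fdot f g x).
have [||||h hL] := @riesz R H L ((\int[mu]_x `|s x|) ^+ 2 * sqn f).
- by rewrite mulr_ge0 ?sqr_ge0 ?sqn_ge0.
- move=> u v; rewrite /L -RintD; [|exact: itg_fdot..].
  by apply: eq_Rintegral => x _; rewrite fdotDr mulrDr.
- move=> a u; rewrite /L -RintZ; last exact: itg_fdot.
  by apply: eq_Rintegral => x _; rewrite fdotZr mulrCA.
- by move=> u; exact: fdot_int_sq.
have E g x : hdot H (((s x)%:C * hdot H f (k x)) *: k x) g =
    (s x * fdot f g x) +i* (s x * fdot f ('i *: g) x).
  rewrite hdotZl -mulrA fdot_hdot.
  by apply/eqP; rewrite eq_complex /=; apply/andP; split; apply/eqP; ring.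
exists h => g; split; first split.
- by under eq_fun do rewrite E /=; exact: itg_fdot.
- by under eq_fun do rewrite E /=; exact: itg_fdot.
rewrite hdotE !hL /L /cintegral.
by congr (_ +i* _); apply: eq_Rintegral => x _; rewrite E.
Qed.

Lemma toeplitz_rip s f g : itg mu s -> rip (toep s f) g = \int[mu]_x (s x * fdot f g x).
Proof.
move=> i; have [_] := toeplitz_weak f i g.
rewrite /rip => ->; apply: eq_Rintegral => x _.
rewrite hdotZl -mulrA fdot_hdot /=; ring.
Qed.

Lemma toeplitz_sym s : itg mu s -> symmetric_op (toep s).
Proof.
move=> i u v; rewrite (ripC u) !toeplitz_rip //.
by apply: eq_Rintegral => x _; rewrite fdotC.
Qed.

Lemma toeplitz_linear s : itg mu s -> linear (toep s).
Proof.
move=> i; have D u v : toep s (u + v) = toep s u + toep s v.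
  apply: rip_ext => g; rewrite ripDl !toeplitz_rip // -RintD; [|exact: itg_fdot..].
  by apply: eq_Rintegral => x _; rewrite fdotDl mulrDr.
have Z a u : toep s (a%:C *: u) = a%:C *: toep s u.
  apply: rip_ext => g; rewrite ripZl !toeplitz_rip // -RintZ; last exact: itg_fdot.
  by apply: eq_Rintegral => x _; rewrite fdotZl mulrCA.
have I u : toep s ('i *: u) = 'i *: toep s u.
  apply: rip_ext => g; rewrite rip_i !toeplitz_rip //.
  rewrite -mulN1r -RintZ; last exact: itg_fdot.
  by apply: eq_Rintegral => x _; rewrite fdotiZ; ring.
apply/linE => z u v; rewrite D; congr (_ + _).
have zE : z = (complex.Re z)%:C + (complex.Im z)%:C * 'i.
  by rewrite [LHS]complexE mulrC [in LHS]mulrC; congr (_ + _); rewrite mulrC.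
by rewrite zE !scalerDl D -!scalerA !Z I.
Qed.

Lemma toeplitz_bounded s : itg mu s ->
  forall f, sqn (toep s f) <= (\int[mu]_x `|s x|) ^+ 2 * sqn f.
Proof.
move=> i f; have := fdot_int_sq f (toep s f) i.
rewrite -toeplitz_rip // -[rip _ _]/(sqn (toep s f)) expr2.
have [->|s0] := eqVneq (sqn (toep s f)) 0.
  by move=> _; rewrite mulr_ge0 ?sqr_ge0 ?sqn_ge0.
by rewrite ler_pM2r // lt_neqAle eq_sym s0 sqn_ge0.
Qed.

Lemma toeplitz_bounded_op s : itg mu s -> bounded_operator (toep s).
Proof.
by move=> i; apply: lin_bounded_op (toeplitz_bounded i); exact: toeplitz_linear.
Qed.

Lemma toeplitz_form_le s s' f : itg mu s -> itg mu s' ->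
  (\forall x \ae mu, s x <= s' x) -> rip (toep s f) f <= rip (toep s' f) f.
Proof.
move=> i i' ss; rewrite !toeplitz_rip //.
apply: Rint_le_ae (itg_fdot f f i) (itg_fdot f f i') _.
by apply: filterS ss => x h; rewrite ler_wpM2r ?fdot_ge0.
Qed.

Lemma toeplitz_form_ge0 s f : itg mu s -> (\forall x \ae mu, 0 <= s x) ->
  0 <= rip (toep s f) f.
Proof.
move=> i s0; rewrite toeplitz_rip //; apply: Rint_ge0_ae; first exact: itg_fdot.
by apply: filterS s0 => x h; rewrite mulr_ge0 ?fdot_ge0.
Qed.

Lemma toeplitz_form_lower s (m : R) f : itg mu s -> (\forall x \ae mu, m <= s x) ->
  m * sqn f <= rip (toep s f) f.
Proof.
move=> i ms; rewrite /sqn -(frame_rip f f) -RintZ; last exact: frame_itg.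
rewrite toeplitz_rip //; apply: Rint_le_ae; [|exact: itg_fdot|].
  by apply: itgZ; exact: frame_itg.
by apply: filterS ms => x h; rewrite ler_wpM2r ?fdot_ge0.
Qed.

Lemma toeplitz_form_upper s (m : R) f : itg mu s -> (\forall x \ae mu, s x <= m) ->
  rip (toep s f) f <= m * sqn f.
Proof.
move=> i ms; rewrite /sqn -(frame_rip f f) -RintZ; last exact: frame_itg.
rewrite toeplitz_rip //; apply: Rint_le_ae; [exact: itg_fdot| |].
  by apply: itgZ; exact: frame_itg.
by apply: filterS ms => x h; rewrite ler_wpM2r ?fdot_ge0.
Qed.

(** Cauchy-Schwarz for the nonnegative form, tested against [toep s e]. *)
Lemma toeplitz_ker s e : itg mu s -> (\forall x \ae mu, 0 <= s x) ->
  rip (toep s e) e = 0 -> toep s e = 0.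
Proof.
move=> i s0 e0; apply: sqn_eq0; apply/eqP; rewrite -sqrf_eq0 eq_le sqr_ge0 andbT.
have := @form_CS R H (toep s) e (toep s e) (toeplitz_linear i) (toeplitz_sym i)
  (fun f => toeplitz_form_ge0 f i s0).
by rewrite e0 mul0r.
Qed.

Section Bessel.
Variables (E : set H) (s : T -> R).
Hypotheses (onE : orthonormal_basis E) (si : itg mu s)
  (s0 : \forall x \ae mu, 0 <= s x).

(** Under the integral, the sum is [s x] times the mass of [k x] on [F], which is at most 1 by
    Bessel. It amounts to [toep s] being trace class for a nonnegative symbol. *)
Lemma toeplitz_bessel (F : {fset H}) : [set` F] `<=` E ->
  \sum_(e <- F) rip (toep s e) e <= \int[mu]_x s x.
Proof.
move=> FE; under eq_bigr do rewrite toeplitz_rip //.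
rewrite -Rint_sum; last by move=> e; exact: itg_fdot.
apply: Rint_le_ae => //; first by apply: itg_sum => e; exact: itg_fdot.
apply: filterS s0 => x sx; rewrite -mulr_sumr -fset_mass_fdot -[leRHS]mulr1.
by rewrite ler_wpM2l // -(frame_norm x); exact: (fset_mass_le onE).
Qed.

(** Substitute for separability: by the Bessel bound only finitely many basis vectors have
    [<T e, e> >= 1/(n + 1)], and by [toeplitz_ker] the vectors found at no level lie in the
    kernel. *)
Lemma toeplitz_fsets : exists F : nat -> {fset H},
  [/\ forall n, [set` F n] `<=` E,
      forall n m, (n <= m)%N -> [set` F n] `<=` [set` F m] &
      forall e, E e -> toep s e <> 0 -> exists n, e \in F n].
Proof.
pose En n := [set e | E e /\ n.+1%:R^-1 <= rip (toep s e) e].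
have fE n : finite_set (En n).
  apply: contrapT => inf.
  have I0 := Rint_ge0_ae si s0.
  (* An infinite level set would contain more than [(n + 1)] times the integral of [s] vectors, each
     contributing at least [1/(n + 1)]. *)
  have [B BE hB] := infinite_set_fset (Num.truncn (n.+1%:R * \int[mu]_x s x)).+1 inf.
  have h1 := toeplitz_bessel (subset_trans BE (fun e => @proj1 _ _)).
  have h2 : #|` B|%:R * n.+1%:R^-1 <= \int[mu]_x s x.
    apply: le_trans h1; rewrite big_seq.
    apply: (@le_trans _ _ (\sum_(e <- B | e \in B) n.+1%:R^-1)); last first.
      by apply: ler_sum => e /BE[].
    by rewrite -big_seq big_const_seq count_predT iter_addr_0 mulr_natl cardfE -?cardfE.
  rewrite ler_pdivrMr ?ltr0n // mulrC in h2.
  have : n.+1%:R * \int[mu]_x s x < #|` B|%:R :> R.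
    by apply: lt_le_trans (truncnS_gt _) _; rewrite ler_nat.
  by rewrite ltNge h2.
exists (fun n => fset_set (En n)); split => [n e|n m nm e|e Ee Te].
- by rewrite /= in_fset_set // => /set_mem[].
- rewrite /= !in_fset_set // => /set_mem[Ee h]; apply/mem_set; split => //.
  by apply: le_trans h; rewrite lef_pV2 ?posrE ?ltr0n // ler_nat.
have Tp : 0 < rip (toep s e) e.
  rewrite lt_neqAle toeplitz_form_ge0 // andbT eq_sym.
  by apply/eqP => /(toeplitz_ker si s0).
have [N _ hN] := near_infty_natSinv_lt (PosNum Tp).
exists N; rewrite in_fset_set //; apply/mem_set; split => //.
exact: ltW (hN N (leqnn N)).
Qed.

End Bessel.

End Frames.

(** * Berezin transform and localization defect of one frame *)

Section FrameBerezin.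
Context d (T : measurableType d) (R : realType) (mu : {measure set T -> \bar R}).
Variables (H : hilbertSpace R) (k : T -> H).
Hypothesis fr : real_frame mu k.
Implicit Types (u v f g e : H) (a b : R) (z : R[i]) (x y : T) (s : T -> R).

Local Notation fdot := (fdot k).
Local Notation toep := (toep mu k).

Definition bz s x : R := \int[mu]_y (s y * fdot (k x) (k x) y).

Lemma bz_toep s x : itg mu s -> bz s x = rip (toep s (k x)) (k x).
Proof. by move=> i; rewrite (toeplitz_rip fr). Qed.

Lemma fset_proj_linear (F : {fset H}) : linear (fset_proj F).
Proof.
apply/linE => z u v; rewrite /fset_proj scaler_sumr -big_split /=.
by apply: eq_bigr => e _; rewrite hdotDl hdotZl scalerDl scalerA.
Qed.

Lemma fset_proj_sym (F : {fset H}) : symmetric_op (fset_proj F).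
Proof.
move=> f g; rewrite ripC !rip_fset_proj; apply: eq_bigr => e _.
by case: (hdot H f e) => p q; case: (hdot H g e) => p' q' /=; ring.
Qed.

Lemma rip_sumr (I : Type) (r : seq I) (F : I -> H) g :
  rip g (\sum_(i <- r) F i) = \sum_(i <- r) rip g (F i).
Proof.
elim: r => [|i r ih]; first by rewrite !big_nil rip0r.
by rewrite !big_cons ripDr ih.
Qed.

(** Projecting [k x] turns the Berezin transform into a finite sum of coefficient functions, each
    integrable in [x] with integral given by the Parseval identity. This stands in for exchanging
    two integrals. *)
Lemma rip_toep_fset_proj (F : {fset H}) A x : linear A ->
  rip (A (fset_proj F (k x))) (fset_proj F (k x)) =
  \sum_(e <- F) fdot (fset_proj F (A e)) e x.
Proof.
move=> lA; rewrite {1}/fset_proj lin_sum // ripC rip_sumr.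
apply: eq_bigr => e _; rewrite linZ // /rip hdotZr.
rewrite (hdotC (fset_proj F (k x))).
rewrite -(symmetric_hdot _ _ (fset_proj_linear F) (@fset_proj_sym F)).
rewrite -[RHS]/(complex.Re (fdot (fset_proj F (A e)) e x +i*
  fdot (fset_proj F (A e)) ('i *: e) x)) -fdot_hdot.
case: (hdot H (fset_proj F (A e)) (k x)) => p q.
by case: (hdot H (k x) e) => p' q' /=; ring.
Qed.

(** A nonzero [<T e, u>] forces [T u] to be nonzero, so the range of [toep s] lies in the closed
    span of the [F n]; [f - g] is orthogonal to that span. *)
Lemma toep_proj_limit (E : set H) s (F : nat -> {fset H}) f g :
  orthonormal_basis E -> itg mu s ->
  (forall n, [set` F n] `<=` E) ->
  (forall n m, (n <= m)%N -> [set` F n] `<=` [set` F m]) ->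
  (forall e, E e -> toep s e <> 0 -> exists n, e \in F n) ->
  (forall n e, e \in F n -> hdot H g e = hdot H f e) ->
  toep s f = toep s g.
Proof.
move=> onE si FE Fm Fc gf.
have lA := toeplitz_linear fr si; have sA := toeplitz_sym fr si.
have h0 n e : e \in F n -> hdot H (f - g) e = 0.
  move=> eF; rewrite hdotDl -scaleN1r hdotZl mulN1r (gf _ _ eF); exact: subrr.
apply/eqP; rewrite -subr_eq0 -(linB _ _ lA); apply/eqP; apply: onE.2 => e Ee.
rewrite (symmetric_hdot _ _ lA sA).
have perp v : (forall e, E e -> hdot H v e <> 0 -> exists n, e \in F n) ->
    rip (f - g) v = 0.
  move=> hv; have sv := orthonormal_expansion onE FE Fm hv.
  have l1 : (fun n => rip (fset_proj (F n) v) (f - g)) @ \oo --> rip v (f - g).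
    exact: scvg_rip.
  have l2 : (fun n => rip (fset_proj (F n) v) (f - g)) @ \oo --> (0 : R).
    apply: cvg_near_cst; apply: nearW => n; rewrite ripC rip_fset_proj big_seq big1 //.
    by move=> u uF; rewrite (h0 n) // mulr0.
  by rewrite ripC; exact: (cvg_unique _ l1 l2).
have Fv z u : E u -> hdot H (z *: toep s e) u <> 0 -> exists n, u \in F n.
  move=> Eu hu; apply: Fc => // u0; apply: hu.
  rewrite hdotZl (symmetric_hdot _ _ lA sA) u0 hdotC.
  have -> : hdot H 0 e = 0 by rewrite -(scale0r e) hdotZl mul0r.
  by rewrite conjc0 mulr0.
rewrite hdotE -[toep s e]scale1r !perp //; first by move=> u; rewrite scale1r; exact: Fv.
by move=> u; rewrite scale1r; have := Fv 1 u; rewrite scale1r.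
Qed.

Lemma bz_ge0 s x : itg mu s -> (\forall x \ae mu, 0 <= s x) -> 0 <= bz s x.
Proof. by move=> si s0; rewrite bz_toep //; exact: (toeplitz_form_ge0 fr). Qed.

(** Replacing [k x] by its projections onto the spans of the [F n] gives functions [b n] whose
    integrals are sums of [<T e, e>] over [F n], bounded by the integral of [s]. They converge
    pointwise to the Berezin transform, because the limit [g] of the projections has the same image
    as [k x]. Fatou concludes, and measurability comes with the limit. *)
Lemma bz_contraction s : itg mu s -> (\forall x \ae mu, 0 <= s x) ->
  itg mu (bz s) /\ \int[mu]_x bz s x <= \int[mu]_x s x.
Proof.
move=> si s0.
have lA := toeplitz_linear fr si; have sA := toeplitz_sym fr si.
have [E onE] := @orthonormal_basis_exists R H.
have [F [FE Fm Fc]] := toeplitz_fsets fr onE si s0.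
pose b n x := rip (toep s (fset_proj (F n) (k x))) (fset_proj (F n) (k x)).
have bE n x : b n x = \sum_(e <- F n) fdot (fset_proj (F n) (toep s e)) e x.
  exact: rip_toep_fset_proj.
have ib n : itg mu (b n).
  have -> : b n = (fun x => \sum_(e <- F n) fdot (fset_proj (F n) (toep s e)) e x).
    by apply/funext => x; exact: bE.
  by apply: itg_sum => e; exact: frame_itg.
have b0 n x : 0 <= b n x by exact: (toeplitz_form_ge0 fr).
have Ib n : \int[mu]_x b n x <= \int[mu]_x s x.
  apply: le_trans (toeplitz_bessel fr onE si s0 (FE n)).
  rewrite (@eq_Rintegral _ _ _ mu setT (fun x => \sum_(e <- F n) fdot (fset_proj (F n) (toep s e)) e x)); last first.
    by move=> x _; exact: bE.
  rewrite Rint_sum; last by move=> e; exact: frame_itg.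
  rewrite big_seq [leRHS]big_seq; apply: ler_sum => e eF.
  by rewrite (frame_rip fr) /rip (fset_proj_hdot onE).
have cb x : b ^~ x @ \oo --> bz s x.
  have [g [sg g1 g2]] := fset_proj_cvg onE (k x) FE Fm.
  have Tg : toep s (k x) = toep s g by exact: (toep_proj_limit onE si FE Fm Fc g1).
  have -> : bz s x = rip (toep s g) g.
    by rewrite bz_toep // Tg sA Tg -sA.
  have [C C0 hC] := bounded_opP (toeplitz_bounded_op fr si).
  pose fn n := fset_proj (F n) (k x).
  have h1 : (fun n => rip (fn n) (toep s g)) @ \oo --> rip g (toep s g) by exact: scvg_rip.
  have h2 : (fun n => rip (fn n - g) (toep s (fn n))) @ \oo --> (0 : R).
    apply/cvgrPdist_le => e e0.
    have K0 : 0 < C + 1 by lra.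
    pose dl := e ^+ 2 / (C + 1).
    have dl0 : 0 < dl by rewrite divr_gt0 ?exprn_gt0.
    have [N hN] := sg dl dl0.
    exists N => // n /= nN; rewrite sub0r normrN.
    rewrite -(@ler_pXn2r _ 2) ?nnegrE ?(ltW e0) // real_normK ?num_real //.
    apply: le_trans (rip_CS _ _) _.
    have h := hN n nN; have h' := hC (fn n).
    have h'' : sqn (fn n) <= 1.
      by rewrite (sqn_fset_proj onE) // -(frame_norm fr x); exact: (fset_mass_le onE).
    have h3 := sqn_ge0 (fn n - g); have h4 := sqn_ge0 (toep s (fn n)).
    have h5 : sqn (toep s (fn n)) <= C by apply: le_trans h' _; rewrite ler_piMr // ltW.
    apply: (@le_trans _ _ (dl * (C + 1))); last by rewrite divfK // gt_eqF.
    by rewrite ler_pM //; lra.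
  have -> : b ^~ x = (fun n => rip (fn n - g) (toep s (fn n)) + rip (fn n) (toep s g)).
    apply/funext => n; rewrite /b -/(fn n) ripBl -(sA g (fn n)) (ripC (toep s g)).
    by rewrite subrK ripC.
  by rewrite sA -[rip g _]add0r; apply: cvgD.
have z0 x : 0 <= bz s x by exact: bz_ge0.
have mb : measurable_fun setT (bz s).
  by apply: (measurable_fun_cvg (h := b)) => [n|x _]; [exact: itg_measurable (ib n)|exact: cb].
have fat : (\int[mu]_x (bz s x)%:E <= (\int[mu]_x s x)%:E)%E.
  have := @fatou _ _ _ mu setT measurableT (fun n x => (b n x)%:E).
  move=> /(_ (fun n => (measurable_EFinP _ _).2 (itg_measurable (ib n)))).
  move=> /(_ (fun n x _ => b0 n x)) h.
  have eq1 : (\int[mu]_x (bz s x)%:E = \int[mu]_x limn_einf ((fun n x => (b n x)%:E)^~ x))%E.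
    apply: eq_integral => x _; apply/esym.
    have c1 : (fun n => (b n x)%:E) @ \oo --> (bz s x)%:E.
      by apply: cvg_EFin; [exact: nearW|exact: cb].
    by have [-> _] := cvg_limn_einf_sup c1.
  rewrite eq1; apply: le_trans h _.
  rewrite limn_einf_lim; apply: lime_le; first exact: is_cvg_einfs.
  apply: nearW => n; apply: (@le_trans _ _ (\int[mu]_x (b n x)%:E)%E).
    by apply: ereal_inf_lbound; exists n => /=.
  by rewrite Rint_ereal // lee_fin.
have iz : itg mu (bz s).
  apply/integrableP; split; first exact/measurable_EFinP.
  apply: le_lt_trans (ltry (\int[mu]_x s x)); apply: le_trans fat.
  rewrite le_eqVlt; apply/orP; left; apply/eqP; apply: eq_integral => x _ /=.
  by rewrite ger0_norm.
by split => //; rewrite -lee_fin -Rint_ereal.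
Qed.

(** Mean of [(s y - s x)^2] for the probability density given by the kernel at [x]. *)
Definition phi s x : R := \int[mu]_y ((s y - s x) ^+ 2 * fdot (k x) (k x) y).

Section Phi.
Variable s : T -> R.
Hypotheses (si : itg mu s) (s2i : itg mu (fun x => s x ^+ 2)).

Lemma itg_phi x f g : itg mu (fun y => (s y - s x) ^+ 2 * fdot f g y).
Proof.
have -> : (fun y => (s y - s x) ^+ 2 * fdot f g y) = (fun y =>
    s y ^+ 2 * fdot f g y + (- 2 * s x) * (s y * fdot f g y) + s x ^+ 2 * fdot f g y).
  by apply/funext => y; ring.
apply: itgD; last by apply: itgZ; exact: (frame_itg fr).
apply: itgD; first exact: (itg_fdot fr f g s2i).
by apply: itgZ; exact: (itg_fdot fr).
Qed.

Lemma phiE x : phi s x = bz (fun y => s y ^+ 2) x - 2 * s x * bz s x + s x ^+ 2.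
Proof.
rewrite /phi (@eq_Rintegral _ _ _ mu setT (fun y => s y ^+ 2 * fdot (k x) (k x) y +
   (- 2 * s x) * (s y * fdot (k x) (k x) y) + s x ^+ 2 * fdot (k x) (k x) y)); last first.
  by move=> y _; ring.
have i1 := itg_fdot fr (k x) (k x) s2i.
have i2 : itg mu (fun y => (- 2 * s x) * (s y * fdot (k x) (k x) y)).
  by apply: itgZ; exact: (itg_fdot fr).
have i3 : itg mu (fun y => s x ^+ 2 * fdot (k x) (k x) y).
  by apply: itgZ; exact: (frame_itg fr).
rewrite RintD //; last exact: itgD.
rewrite RintD // !RintZ; [|exact: (itg_fdot fr)|exact: (frame_itg fr)].
by rewrite (frame_rip fr) -[rip _ _]/(sqn (k x)) (frame_norm fr) /bz; ring.
Qed.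

Lemma phi_ge0 x : 0 <= phi s x.
Proof. by apply: Rint_ge0 => y; rewrite mulr_ge0 ?sqr_ge0 ?fdot_ge0. Qed.

(** With [v = (T_s - s x) k_x], the squared norm of [v] is the integral of
    [(s y - s x) fdot (k x) v y]. A pointwise arithmetic-geometric mean inequality splits it into
    half of [phi] and half of the integral of [fdot v v], which is again the squared norm of [v]. *)
Lemma toeplitz_localized x : sqn (toep s (k x) - (s x)%:C *: k x) <= phi s x.
Proof.
set v := _ - _.
have i1 := itg_fdot fr (k x) v si; have i2 := frame_itg fr (k x) v.
have E : sqn v = \int[mu]_y ((s y - s x) * fdot (k x) v y).
  rewrite {1}/sqn {1}/v ripBl ripZl (toeplitz_rip fr) // -(frame_rip fr) -RintZ //.
  rewrite -RintB //; last exact: itgZ.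
  by apply: eq_Rintegral => y _; ring.
clearbody v.
have i3 : itg mu (fun y => (s y - s x) * fdot (k x) v y).
  have := itgB i1 (itgZ (s x) i2); rewrite /itg.
  by congr (mu.-integrable _ _); apply/funext => y /=; congr (_%:E); ring.
have : 2 * sqn v <= phi s x + sqn v.
  rewrite {1}E -RintZ // /phi /sqn -(frame_rip fr) -RintD; last 2 first.
  - exact: itg_phi.
  - exact: (frame_itg fr).
  apply: Rint_le; first exact: itgZ.
    by apply: itgD; [exact: itg_phi|exact: (frame_itg fr)].
  move=> y; have := fdot_ge0 k ((s y - s x)%:C *: k x - v) y.
  have -> : (s y - s x)%:C *: k x - v = (s y - s x)%:C *: k x + (-1)%:C *: v.
    by rewrite rmorphN1 scaleN1r.
  rewrite !(fdotDl, fdotDr, fdotZl, fdotZr).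
  by rewrite (fdotC k v (k x)); lra.
by lra.
Qed.

End Phi.
End FrameBerezin.

(** * Trace of the product of a Toeplitz operator and a self-adjoint operator *)

Section TraceFormula.
Context d (T : measurableType d) (R : realType) (mu : {measure set T -> \bar R}).
Variables (H : hilbertSpace R) (k : T -> H) (eta : T -> R).
Hypotheses (fr : real_frame mu k) (ei : itg mu eta) (eta0 : \forall x \ae mu, 0 <= eta x).
Implicit Types (u v f g e : H) (a b : R) (z : R[i]) (x y : T).

Local Notation fdot := (fdot k).
Local Notation A := (toep mu k eta).
Let lA : linear A := toeplitz_linear fr ei.
Let sA : symmetric_op A := toeplitz_sym fr ei.

(* [P] is the projection onto the orthogonal complement of the kernel of the
   Toeplitz operator; its range is separable even when [H] is not. *)
Definition support_projection (P : H -> H) := [/\ linear P, symmetric_op P,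
  forall f, rip (f - P f) (P f) = 0, forall f, A (P f) = A f &
  forall f, A f = 0 -> P f = 0].

Lemma support_projection_exists : exists P, support_projection P.
Proof.
have [C C0 hC] := bounded_opP (toeplitz_bounded_op fr ei).
have cM : closed_subspace [set f | A f = 0].
  split => /=; first exact: lin0.
    by move=> z u v hu hv; rewrite (linE A).1 // hu hv scaler0 addr0.
  move=> s u su hs; apply/sqn_eq0/eqP; rewrite eq_le sqn_ge0 andbT.
  apply/ler_addgt0Pr => e e0; rewrite add0r.
  have [N hN] := su _ (divr_gt0 e0 C0).
  have := hC (s N - u); rewrite linB // hs sub0r sqnN => h; apply: le_trans h _.
  by rewrite -ler_pdivlMl // mulrC; exact: hN.
have [Q [lQ MQ oQ]] := projection_exists cM.
have sQ : symmetric_op Q.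
  move=> f g; have := oQ f (Q g) (MQ g); have := oQ g (Q f) (MQ f).
  by rewrite !ripBl (ripC (Q f) g) (ripC (Q g) (Q f)); lra.
exists (fun f => f - Q f); split.
- apply/linE => z u v; rewrite (linE Q).1 // opprD addrACA scalerBr //.
- by move=> u v; rewrite ripBl ripBr sQ.
- by move=> f; rewrite opprB addrCA subrr addr0 ripC oQ.
- by move=> f; rewrite linB // (MQ f) subr0.
move=> f Af; apply: sqn_eq0; rewrite /sqn {1}ripBr oQ // oQ ?subrr //.
Qed.

Variable P : H -> H.
Hypothesis hP : support_projection P.

Let lP : linear P. Proof. by have [] := hP. Qed.
Let sP : symmetric_op P. Proof. by have [] := hP. Qed.

Lemma support_sqn f : sqn f = sqn (P f) + sqn (f - P f).
Proof.
have [_ _ h _ _] := hP; have := sqnD (f - P f) (P f).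
by rewrite subrK h => ->; ring.
Qed.

Lemma support_sqn_le f : sqn (P f) <= sqn f.
Proof. by rewrite (support_sqn f) lerDl sqn_ge0. Qed.

Lemma support_rip f : rip (P f) f = sqn (P f).
Proof.
have [_ _ h _ _] := hP; have := h f.
by rewrite ripBl (ripC f) /sqn; lra.
Qed.

Lemma toeplitz_support f g : rip (A f) g = rip (A f) (P g).
Proof. by have [_ _ _ h _] := hP; rewrite !sA h. Qed.

Section Basis.
Variables (E : set H) (F : nat -> {fset H}).
Hypotheses (onE : orthonormal_basis E) (FE : forall n, [set` F n] `<=` E)
  (Fm : forall n m, (n <= m)%N -> [set` F n] `<=` [set` F m])
  (Fc : forall e, E e -> A e <> 0 -> exists n, e \in F n).

(** A basis vector in the kernel of the Toeplitz operator is killed by [P], so the countable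
    exhaustion carries all of [P f]. *)
Lemma support_expansion f : scvg (fun n => fset_proj (F n) (P f)) (P f).
Proof.
apply: (orthonormal_expansion onE FE Fm) => e Ee h; apply: Fc => // Ae.
have [_ _ _ _ h0] := hP.
apply: h; rewrite (symmetric_hdot _ _ lP sP) h0 // hdotC.
have -> : hdot H 0 f = 0 by rewrite -(scale0r f) hdotZl mul0r.
exact: conjc0.
Qed.

Lemma fset_mass_support (G : {fset H}) x :
  fset_mass G (P (k x)) = \sum_(e <- G) fdot (P e) (P e) x.
Proof.
apply: eq_bigr => e _; rewrite fdot_normc (symmetric_hdot _ _ lP sP) hdotC.
by case: (hdot H (P e) (k x)) => p q /=; rewrite sqrrN.
Qed.

(** The part of the squared norm of [P (k x)] missed by [F n]. It also bounds what any finite set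
    containing [F n] misses, which makes the limit over finite subsets of the basis uniform. *)
Let r n x := sqn (P (k x)) - fset_mass (F n) (P (k x)).

Let cvg_mass x : (fun n => fset_mass (F n) (P (k x))) @ \oo --> sqn (P (k x)).
Proof.
have := scvg_sqn (support_expansion (k x)).
by under eq_fun do rewrite (sqn_fset_proj onE) //.
Qed.

Let measurable_mass n : measurable_fun setT (fun x => fset_mass (F n) (P (k x))).
Proof.
under eq_fun do rewrite fset_mass_support.
by apply: measurable_sum => e; exact: (fdot_measurable fr).
Qed.

Let r_bound n x : 0 <= r n x <= 1.
Proof.
rewrite /r subr_ge0 (fset_mass_le onE) //=.
have := support_sqn_le (k x); rewrite (frame_norm fr).
have : 0 <= fset_mass (F n) (P (k x)) by rewrite -(sqn_fset_proj onE) ?sqn_ge0.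
lra.
Qed.

Let r_cvg : (fun n => \int[mu]_x (`|eta x| * r n x)) @ \oo --> (0 : R).
Proof.
have mP : measurable_fun setT (fun x => sqn (P (k x))).
  by apply: (measurable_fun_cvg (h := fun n x => fset_mass (F n) (P (k x)))) => // x _.
have me : measurable_fun setT (fun x => `|eta x|).
  exact: itg_measurable (itg_norm ei).
have [||||_ h] := @Rint_dct _ _ _ mu (fun n x => `|eta x| * r n x) (fun=> 0)
    (fun x => `|eta x|).
- by move=> n; apply: measurable_funM => //; apply: measurable_funB.
- move=> x; rewrite -(mulr0 `|eta x|); apply: cvgM; first exact: cvg_cst.
  rewrite -(subrr (sqn (P (k x)))); apply: cvgB; [exact: cvg_cst|exact: cvg_mass].
- exact: itg_norm.
- move=> n x; have /andP[h1 h2] := r_bound n x.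
  by rewrite normrM normr_id (ger0_norm h1) ler_piMr.
by move: h; rewrite {2}/Rintegral integral0.
Qed.

(** [is_trace] asks for control over every finite [G] containing [F n], not only along the sequence;
    this comes from [r] and its weighted integral [r_cvg]. The abstract [V] and [g] cover the real
    part with [S] and the imaginary part with ['i *: S]. *)
Lemma support_trace_cvg (V : H -> H) (g : H -> T -> R) (C : R) : 0 <= C ->
  (forall x, sqn (V (k x)) <= C) -> (forall e, measurable_fun setT (g e)) ->
  (forall G x, rip (fset_proj G (P (k x))) (V (k x)) = \sum_(e <- G) g e x) ->
  itg mu (fun x => eta x * rip (P (k x)) (V (k x))) /\
  forall eps : R, 0 < eps -> exists n, forall G : {fset H},
    [set` F n] `<=` [set` G] -> [set` G] `<=` E ->
    `|\int[mu]_x (eta x * \sum_(e <- G) g e x) -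
      \int[mu]_x (eta x * rip (P (k x)) (V (k x)))| <= eps.
Proof.
move=> C0 VC mg gE.
have mG (G : {fset H}) : measurable_fun setT (fun x => \sum_(e <- G) g e x).
  exact: measurable_sum.
have bG (G : {fset H}) x : [set` G] `<=` E -> `|\sum_(e <- G) g e x| <= (1 + C) / 2.
  move=> GE; rewrite -gE.
  have h1 := rip_le (fset_proj G (P (k x))) (V (k x)).
  have h2 := rip_le (- fset_proj G (P (k x))) (V (k x)).
  rewrite ripNl sqnN in h2.
  have h3 := fset_mass_le onE (P (k x)) GE; rewrite -(sqn_fset_proj onE) // in h3.
  have h4 := support_sqn_le (k x); rewrite (frame_norm fr) in h4.
  have h5 := VC x; rewrite ler_norml; lra.
have iG (G : {fset H}) : [set` G] `<=` E -> itg mu (fun x => eta x * \sum_(e <- G) g e x).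
  by move=> GE; apply: (itg_bounded_mul (M := (1 + C) / 2)) => // x; exact: bG.
have me : measurable_fun setT eta := itg_measurable ei.
have [||||iV _] := @Rint_dct _ _ _ mu (fun n x => eta x * \sum_(e <- F n) g e x)
    (fun x => eta x * rip (P (k x)) (V (k x))) (fun x => (1 + C) / 2 * `|eta x|).
- by move=> n; exact: measurable_funM.
- move=> x; apply: cvgM; first exact: cvg_cst.
  under eq_fun do rewrite -gE.
  exact: scvg_rip (support_expansion (k x)).
- by apply: itgZ; exact: itg_norm.
- by move=> n x; rewrite normrM mulrC ler_wpM2r // bG.
split => // eps eps0.
have I0 : 0 <= \int[mu]_x `|eta x| by apply: Rint_ge0.
pose I := \int[mu]_x `|eta x|.
(* Weight of the arithmetic-geometric mean inequality: half of [dl * C * I] is at most [eps / 2],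
   and the other half is paid for by making the integral of [|eta| * r] at most [dl * eps]. *)
pose dl := eps / (1 + C * I).
have CI : 0 < 1 + C * I by have := mulr_ge0 C0 I0; rewrite -/I; lra.
have dl0 : 0 < dl by rewrite divr_gt0.
have /cvgrPdist_le/(_ (dl * eps) (mulr_gt0 dl0 eps0)) [N _ hN] := r_cvg.
exists N => G FG GE.
have rG x : sqn (fset_proj G (P (k x)) - P (k x)) <= r N x.
  rewrite sqnBC (sqn_sub_fset_proj onE) // /r lerD2l lerN2.
  exact: (fset_massW onE).
have ir n : itg mu (fun x => `|eta x| * r n x).
  apply: (itg_bounded_mul (M := 1)); first exact: itg_norm.
    apply: measurable_funB => //.
    by apply: (measurable_fun_cvg (h := fun n x => fset_mass (F n) (P (k x)))) => // x _.
  by move=> x; have /andP[h1 h2] := r_bound n x; rewrite ger0_norm.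
rewrite -RintB //; last exact: iG.
have iB := itgB (iG _ GE) iV.
apply: le_trans (Rint_norm iB) _.
apply: (@le_trans _ _ (\int[mu]_x (dl * C / 2 * `|eta x| + dl^-1 / 2 * (`|eta x| * r N x)))).
  apply: Rint_le.
  - exact: itg_norm iB.
  - by apply: itgD; apply: itgZ => //; exact: itg_norm.
  move=> x; rewrite -mulrBr -gE -ripBl normrM.
  have -> : dl * C / 2 * `|eta x| + dl^-1 / 2 * (`|eta x| * r N x) =
    `|eta x| * (dl * C / 2 + dl^-1 / 2 * r N x) by ring.
  rewrite ler_wpM2l //; set w := fset_proj G _ - _.
  have h1 := rip_AMGM (V (k x)) w dl0.
  have h2 := rip_AMGM (- V (k x)) w dl0.
  rewrite ripNl sqnN in h2; rewrite !(ripC (V _)) in h1 h2.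
  have h3 := ler_wpM2l (ltW dl0) (VC x).
  have di : 0 <= dl^-1 by rewrite invr_ge0 ltW.
  have h4 := ler_wpM2l di (rG x); rewrite -/w in h4.
  by move: (dl^-1) h1 h2 h4 => di' h1 h2 h4; rewrite ler_norml; lra.
rewrite RintD ?RintZ //; [|exact: itg_norm|by apply: itgZ; exact: itg_norm|by apply: itgZ].
have := hN N (leqnn N); rewrite /= sub0r normrN => h.
have h1 := le_trans (ler_norm _) h.
have h2 : dl^-1 * \int[mu]_x (`|eta x| * r N x) <= eps by rewrite ler_pdivrMl.
have h3 : dl * C * I <= eps.
  have dE : dl * (1 + C * I) = eps by rewrite /dl divfK // gt_eqF.
  by rewrite -[leRHS]dE mulrDr mulr1 mulrA lerDr ltW.
rewrite -/I; set J := Rintegral _ _ _ in h2 *.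
have -> : dl * C / 2 * I + dl^-1 / 2 * J = (dl * C * I) / 2 + (dl^-1 * J) / 2 by ring.
by move: (dl * C * I) (dl^-1 * J) h2 h3 => p q; lra.
Qed.

End Basis.

Variable S : H -> H.
Hypotheses (bS : bounded_operator S) (sS : symmetric_op S).

(** Because the range of [A] is fixed by [P], [<A S e, e> = <A S e, P e>], the integral of [eta]
    against [fdot (S e) (P e)]. Summed over a finite set, the integrand is the inner product of
    [S k_x] with a partial expansion of [P k_x]. *)
Lemma trace_toeplitz :
  [/\ itg mu (fun x => eta x * rip (P (k x)) (S (k x))),
      itg mu (fun x => eta x * rip (P (k x)) ('i *: S (k x))) &
      trace (A \o S) = (\int[mu]_x (eta x * rip (P (k x)) (S (k x)))) +i*
                       (\int[mu]_x (eta x * rip (P (k x)) ('i *: S (k x))))].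
Proof.
have lS := bS.1; have [C C0 hC] := bounded_opP bS.
pose g1 e x := fdot (S e) (P e) x.
pose g2 e x := fdot (S e) ('i *: P e) x.
have VC1 x : sqn (S (k x)) <= C by apply: le_trans (hC _) _; rewrite (frame_norm fr) mulr1.
have VC2 x : sqn ('i *: S (k x)) <= C.
  rewrite sqnZ /= expr0n expr1n add0r sqrtr1 expr1n mul1r; exact: VC1.
have mg1 e : measurable_fun setT (g1 e) by exact: (fdot_measurable fr).
have mg2 e : measurable_fun setT (g2 e) by exact: (fdot_measurable fr).
have prod e x : conjc (hdot H (P (k x)) e) * hdot H (S (k x)) e =
    fdot (P e) (S e) x +i* fdot (P e) ('i *: S e) x.
  by rewrite -hdotC -(symmetric_hdot _ _ lP sP) (symmetric_hdot _ _ lS sS) fdot_hdot.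
have gE1 (G : {fset H}) x :
    rip (fset_proj G (P (k x))) (S (k x)) = \sum_(e <- G) g1 e x.
  by rewrite ripC rip_fset_proj; apply: eq_bigr => e _; rewrite prod /= /g1 fdotC.
have gE2 (G : {fset H}) x :
    rip (fset_proj G (P (k x))) ('i *: S (k x)) = \sum_(e <- G) g2 e x.
  rewrite ripC rip_fset_proj; apply: eq_bigr => e _.
  rewrite hdotZl mulrCA prod /g2 [in RHS]fdotC fdotiZ /=; ring.
(* One basis is enough for the integrability claims, whereas the value of the trace has to be
   checked on every basis. *)
have [E0 onE0] := @orthonormal_basis_exists R H.
have [F0 [FE0 Fm0 Fc0]] := toeplitz_fsets fr onE0 ei eta0.
have [i1 _] := support_trace_cvg onE0 FE0 Fm0 Fc0 (ltW C0) VC1 mg1 gE1.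
have [i2 _] := support_trace_cvg onE0 FE0 Fm0 Fc0 (V := fun f => 'i *: S f) (ltW C0) VC2 mg2 gE2.
split => //; apply: is_trace_trace => E onE eps eps0.
have [F [FE Fm Fc]] := toeplitz_fsets fr onE ei eta0.
have [_ h1] := support_trace_cvg onE FE Fm Fc (ltW C0) VC1 mg1 gE1.
have [_ h2] := support_trace_cvg onE FE Fm Fc (V := fun f => 'i *: S f) (ltW C0) VC2 mg2 gE2.
have e2 : 0 < eps / 2 by rewrite divr_gt0.
have [n1 {}h1] := h1 _ e2; have [n2 {}h2] := h2 _ e2.
exists (F (n1 + n2)%N); first exact: FE.
move=> G FG GE.
have {}h1 := h1 G (subset_trans (Fm _ _ (leq_addr _ _)) FG) GE.
have {}h2 := h2 G (subset_trans (Fm _ _ (leq_addl _ _)) FG) GE.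
have sE (g : H -> T -> R) (z : H -> H) : (forall e, itg mu (fun x => eta x * g e x)) ->
    (forall e, rip (A (S e)) (z e) = \int[mu]_x (eta x * g e x)) ->
    \int[mu]_x (eta x * \sum_(e <- G) g e x) = \sum_(e <- G) rip (A (S e)) (z e).
  move=> ig hg; rewrite (eq_bigr _ (fun e _ => hg e)) -Rint_sum //.
  by apply: eq_Rintegral => x _; rewrite mulr_sumr.
have s1 := sE g1 id (fun e => itg_fdot fr (S e) (P e) ei).
rewrite s1 in h1; last first.
  by move=> e; rewrite toeplitz_support (toeplitz_rip fr).
have s2 := sE g2 (fun e => 'i *: e) (fun e => itg_fdot fr (S e) ('i *: P e) ei).
rewrite s2 in h2; last first.
  by move=> e; rewrite toeplitz_support (linZ _ _ lP) (toeplitz_rip fr).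
have -> : \sum_(e <- G) hdot H ((A \o S) e) e =
    (\sum_(e <- G) rip (A (S e)) e) +i* (\sum_(e <- G) rip (A (S e)) ('i *: e)).
  elim: {h1 h2 s1 s2 sE FG GE} (enum_fset G) => [|e l ih]; first by rewrite !big_nil.
  by rewrite !big_cons ih hdotE.
rewrite -[X in _ <= X]/(eps%:C) -[X in X <= _]/((normc _)%:C) lecR.
set p := (\sum_(e <- G) rip (A (S e)) e) in h1 *.
set q := (\sum_(e <- G) rip (A (S e)) ('i *: e)) in h2 *.
rewrite /= -(@ler_pXn2r _ 2) ?nnegrE ?sqrtr_ge0 ?(ltW eps0) // sqr_sqrtr ?addr_ge0 ?sqr_ge0 //.
rewrite -[(p - _) ^+ 2]real_normK ?num_real // -[(q - _) ^+ 2]real_normK ?num_real //.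
rewrite /= in h1 h2.
move: `|p - _| `|q - _| (normr_ge0 (p - \int[mu]_x (eta x * rip (P (k x)) (S (k x)))))
  (normr_ge0 (q - \int[mu]_x (eta x * rip (P (k x)) ('i *: S (k x))))) h1 h2 => x y x0 y0 h1 h2.
by nra.
Qed.

End TraceFormula.

(** * Convergence of Berezin transforms *)

Section PowerInequalities.
Variable R : realType.
Implicit Types a b c p t x : R.

(** The tangent line to [t^p] at [b] lies below the graph. It is Young's inequality for the
    exponents [p] and [p / (p - 1)], and Jensen's inequality follows by integration. *)
Lemma powR_tangent p t b : 1 <= p -> 0 <= t -> 0 <= b ->
  p * (t * b `^ (p - 1)) <= t `^ p + (p - 1) * b `^ p.
Proof.
move=> p1 t0 b0; have [->|pn] := eqVneq p 1.
  by rewrite subrr mul0r addr0 powRr0 mulr1 mul1r powRr1.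
have q0 : 0 < p - 1 by rewrite subr_gt0 lt_neqAle eq_sym pn.
have p0 : 0 < p by lra.
have := @conjugate_powR R t (b `^ (p - 1)) p (p / (p - 1)) t0 (powR_ge0 _ _) p0
  (divr_gt0 p0 q0).
have -> : p^-1 + (p / (p - 1))^-1 = 1 by field; rewrite !gt_eqF.
move=> /(_ erefl); rewrite -powRrM.
have -> : (p - 1) * (p / (p - 1)) = p by field; rewrite gt_eqF.
move=> h; have := ler_wpM2l (ltW p0) h.
have -> : p * (t `^ p / p + b `^ p / (p / (p - 1))) = t `^ p + (p - 1) * b `^ p.
  by field; rewrite !gt_eqF.
by [].
Qed.

Lemma le_powR p a b : 0 <= p -> 0 <= a -> a <= b -> a `^ p <= b `^ p.
Proof.
move=> p0 a0 ab; apply: ge0_ler_powR => //; rewrite nnegrE //.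
exact: le_trans ab.
Qed.

Lemma powR_add3 p a b c : 0 <= p -> 0 <= a -> 0 <= b -> 0 <= c ->
  (a + b + c) `^ p <= 3 `^ p * (a `^ p + b `^ p + c `^ p).
Proof.
move=> p0 a0 b0 c0; have := powR_ge0 a p; have := powR_ge0 b p; have := powR_ge0 c p.
move=> hc hb ha; have h3 := powR_ge0 (3 : R) p.
have step m : 0 <= m -> a + b + c <= 3 * m -> (a + b + c) `^ p <= 3 `^ p * m `^ p.
  by move=> m0 hm; rewrite -powRM // le_powR // !addr_ge0.
have [ab|ab] := leP a b.
  have [bc|bc] := leP b c.
    by apply: le_trans (step c c0 _) _; [lra|rewrite ler_wpM2l //; lra].
  by apply: le_trans (step b b0 _) _; [lra|rewrite ler_wpM2l //; lra].
have [ac|ac] := leP a c.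
  by apply: le_trans (step c c0 _) _; [lra|rewrite ler_wpM2l //; lra].
by apply: le_trans (step a a0 _) _; [lra|rewrite ler_wpM2l //; lra].
Qed.

Lemma powR_add2 p a b : 0 <= p -> 0 <= a -> 0 <= b -> p != 0 ->
  (a + b) `^ p <= 3 `^ p * (a `^ p + b `^ p).
Proof.
move=> p0 a0 b0 pn; have := powR_add3 p0 a0 b0 (lexx 0).
by rewrite powR0 // !addr0.
Qed.

Lemma le1_powR p a : 1 <= p -> 0 <= a -> a <= 1 + a `^ p.
Proof.
move=> p1 a0; have [a1|a1] := leP a 1; first by have := powR_ge0 a p; lra.
have : a `^ 1 <= a `^ p by rewrite ler_powR // ltW.
by rewrite powRr1 //; lra.
Qed.

Lemma measurable_normr_powR d (T : measurableType d) p (f : T -> R) :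
  measurable_fun setT f -> measurable_fun setT (fun y => `|f y| `^ p).
Proof.
move=> mf; have mn : measurable_fun setT (fun y => `|f y|) by exact: measurableT_comp.
exact: (measurableT_comp (measurable_powR p) mn).
Qed.

Lemma mul_le_of_le_div1D a b x : 0 <= a -> x <= b / (1 + a) -> 0 <= b -> a * x <= b.
Proof.
move=> a0 xb b0; apply: le_trans (ler_wpM2l a0 xb) _.
have a1 : 0 < 1 + a by rewrite ltr_pwDl.
by rewrite mulrA ler_pdivrMr // mulrC ler_wpM2l //; lra.
Qed.

End PowerInequalities.

(** * Frames for a multiple of a fixed measure, and contraction in L^p *)

Section ScaledFrame.
Context d (T : measurableType d) (R : realType).
Variables (nu mu : {measure set T -> \bar R}) (c : R).
Hypotheses (c0 : 0 < c)
  (scale : forall B, measurable B -> mu B = (c%:E * nu B)%E).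
Implicit Types (s f g : T -> R) (x y : T).

Lemma ge0_integral_scale (f : T -> \bar R) : measurable_fun setT f ->
  (forall x, (0 <= f x)%E) -> (\int[mu]_x f x = c%:E * \int[nu]_x f x)%E.
Proof.
move=> mf f0; rewrite (eq_measure_integral (mscale (NngNum (ltW c0)) nu)).
  by rewrite ge0_integral_mscale.
by move=> B mB _; rewrite scale.
Qed.

Lemma ae_scale (P : T -> Prop) : (\forall x \ae nu, P x) -> \forall x \ae mu, P x.
Proof. by move=> [B [mB B0 PB]]; exists B; split => //; rewrite scale // B0 mule0. Qed.

Lemma itg_scale f : itg nu f <-> itg mu f.
Proof.
have E : measurable_fun setT f ->
    (\int[mu]_x `|(f x)%:E| = c%:E * \int[nu]_x `|(f x)%:E|)%E.
  move=> mf; apply: ge0_integral_scale => //.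
  by apply: measurableT_comp => //; exact/measurable_EFinP.
split=> /integrableP[m h]; apply/integrableP; split => //.
  rewrite E; last exact/measurable_EFinP.
  by rewrite lte_mul_pinfty ?lee_fin ?(ltW c0).
have := h; rewrite E; last exact/measurable_EFinP.
case: (\int[nu]_x _)%E => [r _| |_]; first exact: ltry.
  by rewrite mulry gtr0_sg // mul1e.
by [].
Qed.

Lemma Rint_scale f : itg nu f -> \int[mu]_x f x = c * \int[nu]_x f x.
Proof.
move=> i.
have pos g : itg nu g -> (forall x, 0 <= g x) -> \int[mu]_x g x = c * \int[nu]_x g x.
  move=> ig g0; apply: EFin_inj; rewrite EFinM -!Rint_ereal //; last exact/itg_scale.
  apply: ge0_integral_scale => [|x]; last by rewrite lee_fin.
  exact: measurable_int ig.
have in_ := itg_norm i.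
have i2 : itg nu (fun x => `|f x| + f x) by exact: itgD.
have E m : itg m f -> \int[m]_x f x = \int[m]_x (`|f x| + f x) - \int[m]_x `|f x|.
  by move=> im; rewrite RintD //; [ring|exact: itg_norm].
rewrite !E //; last exact/itg_scale.
rewrite !pos //; first by ring.
by move=> x; have := ler_norm (- f x); rewrite normrN; lra.
Qed.

Variables (H : hilbertSpace R) (k : T -> H).
Hypothesis fr : real_frame mu k.
Local Notation fdot := (fdot k).
Local Notation bz := (bz mu k).

Let kk x y := fdot (k x) (k x) y.

Lemma kernel_bounds x y : 0 <= kk x y <= 1.
Proof. by rewrite /kk fdot_ge0 -(frame_norm fr x) (fdot_le fr). Qed.

Lemma kernel_itg x : itg mu (kk x). Proof. exact: (frame_itg fr). Qed.
Lemma kernel_int x : \int[mu]_y kk x y = 1.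
Proof. by rewrite (frame_rip fr) -[RHS](frame_norm fr x). Qed.

Lemma berezin_contraction s : itg nu s -> (\forall x \ae nu, 0 <= s x) ->
  [/\ itg nu (bz s), forall x, 0 <= bz s x & \int[nu]_x bz s x <= \int[nu]_x s x].
Proof.
move=> si s0; have si' : itg mu s by exact/itg_scale.
have [i h] := bz_contraction fr si' (ae_scale s0).
have i' : itg nu (bz s) by exact/itg_scale.
split => // [x|]; first exact: (bz_ge0 fr _ si' (ae_scale s0)).
by move: h; rewrite !Rint_scale // ler_pM2l.
Qed.

(** The contraction lemma gives measurability for nonnegative symbols; [s] is the difference of
    [|s| + s] and [|s|]. *)
Lemma bz_measurable s : itg nu s -> measurable_fun setT (bz s).
Proof.
move=> si; have si' : itg mu s by exact/itg_scale.
have ni := itg_norm si.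
have i2 : itg nu (fun x => `|s x| + s x) by exact: itgD.
have [h1 _ _] := berezin_contraction ni (aeW _ (fun x => normr_ge0 (s x))).
have [|h2 _ _] := berezin_contraction i2.
  by apply: aeW => x; have := ler_norm (- s x); rewrite normrN; lra.
have -> : bz s = (fun x => bz (fun x => `|s x| + s x) x - bz (fun x => `|s x|) x).
  apply/funext => x; rewrite /bz -RintB.
  - by apply: eq_Rintegral => y _; ring.
  - by apply: (itg_fdot fr); exact/itg_scale.
  - by apply: (itg_fdot fr); exact/itg_scale.
by apply: measurable_funB; [exact: itg_measurable h2|exact: itg_measurable h1].
Qed.

Section Power.
Variable p : R.
Hypothesis p1 : 1 <= p.
Let p0 : 0 < p. Proof. exact: lt_le_trans ltr01 p1. Qed.
Variable s : T -> R.
Hypotheses (ms : measurable_fun setT s) (si : itg nu (fun x => `|s x| `^ p)).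

Let mk x : measurable_fun setT (kk x). Proof. exact: (fdot_measurable fr). Qed.

Lemma kernel_power_itg x : itg mu (fun y => `|s y| `^ p * kk x y).
Proof. by apply: (itg_fdot fr); exact/itg_scale. Qed.

Lemma kernel_itg_norm x : itg mu (fun y => `|s y| * kk x y).
Proof.
apply: (@itg_dom _ _ _ _ _ (fun y => kk x y + `|s y| `^ p * kk x y)).
- apply: measurable_funM; last exact: mk.
  exact: measurableT_comp.
- by apply: itgD; [exact: kernel_itg|exact: kernel_power_itg].
move=> y; have /andP[h0 _] := kernel_bounds x y.
rewrite ger0_norm ?mulr_ge0 // -[X in _ <= X + _]mul1r -mulrDl ler_wpM2r //.
exact: le1_powR.
Qed.

Lemma kernel_itg_p x : itg mu (fun y => s y * kk x y).
Proof.
apply: (itg_dom _ (kernel_itg_norm x)); first exact: measurable_funM.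
by move=> y; have /andP[h0 _] := kernel_bounds x y; rewrite normrM (ger0_norm h0).
Qed.

(** Integrate [powR_tangent] at the mean [b] of [|s|] against the kernel, which has total mass 1. *)
Lemma berezin_jensen x : `|bz s x| `^ p <= bz (fun y => `|s y| `^ p) x.
Proof.
pose b := \int[mu]_y (`|s y| * kk x y).
have b0 : 0 <= b.
  by apply: Rint_ge0 => y; have /andP[h0 _] := kernel_bounds x y; rewrite mulr_ge0.
have le1 : `|bz s x| <= b.
  apply: le_trans (Rint_norm (kernel_itg_p x)) _.
  rewrite le_eqVlt; apply/orP; left; apply/eqP; apply: eq_Rintegral => y _.
  by have /andP[h0 _] := kernel_bounds x y; rewrite normrM (ger0_norm h0).
apply: le_trans (le_powR (ltW p0) (normr_ge0 _) le1) _.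
have i1 := kernel_itg_norm x; have i2 := kernel_power_itg x; have i3 := kernel_itg x.
have : \int[mu]_y (p * b `^ (p - 1) * (`|s y| * kk x y)) <=
    \int[mu]_y (`|s y| `^ p * kk x y + (p - 1) * b `^ p * kk x y).
  apply: Rint_le; [exact: itgZ|by apply: itgD => //; exact: itgZ|].
  move=> y; have /andP[h0 _] := kernel_bounds x y.
  have := ler_wpM2r h0 (powR_tangent p1 (normr_ge0 (s y)) b0); lra.
rewrite RintD //; last exact: itgZ.
rewrite !RintZ // kernel_int -/b.
have -> : p * b `^ (p - 1) * b = p * b `^ p.
  have [bz0|bn] := eqVneq b 0; first by rewrite bz0 mulr0 powR0 ?mulr0 ?gt_eqF.
  rewrite -mulrA; congr (_ * _); rewrite -{2}(powRr1 b0) -powRD ?subrK //.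
  by rewrite bn implybT.
have -> : \int[mu]_y (`|s y| `^ p * kk x y) = bz (fun y => `|s y| `^ p) x by [].
by lra.
Qed.

(** Small values are cut off as well as large ones: on a space of infinite measure, a bounded
    function of L^p becomes integrable only once it is supported on a set of finite measure. *)
Definition truncate (N : nat) x : R :=
  if (N.+1%:R^-1 <= `|s x|) && (`|s x| <= N.+1%:R) then s x else 0.

Lemma truncate_le N x : `|truncate N x| <= `|s x|.
Proof. by rewrite /truncate; case: ifP => // _; rewrite normr0. Qed.

Lemma truncate_bound N x : `|truncate N x| <= N.+1%:R.
Proof. by rewrite /truncate; case: ifP => [/andP[]//|_]; rewrite normr0. Qed.

Lemma truncate_cvg x : \forall N \near \oo, truncate N x = s x.
Proof.
have [s0|s0] := eqVneq (s x) 0.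
  by apply: nearW => N; rewrite /truncate s0; case: ifP.
have sp : 0 < `|s x| by rewrite normr_gt0.
have [N _ hN] := near_infty_natSinv_lt (PosNum sp).
exists (N + Num.truncn `|s x|)%N => // n /= nN; rewrite /truncate ifT //.
rewrite (ltW (hN n _)) //=; last exact: leq_trans (leq_addr _ _) nN.
apply: le_trans (ltW (truncnS_gt _)) _; rewrite ler_nat ltnS.
exact: leq_trans (leq_addl _ _) nN.
Qed.

Lemma truncate_measurable N : measurable_fun setT (truncate N).
Proof.
have mn : measurable_fun setT (fun x => `|s x|) by exact: measurableT_comp.
apply: measurable_fun_ifT => //; apply: measurable_and.
  by apply: measurable_fun_ler.
by apply: measurable_fun_ler.
Qed.

Lemma truncate_itg N : itg nu (truncate N).
Proof.
apply: (@itg_dom _ _ _ _ _ (fun x => N.+1%:R / N.+1%:R^-1 `^ p * `|s x| `^ p)).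
- exact: truncate_measurable.
- exact: itgZ.
have q0 : 0 < N.+1%:R^-1 `^ p :> R by rewrite powR_gt0 ?invr_gt0.
move=> x; rewrite /truncate; case: ifP => [/andP[h1 h2]|_]; last first.
  by rewrite normr0 mulr_ge0 ?powR_ge0 ?divr_ge0 ?ltW.
apply: le_trans h2 _; rewrite -mulrA ler_peMr //.
by rewrite mulrC ler_pdivlMr // mul1r; apply: le_powR; [exact: ltW|rewrite invr_ge0|].
Qed.

Lemma bz_truncate_cvg x : (fun N => bz (truncate N) x) @ \oo --> bz s x.
Proof.
have [||||_ h] := @Rint_dct _ _ _ mu (fun N y => truncate N y * kk x y)
    (fun y => s y * kk x y) (fun y => `|s y| * kk x y).
- by move=> n; apply: measurable_funM => //; exact: truncate_measurable.
- move=> y; apply: cvg_near_cst; have := truncate_cvg y.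
  by apply: filterS => N ->.
- exact: kernel_itg_norm.
- move=> N y; have /andP[h0 _] := kernel_bounds x y.
  by rewrite normrM (ger0_norm h0) ler_wpM2r // truncate_le.
exact: h.
Qed.

(** A function of L^p need not be integrable, so measurability is obtained as a limit over
    truncations. *)
Lemma bz_measurable_p : measurable_fun setT (bz s).
Proof.
apply: (measurable_fun_cvg (h := fun N => bz (truncate N))) => [N|x _].
  by apply: bz_measurable; exact: truncate_itg.
exact: bz_truncate_cvg.
Qed.

Lemma berezin_power : itg nu (fun x => `|bz s x| `^ p) /\
  \int[nu]_x `|bz s x| `^ p <= \int[nu]_x `|s x| `^ p.
Proof.
have [i _ h] := berezin_contraction si (aeW _ (fun x => powR_ge0 `|s x| p)).
have i' : itg nu (fun x => `|bz s x| `^ p).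
  apply: (itg_dom _ i); first exact: measurable_normr_powR bz_measurable_p.
  by move=> x; rewrite ger0_norm ?powR_ge0 // berezin_jensen.
split; first exact: i'.
apply: le_trans h; apply: Rint_le i' i _ => x; exact: berezin_jensen.
Qed.

End Power.
End ScaledFrame.

Import HBSimple.

(** * Convergence of Berezin transforms along a sequence of frames *)

Section LocalizedSequences.
Variables (R : realType) (X : ptopologicalType).
Variable nu : {measure set (borel X) -> \bar R}.
Hypothesis nu_radon : radon_measure nu.
Variables (mu : nat -> {measure set (borel X) -> \bar R}) (c : nat -> R).
Hypotheses (c0 : forall n, 0 < c n) (scale : forall n (B : set (borel X)),
  measurable B -> mu n B = ((c n)%:E * nu B)%E).
Variables (H : nat -> hilbertSpace R) (k : forall n, borel X -> H n).
Hypothesis fr : forall n, real_frame (mu n) (k n).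

Definition localized := forall (x : X) (U : set (borel X)),
  measurable U -> nbhs x (U : set X) ->
  (fun n => \int[mu n]_(y in ~` U) (fdot (k n) (k n x) (k n x) y)%:E)%E @ \oo --> 0%E.
Hypothesis loc : localized.
Implicit Types (s : borel X -> R) (x y : borel X) (e : R) (n : nat) (B U : set (borel X)).

Local Notation B_ n := (bz (mu n) (k n)).
Local Notation K_ n x := (fdot (k n) (k n x) (k n x)).

Lemma measurable_open U : open (U : set X) -> measurable U.
Proof. by move=> oU; exact: sub_sigma_algebra. Qed.

Lemma itg_mu n s : itg nu s -> itg (mu n) s.
Proof. exact: (itg_scale (c0 n) (@scale n) s).1. Qed.

Lemma itg_kernel n s x : itg nu s -> itg (mu n) (fun y => s y * K_ n x y).
Proof. by move=> si; apply: (itg_fdot (fr n)); exact: itg_mu. Qed.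

Lemma bz_comb n a s s' x : itg nu s -> itg nu s' ->
  B_ n (fun y => a * s y + s' y) x = a * B_ n s x + B_ n s' x.
Proof.
move=> si si'; have i := itg_kernel n x si; have i' := itg_kernel n x si'.
rewrite /bz -RintZ // -RintD //; last exact: itgZ.
by apply: eq_Rintegral => y _; ring.
Qed.

Lemma bz_norm n s : itg nu s -> itg nu (B_ n s) /\
  \int[nu]_x `|B_ n s x| <= \int[nu]_x `|s x|.
Proof.
move=> si; have ni := itg_norm si.
have [h1 h2 h3] := berezin_contraction (c0 n) (@scale n) (fr n) ni
  (aeW _ (fun x => normr_ge0 (s x))).
have le x : `|B_ n s x| <= B_ n (fun y => `|s y|) x.
  apply: le_trans (Rint_norm (itg_kernel n x si)) _.
  rewrite le_eqVlt; apply/orP; left; apply/eqP; apply: eq_Rintegral => y _.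
  by rewrite normrM (ger0_norm (fdot_ge0 _ _ _)).
have i : itg nu (B_ n s).
  by apply: itg_dom h1 le; exact: (bz_measurable (c0 n) (@scale n) (fr n) si).
split => //; apply: le_trans h3; apply: Rint_le => //; exact: itg_norm.
Qed.

Definition L1cvg s := itg nu s /\
  (fun n => \int[nu]_x `|B_ n s x - s x|) @ \oo --> (0 : R).

Lemma cvg0_le (u : nat -> R) : (forall n, 0 <= u n) ->
  (forall e, 0 < e -> \forall n \near \oo, u n <= e) -> u @ \oo --> (0 : R).
Proof.
move=> u0 h; apply/cvgrPdist_le => e e0.
by apply: filterS (h e e0) => n; rewrite sub0r normrN ger0_norm.
Qed.

Lemma cvg0_near (u : nat -> R) : u @ \oo --> (0 : R) ->
  forall e, 0 < e -> \forall n \near \oo, u n <= e.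
Proof.
move=> /cvgrPdist_le h e e0; apply: filterS (h e e0) => n.
rewrite sub0r normrN; exact: le_trans (ler_norm _).
Qed.

Lemma itg_err n s : itg nu s -> itg nu (fun x => `|B_ n s x - s x|).
Proof. by move=> si; apply: itg_norm; apply: itgB => //; exact: (bz_norm n si).1. Qed.

(** Write [B s - s = B (s - s') + (B s' - s') - (s - s')]; contractivity makes the first term as
    small as the last, uniformly in [n]. *)
Lemma L1cvg_approx s : itg nu s ->
  (forall e, 0 < e -> exists2 s', L1cvg s' & \int[nu]_x `|s x - s' x| <= e) ->
  L1cvg s.
Proof.
move=> si h; split => //; apply: cvg0_le => [n|e e0]; first exact: Rint_ge0.
have [s' [si' cs'] hs'] := h (e / 3) (ltac:(by rewrite divr_gt0)).
have idf : itg nu (fun x => s x - s' x) by exact: itgB.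
have := cvg0_near cs' (ltac:(by rewrite divr_gt0) : 0 < e / 3).
apply: filterS => n hn.
have [ib hb] := bz_norm n idf.
apply: (@le_trans _ _ (\int[nu]_x (`|B_ n (fun y => s y - s' y) x| +
   `|B_ n s' x - s' x| + `|s x - s' x|))).
  apply: Rint_le; first exact: itg_err.
    by apply: itgD; [apply: itgD; [exact: itg_norm|exact: itg_err]|exact: itg_norm].
  move=> x.
  have -> : B_ n s x = B_ n (fun y => s y - s' y) x + B_ n s' x.
    rewrite -[X in X + _]mul1r -bz_comb //; apply: eq_Rintegral => y _; ring.
  set p := B_ n (fun y => _) x; set q := B_ n s' x.
  have -> : p + q - s x = p + (q - s' x) - (s x - s' x) by ring.
  by apply: le_trans (ler_normB _ _) _; rewrite lerD2r ler_normD.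
rewrite RintD; [|by apply: itgD; [exact: itg_norm|exact: itg_err]|exact: itg_norm].
by rewrite RintD; [lra|exact: itg_norm|exact: itg_err].
Qed.

Lemma L1cvg_comb a s s' : L1cvg s -> L1cvg s' -> L1cvg (fun x => a * s x + s' x).
Proof.
move=> [si cs] [si' cs']; have i : itg nu (fun x => a * s x + s' x).
  by apply: itgD => //; exact: itgZ.
split => //; apply: cvg0_le => [n|e e0]; first exact: Rint_ge0.
have a0 : 0 < 2 * (1 + `|a|) by have := normr_ge0 a; lra.
have h1 := cvg0_near cs (divr_gt0 e0 a0).
have h2 := cvg0_near cs' (ltac:(by rewrite divr_gt0) : 0 < e / 2).
apply: filterS2 h1 h2 => n h1 h2.
apply: (@le_trans _ _ (\int[nu]_x (`|a| * `|B_ n s x - s x| + `|B_ n s' x - s' x|))).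
  apply: Rint_le; first exact: itg_err.
    by apply: itgD; [apply: itgZ; exact: itg_err|exact: itg_err].
  move=> x; rewrite bz_comb //.
  have -> : a * B_ n s x + B_ n s' x - (a * s x + s' x) =
    a * (B_ n s x - s x) + (B_ n s' x - s' x) by ring.
  by apply: le_trans (ler_normD _ _) _; rewrite normrM.
rewrite RintD; [|by apply: itgZ; exact: itg_err|exact: itg_err].
rewrite RintZ; last exact: itg_err.
have an := normr_ge0 a; have := ler_wpM2l an h1.
have : `|a| * (e / (2 * (1 + `|a|))) <= e / 2.
  have -> : e / 2 = (1 + `|a|) * (e / (2 * (1 + `|a|))).
    by field; rewrite gt_eqF //; lra.
  by rewrite ler_wpM2r ?divr_ge0 ?ltW //; lra.
by lra.
Qed.

Lemma L1cvg0 : L1cvg (fun=> 0).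
Proof.
split; first exact: itg0.
have z m (f : borel X -> R) : (forall x, f x = 0) -> \int[m]_x f x = 0.
  move=> f0; rewrite (@eq_Rintegral _ _ _ m setT (fun=> 0)) => [|x _]; last exact: f0.
  by rewrite /Rintegral integral0.
have -> : (fun n => \int[nu]_x `|B_ n (fun=> 0) x - 0|) = (fun=> 0).
  apply/funext => n; apply: (z) => x; rewrite subr0 /bz z ?normr0 // => y.
  by rewrite mul0r.
exact: cvg_cst.
Qed.

Lemma itg_indic B : measurable B -> (nu B < +oo)%E -> itg nu \1_B.
Proof.
move=> mB fB; apply/integrableP; split; first by apply/measurable_EFinP.
rewrite (eq_integral (EFin \o \1_B)); last first.
  by move=> x _ /=; rewrite ger0_norm // indicE.
by rewrite integral_indic // setIT.
Qed.

Lemma Rint_indic B : measurable B -> \int[nu]_x \1_B x = fine (nu B).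
Proof. by move=> mB; rewrite /Rintegral integral_indic // setIT. Qed.

Lemma localization_open U x : open (U : set X) -> (nu U < +oo)%E -> U x ->
  (fun n => B_ n \1_U x) @ \oo --> (1 : R).
Proof.
move=> oU fU Ux; have mU := measurable_open oU.
have iU := itg_indic mU fU.
have E n : B_ n \1_U x = 1 - fine (\int[mu n]_(y in ~` U) (K_ n x y)%:E).
  rewrite -[fine _]/(Rintegral _ _ _) Rintegral_mkcond.
  rewrite (@eq_Rintegral _ _ _ (mu n) setT (fun y => K_ n x y - \1_U y * K_ n x y)); last first.
    move=> y _; rewrite patchE in_setC indicE.
    by case: (y \in U) => /=; [rewrite mul1r subrr|rewrite mul0r subr0].
  rewrite RintB; [|exact: (frame_itg (fr n))|exact: itg_kernel].
  by rewrite (kernel_int (fr n)) /bz; ring.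
under eq_fun do rewrite E.
have l : (fun n => fine (\int[mu n]_(y in ~` U) (K_ n x y)%:E)) @ \oo --> (0 : R).
  by apply: fine_cvg; apply: loc => //; exact: open_nbhs_nbhs.
have l1 : cst (1 : R) @ \oo --> (1 : R) by exact: cvg_cst.
by have := cvgB l1 l; rewrite subr0; exact.
Qed.

(** Pointwise convergence is available on [U] only, and the mass outside is controlled by
    contractivity. Since [B 1_U] lies between 0 and 1, [|B 1_U - 1_U| = (B 1_U - 1_U) + 2 * 1_U (1 -
    B 1_U)]; the first summand has integral at most 0 and the second is dominated by [2 * 1_U]. *)
Lemma L1cvg_open U : open (U : set X) -> (nu U < +oo)%E -> L1cvg \1_U.
Proof.
move=> oU fU; have mU := measurable_open oU; have iU := itg_indic mU fU.
split => //.
have bU n x : 0 <= B_ n \1_U x <= 1.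
  have i := itg_kernel n x iU; rewrite /bz; apply/andP; split.
    by apply: Rint_ge0 => y; rewrite indicE mulr_ge0 ?fdot_ge0.
  rewrite -(kernel_int (fr n) x); apply: Rint_le => //; first exact: (frame_itg (fr n)).
  by move=> y; rewrite indicE ler_piMl ?fdot_ge0 // lern1 leq_b1.
have mB n : measurable_fun setT (B_ n \1_U).
  exact: (bz_measurable (c0 n) (@scale n) (fr n)).
have m1 : measurable_fun setT (\1_U : borel X -> R) by exact: itg_measurable iU.
have gb n x : (0 : R) <= \1_U x * (1 - B_ n \1_U x) <= \1_U x.
  have /andP[h1 h2] := bU n x; have : 0 <= \1_U x :> R by rewrite indicE.
  by nra.
have mg n : measurable_fun setT (fun x => \1_U x * (1 - B_ n \1_U x)).
  by apply: measurable_funM => //; exact: measurable_funB.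
have ig n : itg nu (fun x => \1_U x * (1 - B_ n \1_U x)).
  by apply: (itg_dom _ iU) => // x; have /andP[h1 h2] := gb n x; rewrite ger0_norm.
have [||||_ h] := @Rint_dct _ _ _ nu (fun n x => \1_U x * (1 - B_ n \1_U x)) (fun=> 0) \1_U.
- exact: mg.
- move=> x; rewrite indicE; have [xU|xU] := boolP (x \in U); last first.
    by under eq_fun do rewrite mul0r; exact: cvg_cst.
  under eq_fun do rewrite mul1r.
  rewrite -(subrr (1 : R)); apply: cvgB; first exact: cvg_cst.
  by apply: localization_open => //; exact/set_mem.
- exact: iU.
- by move=> n x; have /andP[h1 h2] := gb n x; rewrite ger0_norm.
rewrite {2}/Rintegral integral0 /= in h.
apply: cvg0_le => [n|e e0]; first exact: Rint_ge0.
have := cvg0_near h (ltac:(by rewrite divr_gt0) : 0 < e / 2).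
apply: filterS => n hn.
have [ib _] := bz_norm n iU.
have [_ _ hb] := berezin_contraction (c0 n) (@scale n) (fr n) iU
  (aeW _ (fun x => (ltac:(by rewrite indicE) : 0 <= \1_U x :> R))).
apply: (@le_trans _ _ (\int[nu]_x ((B_ n \1_U x - \1_U x) +
    2 * (\1_U x * (1 - B_ n \1_U x))))).
  apply: Rint_le; first exact: itg_err.
    by apply: itgD; [exact: itgB|exact: itgZ].
  move=> x; have /andP[h1 h2] := bU n x; rewrite indicE; case: (x \in U) => /=.
    by rewrite ler0_norm; lra.
  by rewrite ger0_norm; lra.
rewrite RintD; [|exact: itgB|exact: itgZ].
by rewrite RintB // RintZ //; lra.
Qed.

Lemma L1cvg_borel B : measurable B -> (nu B < +oo)%E -> L1cvg \1_B.
Proof.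
move=> mB fB; have iB := itg_indic mB fB.
apply: L1cvg_approx => // e e0.
have [_ oreg _] := nu_radon.
have fin : nu B \is a fin_num by rewrite ge0_fin_numE.
have [|_ [U [oU BU] <-] hU] := lb_ereal_inf_adherent e0
  (S := [set nu U | U in [set U : set X | open U /\ B `<=` U]]).
  by rewrite -oreg.
rewrite -oreg // in hU.
have fU : (nu U < +oo)%E by apply: lt_trans hU _; rewrite lte_add_pinfty // ltry.
have mU := measurable_open oU.
exists \1_U; first exact: L1cvg_open.
rewrite (@eq_Rintegral _ _ _ nu setT (fun x => \1_U x - \1_B x)); last first.
  move=> x _; rewrite !indicE; have [xB|xB] := boolP (x \in B); last first.
    by rewrite sub0r normrN subr0 ger0_norm.
  by rewrite (_ : x \in U) ?subrr ?normr0 //; apply/mem_set/BU/set_mem.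
rewrite RintB //; last exact: itg_indic.
rewrite !Rint_indic //.
have finU : nu U \is a fin_num by rewrite ge0_fin_numE.
have := ltW hU; rewrite -{1}(fineK finU) -(fineK fin) -EFinD lee_fin /=.
by lra.
Qed.

Lemma L1cvg_sfun (g : {sfun borel X >-> R}) : itg nu g -> L1cvg g.
Proof.
move=> ig.
have mg : measurable_fun setT g by exact: measurable_funP.
have level t : t != 0 -> L1cvg \1_(g @^-1` [set t]).
  move=> t0; have mB : measurable (g @^-1` [set t]).
    by rewrite -[X in measurable X]setTI; apply: mg => //; exact: measurable_set1.
  apply: L1cvg_borel => //.
  (* Chebyshev: the level set of a nonzero value has finite measure because [g] is integrable. *)
  have i : itg nu \1_(g @^-1` [set t]).
    apply: (itg_dom _ (itgZ `|t|^-1 (itg_norm ig))) => // x.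
    rewrite indicE; have [xt|xt] := boolP (x \in _) => /=; last first.
      by rewrite normr0 mulr_ge0 ?invr_ge0.
    by move/set_mem : xt => /= ->; rewrite normr1 mulVf // normr_eq0.
  by have := integrable_lty measurableT i; rewrite integral_indic // setIT.
have -> : (g : borel X -> R) = (fun x => \sum_(t <- fset_set (range g)) t * \1_(g @^-1` [set t]) x).
  by apply/funext => x; rewrite {1}fimfunE fsbig_finite.
elim: (enum_fset _) => [|t l ih].
  by under eq_fun do rewrite big_nil; exact: L1cvg0.
under eq_fun do rewrite big_cons.
have [->|t0] := eqVneq t 0; last by apply: L1cvg_comb => //; exact: level.
by under eq_fun do rewrite mul0r add0r.
Qed.

Lemma L1cvg_itg s : itg nu s -> L1cvg s.
Proof.
move=> si; apply: L1cvg_approx => // e e0.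
have [g [ig _ cg]] := approximation_sfun_integrable measurableT si.
have cg' : (fun n => \int[nu]_x `|s x - g n x|) @ \oo --> (0 : R).
  by apply: fine_cvg; apply: cvg_trans cg; apply: near_eq_cvg; apply: nearW => n.
have [N _ hN] := cvg0_near cg' e0.
by exists (g N); [exact: L1cvg_sfun (ig N)|exact: (hN N (leqnn N))].
Qed.

(** Split [s] into its truncation [tau N] and a remainder [rho N] that is small in L^p, and remains
    so after the Berezin transform. The error of the truncation is bounded, so its p-th power is at
    most a constant times the error itself, to which L^1 convergence applies. *)
Lemma Lpcvg p s : 1 <= p -> measurable_fun setT s -> itg nu (fun x => `|s x| `^ p) ->
  (forall n, itg nu (fun x => `|B_ n s x - s x| `^ p)) /\
  (fun n => \int[nu]_x `|B_ n s x - s x| `^ p) @ \oo --> (0 : R).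
Proof.
move=> p1 ms si; have p0 : 0 < p by exact: lt_le_trans ltr01 p1.
have pn : p != 0 by rewrite gt_eqF.
pose tau N := truncate s N.
pose rho N x := s x - tau N x.
have mtau N : measurable_fun setT (tau N) by exact: truncate_measurable.
have itau N : itg nu (tau N) := truncate_itg p1 ms si N.
have mrho N : measurable_fun setT (rho N) by exact: measurable_funB.
have rho_le N x : `|rho N x| <= `|s x|.
  by rewrite /rho /tau /truncate; case: ifP => _; rewrite ?subrr ?subr0 ?normr0.
have irho N : itg nu (fun x => `|rho N x| `^ p).
  apply: (itg_dom _ si); first exact: measurable_normr_powR.
  by move=> x; rewrite ger0_norm ?powR_ge0 // le_powR // ltW.
have crho : (fun N => \int[nu]_x `|rho N x| `^ p) @ \oo --> (0 : R).
  have [||||_ h] := @Rint_dct _ _ _ nu (fun N x => `|rho N x| `^ p) (fun=> 0)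
    (fun x => `|s x| `^ p).
  - by move=> N; exact: measurable_normr_powR.
  - move=> x; apply: cvg_near_cst; have := truncate_cvg s x.
    by apply: filterS => N e; rewrite /rho /tau e subrr normr0 powR0.
  - exact: si.
  - by move=> N x; rewrite ger0_norm ?powR_ge0 // le_powR // ltW.
  by rewrite {2}/Rintegral integral0 /= in h.
have mBs n (f : borel X -> R) : measurable_fun setT f -> itg nu (fun x => `|f x| `^ p) ->
    measurable_fun setT (B_ n f).
  by move=> mf fi; exact: (bz_measurable_p (c0 n) (@scale n) (fr n) p1).
have bpow n (f : borel X -> R) : measurable_fun setT f -> itg nu (fun x => `|f x| `^ p) ->
    itg nu (fun x => `|B_ n f x| `^ p) /\
    \int[nu]_x `|B_ n f x| `^ p <= \int[nu]_x `|f x| `^ p.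
  by move=> mf fi; exact: (berezin_power (c0 n) (@scale n) (fr n) p1).
have ierr n : itg nu (fun x => `|B_ n s x - s x| `^ p).
  apply: (itg_dom _ (itgZ (3 `^ p) (itgD (bpow n s ms si).1 si))).
    by apply: measurable_normr_powR; apply: measurable_funB => //; exact: mBs.
  move=> x; rewrite ger0_norm ?powR_ge0 //.
  apply: le_trans (le_powR (ltW p0) (normr_ge0 _) (ler_normB _ _)) _.
  exact: powR_add2 (ltW p0) _ _ pn.
split; first exact: ierr.
apply: cvg0_le => [n|e e0].
  by apply: Rint_ge0 => x; exact: powR_ge0.
have h3 : 0 < 3 `^ p :> R by rewrite powR_gt0.
pose d := e / (3 * 3 `^ p); have d0 : 0 < d by rewrite divr_gt0 // mulr_gt0.
have [N _ hN] := cvg0_near crho d0; have {}hN := hN N (leqnn N).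
(* [tau N] and its transform are both bounded by [N + 1], so [w^p <= M w] for their distance [w]. *)
pose M : R := (N.+1%:R + N.+1%:R) `^ (p - 1).
have M0 : 0 <= M by exact: powR_ge0.
have d1 : 0 < d / (1 + M) by rewrite divr_gt0 //; lra.
have := cvg0_near (L1cvg_itg (itau N)).2 d1; apply: filterS => n hn.
have it := itg_err n (itau N).
have key x : `|B_ n s x - s x| `^ p <= 3 `^ p * (`|B_ n (rho N) x| `^ p +
    M * `|B_ n (tau N) x - tau N x| + `|rho N x| `^ p).
  have k1 := kernel_itg_p (c0 n) (@scale n) (fr n) p1 (mrho N) (irho N) x.
  have k2 := itg_kernel n x (itau N).
  have -> : B_ n s x = B_ n (rho N) x + B_ n (tau N) x.
    rewrite /bz -RintD //; apply: eq_Rintegral => y _; rewrite /rho; ring.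
  set u := B_ n (rho N) x; set v := B_ n (tau N) x.
  have -> : u + v - s x = u + (v - tau N x) + (- rho N x) by rewrite /rho; ring.
  apply: le_trans (le_powR (ltW p0) (normr_ge0 _) (le_trans (ler_normD _ _)
    (lerD (ler_normD _ _) (lexx _)))) _.
  apply: le_trans (powR_add3 (ltW p0) _ _ _) _ => //.
  rewrite normrN ler_wpM2l ?(ltW h3) // lerD2r lerD2l.
  have vb : `|v| <= N.+1%:R.
    apply: le_trans (Rint_norm k2) _.
    have iK := kernel_itg (fr n) x.
    have E1 : N.+1%:R = \int[mu n]_y (N.+1%:R * K_ n x y).
      by rewrite RintZ // (kernel_int (fr n)) mulr1.
    rewrite [leRHS]E1.
    apply: Rint_le; first exact: itg_norm.
      by apply: itgZ; exact: (kernel_itg (fr n) x).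
    move=> y; rewrite normrM (ger0_norm (fdot_ge0 _ _ _)).
    apply: ler_wpM2r; first exact: fdot_ge0.
    exact: truncate_bound.
  set w := `|v - tau N x|.
  have wb : w <= N.+1%:R + N.+1%:R.
    by apply: le_trans (ler_normB _ _) _; apply: lerD => //; exact: truncate_bound.
  have w0 : 0 <= w by exact: normr_ge0.
  have [wz|wn] := eqVneq w 0; first by rewrite wz powR0 // mulr0.
  have -> : w `^ p = w `^ (p - 1) * w.
    by rewrite -{3}(powRr1 w0) -powRD ?subrK // wn implybT.
  by rewrite ler_wpM2r // le_powR //; lra.
have [ib hb] := bpow n _ (mrho N) (irho N).
have i1 : itg nu (fun x => `|B_ n (rho N) x| `^ p + M * `|B_ n (tau N) x - tau N x|).
  by apply: itgD => //; exact: itgZ.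
apply: le_trans (Rint_le (ierr n) (itgZ (3 `^ p) (itgD i1 (irho N))) key) _.
rewrite RintZ; last exact: itgD.
rewrite RintD // RintD //; last exact: itgZ.
rewrite RintZ //.
have h4 : M * \int[nu]_x `|B_ n (tau N) x - tau N x| <= d.
  apply: le_trans (ler_wpM2l M0 hn) _.
  have M1 : 1 + M != 0 by rewrite gt_eqF // ltr_pwDl.
  rewrite -[leRHS](divfK M1) mulrC; apply: ler_wpM2l; first exact: ltW d1.
  by rewrite lerDr ler01.
have -> : e = 3 `^ p * (d + d + d) by rewrite /d; field; rewrite gt_eqF.
rewrite ler_wpM2l ?(ltW h3) //.
exact: lerD (lerD (le_trans hb hN) h4) hN.
Qed.

End LocalizedSequences.

(** * Szego limits along sequences *)

Section PointwiseEstimates.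
Context d (T : measurableType d) (R : realType) (mu : {measure set T -> \bar R}).
Variables (H : hilbertSpace R) (k : T -> H).
Hypothesis fr : real_frame mu k.
Implicit Types (s eta : T -> R) (psi : R -> R) (x : T).

(** The weight [dl = e q + th w] adapts to [w]: its first part balances the term in [q], and its
    second gives [w / dl <= 1 / th], so [F] is not multiplied by the possibly unbounded [w]. In the
    application [w] is [eta x], [q] is [1 + |s x|] and [F] is [phi], and every term of the bound is
    integrable. *)
Lemma weight_bound (w r e q th C F : R) : 0 <= w -> 0 < e -> 1 <= q -> 0 < th ->
  0 <= F -> (forall dl, 0 < dl ->
    2 * r <= dl + dl^-1 * (10 * e ^+ 2 * q ^+ 2 + 8 * C ^+ 2 * F)) ->
  w * r <= 6 * e * (w * q) + th * w ^+ 2 + 4 * C ^+ 2 / th * F.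
Proof.
move=> w0 e0 q1 th0 F0 h.
have C2 := sqr_ge0 C; have CF : 0 <= C ^+ 2 * F by rewrite mulr_ge0.
have [wz|wn] := eqVneq w 0.
  have -> : 4 * C ^+ 2 / th * F = 4 * (C ^+ 2 * F / th) by ring.
  by have := divr_ge0 CF (ltW th0); rewrite wz; lra.
have wp : 0 < w by rewrite lt_neqAle eq_sym wn.
have eq0 : 0 < e * q by rewrite mulr_gt0 //; lra.
have tw0 : 0 < th * w by rewrite mulr_gt0.
pose dl := e * q + th * w.
have dl0 : 0 < dl by rewrite /dl; lra.
have := h dl dl0.
have h1 : dl^-1 * (10 * e ^+ 2 * q ^+ 2) <= 10 * (e * q).
  rewrite ler_pdivrMl //.
  have -> : 10 * e ^+ 2 * q ^+ 2 = (e * q) * (10 * (e * q)) by ring.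
  by rewrite ler_wpM2r //; [lra|rewrite /dl; lra].
have h2 : dl^-1 * (8 * C ^+ 2 * F) <= (th * w)^-1 * (8 * C ^+ 2 * F).
  by rewrite ler_wpM2r //; [lra|rewrite lef_pV2 ?posrE // /dl; lra].
rewrite mulrDr => h3.
have h4 : 2 * r <= dl + (10 * (e * q) + (th * w)^-1 * (8 * C ^+ 2 * F)) by lra.
have := ler_wpM2l w0 h4.
have -> : w * (dl + (10 * (e * q) + (th * w)^-1 * (8 * C ^+ 2 * F))) =
  11 * (e * (w * q)) + th * w ^+ 2 + 2 * (4 * C ^+ 2 / th * F).
  by rewrite /dl; field; rewrite !gt_eqF.
have := mulr_ge0 (ltW e0) (mulr_ge0 w0 (le_trans ler01 q1)).
have := mulr_ge0 (ltW th0) (sqr_ge0 w).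
by move: (4 * C ^+ 2 / th * F) => z; lra.
Qed.

Variables (s : T -> R) (psi : R -> R) (S : H -> H).
Hypotheses (si : itg mu s) (s2i : itg mu (fun x => s x ^+ 2)).
Local Notation A := (toep mu k s).
Hypothesis cS : is_fun_calculus A psi S.

(** Squaring the modulus with [(u + v)^2 <= 2u^2 + 2v^2] doubles the factors 5 and 4 of
    [fun_calculus_sqn_le]. *)
Lemma fun_calculus_localized (e C : R) x : 0 < e -> 0 <= C ->
  (forall t, spectrum A t%:C -> `|psi t - psi (s x)| <= e * (1 + `|s x|) + C * `|t - s x|) ->
  sqn (S (k x) - (psi (s x))%:C *: k x) <=
  10 * e ^+ 2 * (1 + `|s x|) ^+ 2 + 8 * C ^+ 2 * phi mu k s x.
Proof.
move=> e0 C0 h.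
have q0 : 0 < 1 + `|s x| by have := normr_ge0 (s x); lra.
have := @fun_calculus_sqn_le R H A (toeplitz_linear fr si) (toeplitz_sym fr si)
  (toeplitz_bounded_op fr si) S psi cS (2 * e ^+ 2 * (1 + `|s x|) ^+ 2) (2 * C ^+ 2)
  (s x) (psi (s x)) (k x).
rewrite (frame_norm fr) mulr1 => key; apply: le_trans (key _ _ _) _.
- by rewrite mulr_gt0 ?exprn_gt0 // mulr_gt0 ?exprn_gt0.
- by rewrite mulr_ge0 ?sqr_ge0.
- move=> t /h ht; rewrite -[(psi t - _) ^+ 2]real_normK ?num_real //.
  rewrite -[(t - s x) ^+ 2]real_normK ?num_real //.
  have := normr_ge0 (psi t - psi (s x)).
  move: (`|psi t - _|) (`|t - _|) ht => u v huv u0.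
  apply: (@le_trans _ _ ((e * (1 + `|s x|) + C * v) ^+ 2)).
    by rewrite ler_pXn2r ?nnegrE //; exact: le_trans huv.
  have := sqr_ge0 (e * (1 + `|s x|) - C * v); move: (1 + `|s x|) => y.
  by rewrite !sqrrD sqrrN !exprMn; lra.
have := ler_wpM2l (sqr_ge0 C) (toeplitz_localized fr si s2i x).
by move: (C ^+ 2) => z; lra.
Qed.

Variables (eta : T -> R) (P : H -> H).
Hypotheses (ei : itg mu eta) (e2i : itg mu (fun x => eta x ^+ 2)).
Hypothesis hP : support_projection mu k eta P.

(** Where [eta] is not small, [k x] nearly lies in the range of [P]: as [P] fixes [T_eta k_x],
    [eta x (k_x - P k_x)] is minus the component outside that range of
    [v = T_eta k_x - eta x k_x]. *)
Lemma support_deficiency x : eta x ^+ 2 * (1 - sqn (P (k x))) <= phi mu k eta x.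
Proof.
have [lP sP _ AP _] := hP.
have PA f : P (toep mu k eta f) = toep mu k eta f.
  by apply: rip_ext => g; rewrite sP -(toeplitz_support fr ei hP).
apply: le_trans (toeplitz_localized fr ei e2i x).
set v := toep mu k eta (k x) - _.
have E : (eta x)%:C *: (k x - P (k x)) = - (v - P v).
  rewrite /v (linB _ _ lP) PA (linZ _ _ lP) scalerBr.
  by rewrite opprB opprB [RHS]addrC addrA subrK.
have := support_sqn hP v; have := sqn_ge0 (P v).
rewrite -[sqn (v - P v)]sqnN -E sqnZr.
by have := support_sqn hP (k x); rewrite (frame_norm fr) => ->; nra.
Qed.

(** Write [S k_x = v + psi (s x) k_x]. The part [v] is controlled by [fun_calculus_localized]; the
    other contributes [psi (s x)] times the squared norm of [P k_x], whence the deficiency term, and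
    nothing to the imaginary part since [P] is symmetric. *)
Lemma product_pointwise (e C th : R) x : 0 < e -> 0 <= C -> 0 < th -> 0 <= eta x ->
  linear S -> symmetric_op S ->
  (forall t, spectrum A t%:C -> `|psi t - psi (s x)| <= e * (1 + `|s x|) + C * `|t - s x|) ->
  let bound := 6 * e * (eta x * (1 + `|s x|)) + th * eta x ^+ 2 + 4 * C ^+ 2 / th * phi mu k s x in
  `|eta x * rip (P (k x)) (S (k x)) - eta x * psi (s x)| <=
    bound + eta x * `|psi (s x)| * (1 - sqn (P (k x))) /\
  `|eta x * rip (P (k x)) ('i *: S (k x))| <= bound.
Proof.
move=> e0 C0 th0 w0 lS sS h bound.
have [lP sP _ AP _] := hP.
have q1 : 1 <= 1 + `|s x| by have := normr_ge0 (s x); lra.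
have F0 := phi_ge0 mu k s x.
set v := S (k x) - (psi (s x))%:C *: k x.
have hv : sqn v <= _ := fun_calculus_localized e0 C0 h.
have p1 : sqn (P (k x)) <= 1 by have := support_sqn_le hP (k x); rewrite (frame_norm fr).
have key u : sqn u = sqn v -> eta x * `|rip (P (k x)) u| <= bound.
  move=> uv; apply: weight_bound => // dl dl0.
  have h1 := rip_AMGM (P (k x)) u dl0.
  have h2 := rip_AMGM (P (k x)) (- u) dl0.
  rewrite ripNr sqnN in h2; rewrite uv in h1 h2.
  have di : 0 <= dl^-1 by rewrite invr_ge0 ltW.
  have h3 := ler_wpM2l di hv; have h4 := ler_wpM2l (ltW dl0) p1.
  rewrite -ler_pdivlMl // ler_norml.
  by move: (dl^-1) h1 h2 h3 => y h1 h2 h3; lra.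
have Sk : S (k x) = v + (psi (s x))%:C *: k x by rewrite /v subrK.
split.
  have -> : eta x * rip (P (k x)) (S (k x)) - eta x * psi (s x) =
      eta x * rip (P (k x)) v - eta x * psi (s x) * (1 - sqn (P (k x))).
    by rewrite Sk ripDr ripZr (support_rip hP); ring.
  apply: le_trans (ler_normB _ _) _; rewrite normrM (ger0_norm w0); apply: lerD.
    exact: key.
  rewrite normrM normrM (ger0_norm w0) (@ger0_norm _ (1 - _)) //; lra.
have -> : rip (P (k x)) ('i *: S (k x)) = rip (P (k x)) ('i *: v).
  rewrite Sk scalerDr ripDr scalerA (mulrC 'i) -scalerA ripZr.
  by rewrite (symmetric_rip_i lP sP) mulr0 addr0.
rewrite normrM (ger0_norm w0); apply: key.
by rewrite sqnZ /= expr0n expr1n add0r sqrtr1 expr1n mul1r.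
Qed.

End PointwiseEstimates.

(** * Trace limits for square-integrable symbols *)

Section TraceLimits.
Variables (R : realType) (X : ptopologicalType).
Variable nu : {measure set (borel X) -> \bar R}.
Hypothesis nu_radon : radon_measure nu.
Variables (mu : nat -> {measure set (borel X) -> \bar R}) (c : nat -> R).
Hypotheses (c0 : forall n, 0 < c n) (scale : forall n (B : set (borel X)),
  measurable B -> mu n B = ((c n)%:E * nu B)%E).
Variables (H : nat -> hilbertSpace R) (k : forall n, borel X -> H n).
Hypothesis fr : forall n, real_frame (mu n) (k n).
Hypothesis loc : localized mu k.
Implicit Types (s eta g : borel X -> R) (x y : borel X) (e : R) (n : nat).

Local Notation B_ n := (bz (mu n) (k n)).
Local Notation T_ n s := (toep (mu n) (k n) s).

Let itg_m n s : itg nu s -> itg (mu n) s := itg_mu c0 scale n (s := s).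

(** Completing the square gives [phi <= |B(s^2) - s^2| + th s^2 + (B s - s)^2 / th]. Convergence in
    L^1 for [s^2] and in L^2 for [s] handle the outer terms once [th] is fixed. *)
Lemma phi_cvg s : itg nu s -> itg nu (fun x => s x ^+ 2) ->
  (forall n, itg nu (phi (mu n) (k n) s)) /\
  (fun n => \int[nu]_x phi (mu n) (k n) s x) @ \oo --> (0 : R).
Proof.
move=> si s2i; have ms := itg_measurable si.
have p2 (z : R) : `|z| `^ 2 = z ^+ 2.
  by rewrite (powR_mulrn 2) // real_normK // num_real.
have s2i' : itg nu (fun x => `|s x| `^ 2) by under eq_fun do rewrite p2.
have [ierr2 cerr2] := Lpcvg nu_radon c0 scale fr loc (ler1n _ _ : 1 <= 2) ms s2i'.
have ierr2' n : itg nu (fun x => (B_ n s x - s x) ^+ 2).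
  by have := ierr2 n; under eq_fun do rewrite p2.
have cerr2' : (fun n => \int[nu]_x (B_ n s x - s x) ^+ 2) @ \oo --> (0 : R).
  move: cerr2; apply: cvg_trans; apply: near_eq_cvg; apply: nearW => n.
  by apply: eq_Rintegral => x _; rewrite p2.
have [_ cs2] := L1cvg_itg nu_radon c0 scale fr loc s2i.
have ierr1 n := itg_err c0 scale fr n s2i.
have phi_le n x (th : R) : 0 < th -> phi (mu n) (k n) s x <=
    `|B_ n (fun y => s y ^+ 2) x - s x ^+ 2| + (th * s x ^+ 2 +
    th^-1 * (B_ n s x - s x) ^+ 2).
  move=> th0; rewrite (phiE (fr n)); [|exact: itg_m..].
  set b2 := B_ n (fun y => s y ^+ 2) x; set b := B_ n s x.
  have -> : b2 - 2 * s x * b + s x ^+ 2 = (b2 - s x ^+ 2) - 2 * s x * (b - s x) by ring.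
  apply: lerD; first exact: ler_norm.
  have : 0 <= th^-1 * (th * s x + (b - s x)) ^+ 2.
    by rewrite mulr_ge0 ?sqr_ge0 // invr_ge0 ltW.
  have -> : th^-1 * (th * s x + (b - s x)) ^+ 2 = th * s x ^+ 2 + 2 * s x * (b - s x) +
    th^-1 * (b - s x) ^+ 2 by field; rewrite gt_eqF.
  by lra.
have ib n (th : R) : itg nu (fun x => `|B_ n (fun y => s y ^+ 2) x - s x ^+ 2| +
    (th * s x ^+ 2 + th^-1 * (B_ n s x - s x) ^+ 2)).
  by apply: itgD => //; apply: itgD; exact: itgZ.
have iphi n : itg nu (phi (mu n) (k n) s).
  apply: (itg_dom _ (ib n 1)); last first.
    by move=> x; rewrite ger0_norm ?phi_le //; exact: phi_ge0.
  have -> : phi (mu n) (k n) s =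
      (fun x => B_ n (fun y => s y ^+ 2) x - 2 * s x * B_ n s x + s x ^+ 2).
    by apply/funext => x; rewrite (phiE (fr n)) //; exact: itg_m.
  have m1 := itg_measurable (bz_norm c0 scale fr n s2i).1.
  have m2 := itg_measurable (bz_norm c0 scale fr n si).1.
  apply: measurable_funD; last exact: itg_measurable s2i.
  by apply: measurable_funB => //; apply: measurable_funM => //; exact: measurable_funM.
split => //; apply: cvg0_le => [n|e e0].
  by apply: Rint_ge0 => x; exact: phi_ge0.
pose I := \int[nu]_x s x ^+ 2.
have I0 : 0 <= I by apply: Rint_ge0 => x; exact: sqr_ge0.
pose th := e / (3 * (1 + I)).
have th0 : 0 < th by rewrite divr_gt0 // mulr_gt0 //; lra.
have e3 : 0 < e / 3 by rewrite divr_gt0.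
have h1 := cvg0_near cs2 e3.
have h2 := cvg0_near cerr2' (mulr_gt0 th0 e3).
apply: filterS2 h1 h2 => n h1 h2.
apply: le_trans (Rint_le (iphi n) (ib n th) (fun x => phi_le n x th th0)) _.
rewrite RintD //; last by apply: itgD; exact: itgZ.
rewrite RintD; [|exact: itgZ..].
rewrite !RintZ // -/I.
have h3 : th^-1 * \int[nu]_x (B_ n s x - s x) ^+ 2 <= e / 3 by rewrite ler_pdivrMl.
have h4 : th * I <= e / 3.
  have -> : e / 3 = th * (1 + I) by rewrite /th; field; rewrite gt_eqF //; lra.
  by rewrite ler_wpM2l ?(ltW th0) //; lra.
by have := lerD h1 (lerD h4 h3); have -> : e / 3 + (e / 3 + e / 3) = e by field.
Qed.

(* [g] is a measurable version of [psi \o s], which need not be measurable. *)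
Lemma trace_product_limit s eta g psi (D : set R) :
  itg nu s -> itg nu (fun x => s x ^+ 2) -> itg nu eta -> itg nu (fun x => eta x ^+ 2) ->
  (\forall x \ae nu, 0 <= eta x) ->
  modulus D psi -> (\forall x \ae nu, D (s x)) ->
  (forall n, exists a b, [/\ `[a, b] `<=` D,
     forall f, a * sqn f <= rip (T_ n s f) f & forall f, rip (T_ n s f) f <= b * sqn f]) ->
  measurable_fun setT g -> (\forall x \ae nu, g x = psi (s x)) ->
  let t n := trace (T_ n eta \o fun_calculus (T_ n s) psi) in
  (fun n => (c n)^-1 * complex.Re (t n)) @ \oo --> \int[nu]_x (eta x * g x) /\
  (fun n => (c n)^-1 * complex.Im (t n)) @ \oo --> (0 : R).
Proof.
move=> si s2i ei e2i eta0 mpsi Ds bnd mg gE t.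
have ms := itg_measurable si; have me := itg_measurable ei.
have iq : itg nu (fun x => eta x * (1 + `|s x|)).
  apply: (itg_dom _ (itgD (itg_norm ei) (itgD e2i s2i))).
    apply: measurable_funM => //; apply: measurable_funD => //; exact: measurableT_comp.
  move=> x; rewrite normrM (@ger0_norm _ (1 + _)) ?addr_ge0 // mulrDr mulr1 lerD2l.
  rewrite -[eta x ^+ 2]real_normK ?num_real // -[s x ^+ 2]real_normK ?num_real //.
  have := sqr_ge0 (`|eta x| - `|s x|); have := normr_ge0 (eta x); have := normr_ge0 (s x).
  by nra.
(* One instance of the modulus at a base point gives [psi] linear growth on [D], so [eta * g] is
   dominated by a multiple of [eta * (1 + |s|)]. *)
have [C1 C10 hC1] : exists2 C1 : R, 0 <= C1 & \forall x \ae nu, `|g x| <= C1 * (1 + `|s x|).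
  have [[d0 Dd0]|nD] := pselect (exists d0, D d0); last first.
    by exists 0 => //; apply: filterS Ds => x Dx; case: nD; exists (s x).
  have [C C0 hC] := mpsi 1 ltr01.
  exists (`|psi d0| + (1 + `|d0|) + C * (1 + `|d0|)).
    by rewrite !addr_ge0 ?mulr_ge0 ?addr_ge0.
  apply: filterS2 Ds gE => x Dx ->.
  have h := hC (s x) d0 Dx Dd0.
  have h1 := ler_normD (psi (s x) - psi d0) (psi d0); rewrite subrK in h1.
  have h2 := ler_wpM2l C0 (ler_normB (s x) d0).
  have n1 := normr_ge0 (s x); have n2 := normr_ge0 d0; have n3 := normr_ge0 (psi d0).
  have h3 := mulr_ge0 n3 n1; have h4 := mulr_ge0 n2 n1; have h5 := mulr_ge0 C0 n1.
  have h6 := mulr_ge0 C0 n2; have h7 := mulr_ge0 h6 n1.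
  by rewrite mulrDr in h2; lra.
pose G x := `|eta x * g x|.
have ig : itg nu (fun x => eta x * g x).
  apply: (itg_dom_ae _ (itgZ C1 (itg_norm iq))); first exact: measurable_funM.
  apply: filterS hC1 => x hx; rewrite !normrM mulrCA ler_wpM2l //.
  by apply: le_trans hx _; rewrite ler_wpM2l // ler_norm.
have iG : itg nu G by exact: itg_norm.
have mG := itg_measurable iG.
pose Gt m x := if eta x ^+ 2 < m.+1%:R^-1 * G x then G x else 0.
have Gt_b m x : 0 <= Gt m x <= G x.
  by rewrite /Gt; case: ifP => _; rewrite ?lexx ?andbT /G normr_ge0.
have mGt m : measurable_fun setT (Gt m).
  apply: measurable_fun_ifT => //; apply: measurable_fun_ltr => //.
    exact: measurable_funX.
  exact: measurable_funM.
have iGt m : itg nu (Gt m).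
  by apply: (itg_dom _ iG) => // x; have /andP[h1 h2] := Gt_b m x; rewrite ger0_norm.
have cGt : (fun m => \int[nu]_x Gt m x) @ \oo --> (0 : R).
  have [||||_ h] := @Rint_dct _ _ _ nu Gt (fun=> 0) G.
  - exact: mGt.
  - move=> x; apply: cvg_near_cst.
    have [e0|e0] := eqVneq (eta x) 0.
      by apply: nearW => m; rewrite /Gt /G e0 mul0r normr0 mulr0; case: ifP.
    have e2p : 0 < eta x ^+ 2 by rewrite exprn_even_gt0.
    have G0 : 0 <= G x by exact: normr_ge0.
    have G1 : 0 < 1 + G x by rewrite ltr_pwDl.
    have [N _ hN] := near_infty_natSinv_lt (PosNum (divr_gt0 e2p G1)).
    exists N => // m /= mN; rewrite /Gt ifF //; apply/negbTE; rewrite -leNgt.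
    have := ltW (hN m mN); rewrite /= => h.
    rewrite mulrC; apply: mul_le_of_le_div1D => //; exact: ltW.
  - exact: iG.
  - by move=> m x; have /andP[h1 h2] := Gt_b m x; rewrite ger0_norm.
  by rewrite {2}/Rintegral integral0 in h.
have [iphi1 cphi1] := phi_cvg si s2i.
have [iphi2 cphi2] := phi_cvg ei e2i.
have iA eps n (C th : R) m := itgD (itgD (itgD (itgZ (6 * eps) iq) (itgZ th e2i))
  (itgZ (4 * C ^+ 2 / th) (iphi1 n))) (itgD (iGt m) (itgZ m.+1%:R (iphi2 n))).
pose err eps n (C th : R) m := \int[nu]_x
  (6 * eps * (eta x * (1 + `|s x|)) + th * eta x ^+ 2 +
   4 * C ^+ 2 / th * phi (mu n) (k n) s x + (Gt m x + m.+1%:R * phi (mu n) (k n) eta x)).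
have main eps C th m n : 0 < eps -> 0 <= C -> 0 < th ->
    (forall r z : R, D r -> D z -> `|psi r - psi z| <= eps * (1 + `|z|) + C * `|r - z|) ->
    `|(c n)^-1 * complex.Re (t n) - \int[nu]_x (eta x * g x)| <= err eps n C th m /\
    `|(c n)^-1 * complex.Im (t n)| <= err eps n C th m.
  move=> e0 C0 th0 hmod.
  have sin := itg_m n si; have s2in := itg_m n s2i.
  have ein := itg_m n ei; have e2in := itg_m n e2i.
  have lT := toeplitz_linear (fr n) sin; have sT := toeplitz_sym (fr n) sin.
  have bT := toeplitz_bounded_op (fr n) sin.
  have [a [b [abD ha hb]]] := bnd n.
  have cS := fun_calculus_modulus lT sT bT mpsi abD ha hb.
  have sS := fun_calculus_sym lT sT cS.
  have [P hP] := support_projection_exists (fr n) ein.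
  have [i1 i2 tE] := trace_toeplitz (fr n) ein (ae_scale (@scale n) eta0) hP cS.1 sS.
  move/(itg_scale (c0 n) (@scale n)) : i1 => i1.
  move/(itg_scale (c0 n) (@scale n)) : i2 => i2.
  have cn : c n != 0 by rewrite gt_eqF.
  rewrite /t tE /= !(Rint_scale (c0 n) (@scale n)) // !mulKf //.
  have specD z : spectrum (T_ n s) z%:C -> D z.
    move=> sz; apply: abD; rewrite /= in_itv /=.
    by rewrite (spectrum_lower lT sT ha sz) (spectrum_upper lT sT hb sz).
  have pw : \forall x \ae nu, `|eta x * rip (P (k n x)) (fun_calculus (T_ n s) psi (k n x)) -
        eta x * g x| <= 6 * eps * (eta x * (1 + `|s x|)) + th * eta x ^+ 2 +
        4 * C ^+ 2 / th * phi (mu n) (k n) s x + (Gt m x + m.+1%:R * phi (mu n) (k n) eta x) /\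
      `|eta x * rip (P (k n x)) ('i *: fun_calculus (T_ n s) psi (k n x))| <=
        6 * eps * (eta x * (1 + `|s x|)) + th * eta x ^+ 2 +
        4 * C ^+ 2 / th * phi (mu n) (k n) s x + (Gt m x + m.+1%:R * phi (mu n) (k n) eta x).
    apply: filterS3 Ds gE eta0 => x Dx gx ex0.
    have [] := product_pointwise (fr n) sin s2in cS hP e0 C0 th0 ex0 cS.1.1 sS
      (fun z sz => hmod _ _ (specD z sz) Dx).
    have := support_deficiency (fr n) ein e2in hP x.
    have := phi_ge0 (mu n) (k n) eta x.
    have p1 : sqn (P (k n x)) <= 1.
      by have := support_sqn_le hP (k n x); rewrite (frame_norm (fr n)).
    have p0 := sqn_ge0 (P (k n x)).
    rewrite -gx; have -> : eta x * `|g x| = G x by rewrite /G normrM (ger0_norm ex0).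
    have /andP[g0 _] := Gt_b m x.
    set F := phi (mu n) (k n) eta x; set d := 1 - sqn (P (k n x)) => F0 hF hr hi.
    have d01 : 0 <= d <= 1 by rewrite /d subr_ge0 p1 gerBl.
    have m0 : 0 < m.+1%:R :> R by rewrite ltr0n.
    have mF := mulr_ge0 (ltW m0) F0.
    have hd : G x * d <= Gt m x + m.+1%:R * F.
      have /andP[d0 d1] := d01; have G0 : 0 <= G x by exact: normr_ge0.
      rewrite /Gt; case: ifPn => [_|].
        have := ler_wpM2l G0 d1; rewrite mulr1 => h; apply: le_trans h _.
        by rewrite lerDl.
      rewrite -leNgt ler_pdivrMl // => hG; rewrite add0r.
      apply: le_trans (ler_wpM2r d0 hG) _.
      by rewrite -mulrA ler_wpM2l // ltW.
    split; first by apply: le_trans hr _; rewrite lerD2l.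
    by apply: le_trans hi _; rewrite lerDl addr_ge0.
  split.
    rewrite -RintB //; apply: le_trans (Rint_norm (itgB i1 ig)) _.
    apply: Rint_le_ae; [exact: itg_norm (itgB i1 ig)|exact: iA|].
    by apply: filterS pw => x [].
  apply: le_trans (Rint_norm i2) _.
  apply: Rint_le_ae; [exact: itg_norm i2|exact: iA|].
  by apply: filterS pw => x [].
have errE eps n C th m : err eps n C th m = 6 * eps * \int[nu]_x (eta x * (1 + `|s x|)) +
    th * \int[nu]_x eta x ^+ 2 + 4 * C ^+ 2 / th * \int[nu]_x phi (mu n) (k n) s x +
    (\int[nu]_x Gt m x + m.+1%:R * \int[nu]_x phi (mu n) (k n) eta x).
  rewrite /err RintD; [|by do 2?apply: itgD; apply: itgZ|by apply: itgD => //; exact: itgZ].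
  rewrite RintD; [|by apply: itgD; exact: itgZ|exact: itgZ].
  rewrite RintD; [|exact: itgZ|exact: itgZ].
  by rewrite RintD ?RintZ //; exact: itgZ.
suff : forall e, 0 < e -> \forall n \near \oo,
    `|(c n)^-1 * complex.Re (t n) - \int[nu]_x (eta x * g x)| <= e /\
    `|(c n)^-1 * complex.Im (t n)| <= e.
  move=> h; split; apply/cvgrPdist_le => e e0; apply: filterS (h e e0) => n [h1 h2].
    by rewrite distrC.
  by rewrite sub0r normrN.
(* One fifth for each term of [errE]. The order of choice matters: [eps] determines [C], then [th]
   and [m] are fixed, and [n] comes last. *)
move=> e e0; have e5 : 0 < e / 5 by rewrite divr_gt0.
set J := \int[nu]_x (eta x * (1 + `|s x|)) in errE.
set I2 := \int[nu]_x eta x ^+ 2 in errE.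
have I20 : 0 <= I2 by apply: Rint_ge0 => x; exact: sqr_ge0.
have aJ : 0 <= 6 * `|J| by rewrite mulr_ge0.
pose eps := e / 5 / (1 + 6 * `|J|).
have eps0 : 0 < eps by rewrite divr_gt0 // ltr_pwDl.
have [C C0 hC] := mpsi eps eps0.
pose th := e / 5 / (1 + I2).
have th0 : 0 < th by rewrite divr_gt0 // ltr_pwDl.
have [m _ hm] := cvg0_near cGt e5; have {}hm := hm m (leqnn m).
have K0 : 0 <= 4 * C ^+ 2 / th.
  by apply: divr_ge0; [rewrite mulr_ge0 ?sqr_ge0|exact: ltW].
have K1 : 0 < 1 + 4 * C ^+ 2 / th by rewrite ltr_pwDl.
have M0 : 0 <= m.+1%:R :> R by rewrite ler0n.
have M1 : 0 < 1 + m.+1%:R :> R by rewrite ltr_pwDl.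
have h1 := cvg0_near cphi1 (divr_gt0 e5 K1).
have h2 := cvg0_near cphi2 (divr_gt0 e5 M1).
apply: filterS2 h1 h2 => n h1 h2.
have hK := mul_le_of_le_div1D K0 h1 (ltW e5).
have hM := mul_le_of_le_div1D M0 h2 (ltW e5).
have hT := mul_le_of_le_div1D I20 (lexx _) (ltW e5).
have hJ := mul_le_of_le_div1D aJ (lexx _) (ltW e5).
have hJ' : 6 * eps * J <= e / 5.
  apply: (@le_trans _ _ (6 * `|J| * eps)); last exact: hJ.
  have E1 : 6 * eps * J = 6 * (eps * J) by ring.
  have E2 : 6 * `|J| * eps = 6 * (eps * `|J|) by ring.
  by rewrite E1 E2 ler_wpM2l // ler_wpM2l ?ler_norm // ltW.
have [r1 r2] := main eps C th m n eps0 C0 th0 hC.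
have hE : err eps n C th m <= e.
  rewrite errE; have -> : e = e / 5 + e / 5 + e / 5 + (e / 5 + e / 5) by field.
  have hT' : th * I2 <= e / 5 by rewrite mulrC.
  exact: lerD (lerD (lerD hJ' hT') hK) (lerD hm hM).
by split; [exact: le_trans r1 hE|exact: le_trans r2 hE].
Qed.

End TraceLimits.

(** * Integrable symbols on a space of finite measure *)

Section IdentityToeplitz.
Context d (T : measurableType d) (R : realType) (mu : {measure set T -> \bar R}).
Variables (H : hilbertSpace R) (k : T -> H).
Hypothesis fr : real_frame mu k.
Hypothesis i1 : itg mu (fun=> 1).
Implicit Types (s : T -> R) (x : T).

Lemma toeplitz_one : toep mu k (fun=> 1) = id.
Proof.
apply/funext => f; apply: rip_ext => g; rewrite (toeplitz_rip fr) // -(frame_rip fr).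
by apply: eq_Rintegral => x _; rewrite mul1r.
Qed.

(** The trace formula with [eta = 1], whose Toeplitz operator is the identity, so that its kernel is
    trivial and [P] is the identity too. *)
Lemma trace_frame S : bounded_operator S -> symmetric_op S ->
  itg mu (fun x => rip (S (k x)) (k x)) /\
  trace S = (\int[mu]_x rip (S (k x)) (k x))%:C.
Proof.
move=> bS sS; have [P hP] := support_projection_exists fr i1.
have Pid f : P f = f by have [_ _ _ h _] := hP; have := h f; rewrite toeplitz_one.
have one0 : \forall x \ae mu, 0 <= (1 : R) by apply: aeW => x; exact: ler01.
have [] := trace_toeplitz fr i1 one0 hP bS sS; rewrite toeplitz_one => i _ ->.
have E x : 1 * rip (P (k x)) (S (k x)) = rip (S (k x)) (k x).
  by rewrite mul1r Pid ripC.
have -> : (fun x => rip (S (k x)) (k x)) = (fun x => 1 * rip (P (k x)) (S (k x))).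
  by apply/funext => x; rewrite E.
split => //; congr (_ +i* _); rewrite (@eq_Rintegral _ _ _ mu setT (fun=> 0)).
  by rewrite /Rintegral integral0.
move=> x _; rewrite Pid ripC rip_i (symmetric_rip_i bS.1 sS) oppr0.
by rewrite mulr0.
Qed.

Variables (s sN : T -> R) (N : R).
Hypotheses (si : itg mu s) (s0 : \forall x \ae mu, 0 <= s x).
Hypotheses (sNi : itg mu sN) (sN2i : itg mu (fun x => sN x ^+ 2)).
Hypotheses (sN0 : forall x, 0 <= sN x <= N) (sNs : \forall x \ae mu, sN x <= s x).

(* The test function [(t - a)^2 / (1 + t)] replaces [(t - a)^2], which is not
   controlled by the trace when the symbol is not square integrable; the
   resolvent is then compared with the one of the truncated symbol. *)
Lemma resolvent_pointwise (psi : R -> R) S (e C th : R) x :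
  is_fun_calculus (toep mu k s) psi S -> 0 < e -> 0 <= C -> 0 < th ->
  (forall t z : R, 0 <= t -> 0 <= z -> `|psi t - psi z| <= e * (1 + `|z|) + C * `|t - z|) ->
  `|rip (S (k x)) (k x) - psi (sN x)| <= 3 * (e * (2 + sN x)) + e * bz mu k s x +
    C ^+ 2 / (4 * e) * (bz mu k s x - sN x + (2 + N) * (th + th^-1 * phi mu k sN x)).
Proof.
move=> cS e0 C0 th0 hpsi.
have lT := toeplitz_linear fr si; have sT := toeplitz_sym fr si.
have bT := toeplitz_bounded_op fr si.
set A := toep mu k s in cS lT sT bT *.
have Ap f : 0 <= rip (A f) f by exact: (toeplitz_form_ge0 fr).
have lA : linear (fun f => f + A f).
  by apply/linE => z u v; rewrite (linE A).1 // addrACA scalerDr.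
have syA : symmetric_op (fun f => f + A f).
  by move=> u v; rewrite ripDl ripDr sT.
have [|Ri [_ R1 _ R3]] := coercive_inverse lA syA ltr01.
  by move=> u; rewrite mul1r ripDl -/(sqn u) lerDl.
pose g := Ri (k x).
have kg : k x = g + A g by rewrite -{1}(R1 (k x)).
have g1 : sqn g <= 1 by have := R3 (k x); rewrite expr1n invr1 mul1r (frame_norm fr).
have /andP[a0 aN] := sN0 x; set a := sN x in a0 aN *.
have spec0 t : spectrum A t%:C -> 0 <= t.
  by apply: (spectrum_lower lT sT) => f; rewrite mul0r.
have K0 : 0 <= C ^+ 2 / (4 * e) by rewrite divr_ge0 ?sqr_ge0 // mulr_ge0 // ltW.
(* The constants come from [C v (1 + t) <= e (1 + t)^2 + C^2 / (4e) v^2] with [v = |t - a|]; adding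
   [e (1 + a)(1 + t)] gives [(e (2 + a) + e t)(1 + t)]. *)
have := fun_calculus_form_le lT sT bT cS (A := e * (2 + a)) (B := e)
  (C := C ^+ 2 / (4 * e)) (s := a) (c := psi a) kg.
rewrite (frame_norm fr) -(bz_toep fr) // !mulr1 => key.
apply: le_trans (key _ _ _ _) _ => //.
- by rewrite mulr_gt0 //; lra.
- exact: ltW.
- move=> t st; have t0 := spec0 t st; split => //.
  have h := hpsi t a t0 a0; rewrite (ger0_norm a0) in h.
  have t1 : 0 <= 1 + t := addr_ge0 ler01 t0.
  apply: le_trans (ler_wpM2r t1 h) _.
  rewrite -[(t - a) ^+ 2]real_normK ?num_real //; move: `|t - a| => v.
  have : 0 <= e^-1 * (e * (1 + t) - C * v / 2) ^+ 2.
    by rewrite mulr_ge0 ?sqr_ge0 // invr_ge0 ltW.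
  have -> : e^-1 * (e * (1 + t) - C * v / 2) ^+ 2 =
    e * (1 + t) ^+ 2 - C * v * (1 + t) + C ^+ 2 / (4 * e) * v ^+ 2.
    by field; rewrite gt_eqF.
  by move: (C ^+ 2 / _ * _) => z; lra.
set TN := toep mu k sN.
have lN : linear TN := toeplitz_linear fr sNi.
have syN : symmetric_op TN := toeplitz_sym fr sNi.
pose r := TN (k x) - a%:C *: k x.
have hr : sqn r <= phi mu k sN x := toeplitz_localized fr sNi sN2i x.
have TNk : TN (k x) = a%:C *: k x + r by rewrite /r addrC subrK.
clearbody r.
(* What is needed is [(1 + a)^2 <k_x, g> <= 1 + a] up to errors in [r]. If [k x] were an eigenvector
   of [TN] for [a], then [w] would compare [g] with the resolvent of [TN] at [k x]; nonnegativity of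
   the form of [1 + TN] at [w], together with [TN] lying below [A], gives the inequality. *)
pose w := (1 + a)%:C *: g - k x.
have w0 : 0 <= sqn w + rip (TN w) w.
  apply: addr_ge0 (sqn_ge0 w) _; apply: (toeplitz_form_ge0 fr) => //.
  by apply: aeW => y; have /andP[] := sN0 y.
have u1 : sqn g + rip (TN g) g <= rip (k x) g.
  by rewrite {1}kg ripDl lerD2l; exact: (toeplitz_form_le fr).
have E : sqn w + rip (TN w) w = (1 + a) ^+ 2 * (sqn g + rip (TN g) g)
    - 2 * (1 + a) * ((1 + a) * rip (k x) g + rip r g) + 1 + a + rip r (k x).
  rewrite /w sqnB sqnZr ripZl (ripC g) (frame_norm fr) (linB _ _ lN) (linZ _ _ lN).
  rewrite ripBl 2!ripBr 2!ripZl 2!ripZr (syN g (k x)) (ripC g (TN (k x))).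
  rewrite TNk 2!ripDl 2!ripZl -/(sqn (k x)) (frame_norm fr).
  move: (sqn g) (rip (TN g) g) (rip (k x) g) (rip r g) (rip r (k x)) => q1 q2 q3 q4 q5.
  ring.
rewrite E in w0.
have h1 := ler_wpM2l (sqr_ge0 (1 + a)) u1.
have h2 := rip_AMGM g (- r) th0; have h3 := rip_AMGM (k x) r th0.
rewrite sqnN ripNr (ripC g) in h2; rewrite (frame_norm fr) (ripC (k x)) mulr1 in h3.
have ti : 0 <= th^-1 by rewrite invr_ge0 ltW.
have h4 := ler_wpM2l ti hr; have h5 := ler_wpM2l (ltW th0) g1.
rewrite mulr1 in h5.
set W := th + th^-1 * phi mu k sN x.
have hW1 : - 2 * rip r g <= W.
  by rewrite mulNr -mulrN; exact: le_trans h2 (lerD h5 h4).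
have hW2 : 2 * rip r (k x) <= W := le_trans h3 (lerD (lexx th) h4).
have W0 : 0 <= W.
  by apply: addr_ge0; [exact: ltW|apply: mulr_ge0 => //; exact: phi_ge0].
rewrite lerD2l ler_wpM2l //.
have h6 := ler_wpM2l (addr_ge0 ler01 a0) hW1.
have h7 := ler_wpM2r W0 aN.
move: (sqn g + rip (TN g) g) h1 w0 => q h1 w0.
move: W W0 h6 h7 hW2 {hW1} => W W0 h6 h7 hW2.
move: (rip (k x) g) (rip r g) (rip r (k x)) h1 w0 h6 hW2 => u p p' h1 w0 h6 hW2.
by rewrite !expr2 in h1 w0 *; lra.
Qed.

End IdentityToeplitz.

Section FiniteTraceLimit.
Variables (R : realType) (X : ptopologicalType).
Variable nu : {measure set (borel X) -> \bar R}.
Hypothesis nu_radon : radon_measure nu.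
Variables (mu : nat -> {measure set (borel X) -> \bar R}) (c : nat -> R).
Hypotheses (c0 : forall n, 0 < c n) (scale : forall n (B : set (borel X)),
  measurable B -> mu n B = ((c n)%:E * nu B)%E).
Variables (H : nat -> hilbertSpace R) (k : forall n, borel X -> H n).
Hypothesis fr : forall n, real_frame (mu n) (k n).
Hypothesis loc : localized mu k.
Hypothesis i1 : itg nu (fun=> 1).
Implicit Types (s g : borel X -> R) (x : borel X) (e : R) (n : nat).

Local Notation B_ n := (bz (mu n) (k n)).
Local Notation T_ n s := (toep (mu n) (k n) s).

(** An unbounded integrable symbol still gives a bounded operator, as [fdot f f] is at most [sqn f].
    The spectrum is thus in a compact segment, where polynomial approximation works. *)
Lemma toeplitz_form_bounds n s : itg (mu n) s -> (\forall x \ae mu n, 0 <= s x) ->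
  (forall f, 0 * sqn f <= rip (T_ n s f) f) /\
  (forall f, rip (T_ n s f) f <= (\int[mu n]_x `|s x|) * sqn f).
Proof.
move=> si s0; split => f; first by rewrite mul0r; exact: (toeplitz_form_ge0 (fr n)).
rewrite (toeplitz_rip (fr n)) // mulrC -RintZ; last exact: itg_norm.
apply: Rint_le; [exact: (itg_fdot (fr n))|by apply: itgZ; exact: itg_norm|].
move=> x; apply: le_trans (ler_norm _) _.
rewrite normrM (ger0_norm (fdot_ge0 _ _ _)) mulrC ler_wpM2r //.
exact: (fdot_le (fr n)).
Qed.

(** In the integrated form of [resolvent_pointwise], [s] enters only through its integral [I] and
    that of its Berezin transform, which is at most [I]. The truncation leaves an error proportional
    to [I - IN], small for large [N]; being bounded on a space of finite measure, [sN N] is square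
    integrable and [phi_cvg] applies to it. *)
Lemma trace_finite_limit s g psi : itg nu s -> (\forall x \ae nu, 0 <= s x) ->
  modulus `[0, +oo[ psi -> measurable_fun setT g ->
  (\forall x \ae nu, g x = psi (s x)) ->
  let t n := trace (fun_calculus (T_ n s) psi) in
  (fun n => (c n)^-1 * complex.Re (t n)) @ \oo --> \int[nu]_x g x /\
  (fun n => (c n)^-1 * complex.Im (t n)) @ \oo --> (0 : R).
Proof.
move=> si s0 mpsi mg gE t.
have ms := itg_measurable si.
have in0 (z : R) : z \in `[0, +oo[ = (0 <= z) by rewrite in_itv /= andbT.
have cst_itg (a : R) : itg nu (fun=> a).
  by have := itgZ a i1; under eq_fun do rewrite mulr1.
have i1m n : itg (mu n) (fun=> 1) by exact/(itg_scale (c0 n) (@scale n)).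
have sm n : itg (mu n) s by exact/(itg_scale (c0 n) (@scale n)).
have s0m n := ae_scale (@scale n) s0.
have [C1 C10 hC1] := mpsi 1 ltr01.
have ig : itg nu g.
  apply: (itg_dom_ae (g := fun x => `|psi 0| + 1 + C1 * `|s x|)) => //.
    by apply: itgD => //; apply: itgZ; exact: itg_norm.
  apply: filterS2 s0 gE => x sx ->.
  have := hC1 (s x) 0; rewrite /= !in0 lexx normr0 addr0 mul1r subr0 => /(_ sx isT) h.
  by have := ler_normD (psi (s x) - psi 0) (psi 0); rewrite subrK; lra.
have cS n := fun_calculus_modulus (toeplitz_linear (fr n) (sm n)) (toeplitz_sym (fr n) (sm n))
  (toeplitz_bounded_op (fr n) (sm n)) mpsi
  (ltac:(by move=> z /=; rewrite !in_itv /= => /andP[-> _]) :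
    `[0, \int[mu n]_x `|s x|] `<=` `[0, +oo[)
  (toeplitz_form_bounds (sm n) (s0m n)).1 (toeplitz_form_bounds (sm n) (s0m n)).2.
have sS n := fun_calculus_sym (toeplitz_linear (fr n) (sm n)) (toeplitz_sym (fr n) (sm n)) (cS n).
pose h n x := rip (fun_calculus (T_ n s) psi (k n x)) (k n x).
have ih n : itg nu (h n).
  exact/(itg_scale (c0 n) (@scale n))/(trace_frame (fr n) (i1m n) (cS n).1 (sS n)).1.
have tE n : t n = (c n * \int[nu]_x h n x)%:C.
  rewrite /t (trace_frame (fr n) (i1m n) (cS n).1 (sS n)).2.
  by rewrite -(Rint_scale (c0 n) (@scale n) (ih n)).
have reE n : (c n)^-1 * complex.Re (t n) = \int[nu]_x h n x.
  by rewrite tE /= mulKf // gt_eqF.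
have imE n : (c n)^-1 * complex.Im (t n) = 0 by rewrite tE /= mulr0.
split; last by under eq_fun do rewrite imE; exact: cvg_cst.
under eq_fun do rewrite reE.
pose sN (N : nat) x := Num.max 0 (Num.min (s x) N%:R).
have sN_b N x : 0 <= sN N x <= N%:R.
  by rewrite /sN le_max lexx /= ge_max ler0n /= ge_min lexx orbT.
have msN N : measurable_fun setT (sN N).
  by apply: measurable_maxr => //; exact: measurable_minr.
have isN N : itg nu (sN N).
  apply: (itg_dom _ (cst_itg N%:R)) => // x.
  by have /andP[h1 h2] := sN_b N x; rewrite ger0_norm.
have isN2 N : itg nu (fun x => sN N x ^+ 2).
  apply: (itg_dom _ (cst_itg (N%:R ^+ 2))) => [|x]; first exact: measurable_funX.
  have /andP[h1 h2] := sN_b N x; rewrite ger0_norm ?sqr_ge0 //.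
  by rewrite ler_pXn2r ?nnegrE.
have sNs N : \forall x \ae nu, sN N x <= s x.
  by apply: filterS s0 => x sx; rewrite /sN ge_max sx ge_min lexx.
have csN : (fun N => \int[nu]_x sN N x) @ \oo --> \int[nu]_x s x.
  have sp : \int[nu]_x s x = \int[nu]_x Num.max 0 (s x).
    apply: Rint_ae => //; first exact: measurable_maxr.
    by apply: filterS s0 => x sx; rewrite max_r.
  rewrite sp.
  have [||||_ hh] := @Rint_dct _ _ _ nu sN (fun x => Num.max 0 (s x)) (fun x => `|s x|).
  - exact: msN.
  - move=> x; apply: cvg_near_cst.
    exists (Num.truncn (s x)).+1 => // N /= sN'; rewrite /sN; congr Num.max.
    apply: min_l; apply: le_trans (ltW (truncnS_gt _)) _; by rewrite ler_nat.
  - exact: itg_norm.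
  - move=> N x; have /andP[h1 _] := sN_b N x; rewrite ger0_norm // /sN ge_max normr_ge0 /=.
    by rewrite ge_min ler_norm.
  exact: hh.
have total (V I IN J b e th ti N C C' : R) :
    e * b <= e * I -> e * IN <= e * I -> C' * b <= C' * I ->
    3 * (e * (2 * V + IN)) + e * b + C' * (b - IN + (2 + N) * (th * V + ti * J)) +
      (e * (V + I) + C * (I - IN)) <=
    (7 * V + 5 * I) * e + (C + C') * (I - IN) + C' * (2 + N) * V * th +
      C' * (2 + N) * ti * J.
  by lra.
apply/cvgrPdist_le => eps eps0.
pose V := \int[nu]_x (fun=> (1 : R)) x; pose I := \int[nu]_x s x.
have V0 : 0 <= V by apply: Rint_ge0 => x; exact: ler01.
have I0 : 0 <= I by exact: Rint_ge0_ae.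
(* Collects all the terms with factor [e] after integration: [6V + 3IN] and the transform from the
   pointwise bound, [V + I] from comparing [psi (sN N x)] with [psi (s x)]. *)
pose K := 7 * V + 5 * I.
have K0 : 0 <= K by rewrite /K; lra.
have e4 : 0 < eps / 4 by rewrite divr_gt0.
pose e := eps / 4 / (1 + K).
have e0 : 0 < e by rewrite divr_gt0 // ltr_pwDl.
have heK : K * e <= eps / 4 by apply: mul_le_of_le_div1D => //; exact: ltW.
have [C C0 hC] := mpsi e e0.
pose C' := C ^+ 2 / (4 * e).
have C'0 : 0 <= C' by rewrite divr_ge0 ?sqr_ge0 // mulr_ge0 // ltW.
have CC0 : 0 <= C + C' by exact: addr_ge0.
have CC1 : 0 < 1 + (C + C') by rewrite ltr_pwDl.
have /cvgrPdist_le/(_ _ (divr_gt0 e4 CC1)) [N _ hN] := csN.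
have {hN} hN := hN N (leqnn N); set IN := \int[nu]_x sN N x in hN.
have hIN : (C + C') * (I - IN) <= eps / 4.
  by apply: mul_le_of_le_div1D; [by []|exact: le_trans (ler_norm _) hN|exact: ltW].
have INI : IN <= I by apply: Rint_le_ae.
have IN0 : 0 <= IN by apply: Rint_ge0 => x; have /andP[] := sN_b N x.
have CN0 : 0 <= C' * (2 + N%:R) by rewrite mulr_ge0 // addr_ge0.
have CNV0 : 0 <= C' * (2 + N%:R) * V by rewrite mulr_ge0.
pose th := eps / 4 / (1 + C' * (2 + N%:R) * V).
have th0 : 0 < th by rewrite divr_gt0 // ltr_pwDl.
have hth : C' * (2 + N%:R) * V * th <= eps / 4 by apply: mul_le_of_le_div1D => //; exact: ltW.
have [iphi cphi] := phi_cvg nu_radon c0 scale fr loc (isN N) (isN2 N).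
have CT0 : 0 <= C' * (2 + N%:R) * th^-1 by rewrite mulr_ge0 // invr_ge0 ltW.
have := cvg0_near cphi (divr_gt0 e4 (ltr_pwDl ltr01 CT0)).
apply: filterS => n hn.
have {}hn := mul_le_of_le_div1D CT0 hn (ltW e4).
have [ib _ hb] := berezin_contraction (c0 n) (@scale n) (fr n) si s0.
pose bnd x := 3 * (e * (2 + sN N x)) + e * B_ n s x +
  C' * (B_ n s x - sN N x + (2 + N%:R) * (th + th^-1 * phi (mu n) (k n) (sN N) x)) +
  (e * (1 + s x) + C * (s x - sN N x)).
have pw : \forall x \ae nu, `|g x - h n x| <= bnd x.
  apply: filterS3 s0 gE (sNs N) => x sx gx sNx.
  have sNm : itg (mu n) (sN N) by exact/(itg_scale (c0 n) (@scale n)).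
  have sN2m : itg (mu n) (fun x => sN N x ^+ 2) by exact/(itg_scale (c0 n) (@scale n)).
  have hC' (r z : R) : 0 <= r -> 0 <= z -> `|psi r - psi z| <= e * (1 + `|z|) + C * `|r - z|.
    by move=> r0 z0; apply: hC; rewrite /= in0.
  have r1 := resolvent_pointwise (fr n) (sm n) (s0m n) sNm sN2m (sN_b N)
    (ae_scale (@scale n) (sNs N)) x (cS n) e0 C0 th0 hC'.
  have /andP[a0 _] := sN_b N x.
  have r2 := hC' (sN N x) (s x) a0 sx.
  have d0 : sN N x - s x <= 0 by rewrite subr_le0.
  rewrite (ger0_norm sx) distrC (ler0_norm d0) in r2.
  rewrite distrC; apply: le_trans (ler_distD (psi (sN N x)) _ _) _.
  by rewrite gx (distrC _ (psi (s x))) /bnd; apply: lerD; [exact: r1|rewrite opprB in r2].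
have iphin := iphi n.
have j1 : itg nu (fun x => 3 * (e * (2 + sN N x))).
  by apply: itgZ; apply: itgZ; apply: itgD => //; exact: isN.
have j2 : itg nu (fun x => e * B_ n s x) by exact: itgZ.
have j3' : itg nu (fun x => th + th^-1 * phi (mu n) (k n) (sN N) x).
  by apply: itgD => //; exact: itgZ.
have j3 : itg nu (fun x => C' * (B_ n s x - sN N x +
    (2 + N%:R) * (th + th^-1 * phi (mu n) (k n) (sN N) x))).
  by apply: itgZ; apply: itgD; [exact: itgB|exact: itgZ].
have j4 : itg nu (fun x => e * (1 + s x)) by apply: itgZ; exact: itgD.
have j5 : itg nu (fun x => C * (s x - sN N x)) by apply: itgZ; exact: itgB.
have j6 := itgB ig (ih n).
have j12 := itgD j1 j2; have j123 := itgD j12 j3; have j45 := itgD j4 j5.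
rewrite -RintB //; apply: le_trans (Rint_norm j6) _.
apply: le_trans (Rint_le_ae (itg_norm j6) (itgD j123 j45) pw) _.
rewrite (RintD j123 j45) (RintD j12 j3) (RintD j1 j2) (RintD j4 j5).
rewrite (RintZ 3 (itgZ e (itgD (cst_itg 2) (isN N)))) (RintZ e (itgD (cst_itg 2) (isN N))).
rewrite (RintD (cst_itg 2) (isN N)) (RintZ e ib) (RintZ C' (itgD (itgB ib (isN N)) (itgZ _ j3'))).
rewrite (RintD (itgB ib (isN N)) (itgZ _ j3')) (RintB ib (isN N)) (RintZ _ j3').
rewrite (RintD (cst_itg th) (itgZ _ iphin)) (RintZ _ iphin).
rewrite (RintZ e (itgD i1 si)) (RintD i1 si) (RintZ C (itgB si (isN N))) (RintB si (isN N)).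
have cstE (a : R) : \int[nu]_x (fun=> a) x = a * V.
  by rewrite /V -RintZ //; apply: eq_Rintegral => x _; rewrite mulr1.
rewrite !cstE mul1r -/I -/IN; set J := \int[nu]_x phi _ _ _ x in hn *.
set b := \int[nu]_x B_ n s x in hb *; rewrite -/I in hb.
have q1 := ler_wpM2l (ltW e0) hb; have q2 := ler_wpM2l (ltW e0) INI.
have q3 := ler_wpM2l C'0 hb.
rewrite /K in heK.
have -> : eps = eps / 4 + eps / 4 + eps / 4 + eps / 4 by field.
apply: le_trans (lerD (lerD (lerD heK hIN) hth) hn).
by have := total V I IN J b e th (th^-1) N%:R C C' q1 q2 q3.
Qed.

End FiniteTraceLimit.

(** * Complex symbols and limits along the parameter *)

Section NonmeasurableIntegrands.
Context d (T : measurableType d) (R : realType) (mu : {measure set T -> \bar R}).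
Import HBNNSimple.

(** Needed because [psi \o sigma] in the theorem may be nonmeasurable. The integral of a nonnegative
    function is a supremum over simple functions below it; cutting such a function to zero on the
    null set [N] keeps its integral and puts it below [g]. *)
Lemma ge0_integral_ae_le (f g : T -> \bar R) (N : set T) :
  (forall x, (0 <= f x)%E) -> (forall x, (0 <= g x)%E) -> measurable N -> mu N = 0%E ->
  (forall x, ~ N x -> f x = g x) -> (\int[mu]_x f x <= \int[mu]_x g x)%E.
Proof.
move=> f0 g0 mN N0 fg; rewrite !ge0_integralTE //.
apply: ge_ereal_sup => _ [h hf <-].
pose h' := proj_nnsfun h (measurableC mN).
have h'E x : h' x = h x * (x \in ~` N)%:R by rewrite /h' /proj_nnsfun /= mindicE.
have -> : sintegral mu h = sintegral mu h'.
  rewrite -!integralT_nnsfun; apply: ae_eq_integral => //.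
  - by apply/measurable_EFinP; exact: measurable_funP.
  - by apply/measurable_EFinP; exact: measurable_funP.
  exists N; split => // x hx; apply: contrapT => Nx; apply: hx => _.
  by congr (_%:E); rewrite -[RHS]/(h' x) h'E in_setC memNset //= mulr1.
apply: ereal_sup_ubound; exists h' => //= x.
rewrite -[X in X%:E]/(h' x) h'E in_setC; have [xN|xN] := boolP (x \in N).
  by rewrite mulr0.
by rewrite mulr1 -fg //; move: xN => /negP; apply: contra_not => /mem_set.
Qed.

Lemma integral_ae (f g : T -> \bar R) : (\forall x \ae mu, f x = g x) ->
  (\int[mu]_x f x = \int[mu]_x g x)%E.
Proof.
move=> [N [mN N0 fgN]].
have fg x : ~ N x -> f x = g x.
  by move=> Nx; apply: contrapT => h; apply: Nx; exact: fgN.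
rewrite integralE [RHS]integralE; congr (_ - _)%E; apply/eqP; rewrite eq_le; apply/andP; split;
  apply: (ge0_integral_ae_le (N := N)) => // x Nx; rewrite ?funeposE ?funenegE fg //.
Qed.

Lemma Rintegral_ae (f g : T -> R) : (\forall x \ae mu, f x = g x) ->
  \int[mu]_x f x = \int[mu]_x g x.
Proof.
by move=> fg; congr fine; apply: integral_ae; apply: filterS fg => x ->.
Qed.

End NonmeasurableIntegrands.

Section ParsevalFrames.
Variables (R : realType) (X : ptopologicalType) (H : hilbertSpace R) (k : X -> H).
Variable mu : {measure set (borel X) -> \bar R}.
Hypothesis fr : normalized_parseval_frame k mu.

Lemma parseval_real_frame : real_frame mu (k : borel X -> H).
Proof.
have [_ k1 km kw] := fr; split.
- move=> x; have := k1 x; rewrite hnormE => /(congr1 (@complex.Re R)) /= h.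
  by rewrite -(sqr_sqrtr (sqn_ge0 (k x))) h expr1n.
- by move=> f; exact: (km f).1.
- move=> f g; have [[i _] _] := kw f g; move: i.
  congr (mu.-integrable _ _); apply/funext => x /=; congr (_%:E).
  by rewrite hdotZl (fdot_hdot (T := borel X)).
move=> f g; have [_] := kw f g; rewrite /rip => ->.
by apply: eq_Rintegral => x _; rewrite hdotZl (fdot_hdot (T := borel X)).
Qed.

End ParsevalFrames.

Section ComplexBerezin.
Context d (T : measurableType d) (R : realType) (mu : {measure set T -> \bar R}).
Variables (H : hilbertSpace R) (k : T -> H).

Lemma berezinE (s : T -> R[i]) x : berezin mu k s x =
  bz mu k (fun y => complex.Re (s y)) x +i* bz mu k (fun y => complex.Im (s y)) x.
Proof.
have E y : s y * `|hdot H (k x) (k y)| ^+ 2 =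
    (complex.Re (s y) * fdot k (k x) (k x) y) +i*
    (complex.Im (s y) * fdot k (k x) (k x) y).
  rewrite (fdot_normc).
  have -> : `|hdot H (k x) (k y)| ^+ 2 = (normc (hdot H (k x) (k y)) ^+ 2)%:C.
    by rewrite rmorphXn.
  case: (s y) => p q /=.
  by apply/eqP; rewrite eq_complex /=; apply/andP; split; apply/eqP; ring.
rewrite /berezin /cintegral; congr (_ +i* _);
  by apply: eq_Rintegral => y _; rewrite E.
Qed.

End ComplexBerezin.

Section ComplexLp.
Context d (T : measurableType d) (R : realType) (nu : {measure set T -> \bar R}).
Implicit Types (f : T -> R[i]) (p : R).

Lemma normc_le (z : R[i]) : normc z <= `|complex.Re z| + `|complex.Im z|.
Proof.
rewrite -(@ler_pXn2r _ 2) ?nnegrE ?addr_ge0 //; last by case: z => a b /=; rewrite sqrtr_ge0.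
rewrite normc_sqr sqrrD !real_normK ?num_real //.
by have := mulr_ge0 (normr_ge0 (complex.Re z)) (normr_ge0 (complex.Im z)); lra.
Qed.

Lemma normc_ge0 (z : R[i]) : 0 <= normc z.
Proof. by case: z => a b /=; rewrite sqrtr_ge0. Qed.

Lemma Re_le_normc (z : R[i]) : `|complex.Re z| <= normc z.
Proof.
rewrite -(@ler_pXn2r _ 2) ?nnegrE ?normc_ge0 // normc_sqr real_normK ?num_real //.
by rewrite lerDl sqr_ge0.
Qed.

Lemma Im_le_normc (z : R[i]) : `|complex.Im z| <= normc z.
Proof.
rewrite -(@ler_pXn2r _ 2) ?nnegrE ?normc_ge0 // normc_sqr real_normK ?num_real //.
by rewrite lerDr sqr_ge0.
Qed.

Lemma measurable_normc f : cmeasurable f -> measurable_fun setT (fun x => normc (f x)).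
Proof.
move=> [mr mi]; have -> : (fun x => normc (f x)) =
    (fun x => Num.sqrt (complex.Re (f x) ^+ 2 + complex.Im (f x) ^+ 2)).
  by apply/funext => x; case: (f x).
have ms : measurable_fun setT (@Num.sqrt R).
  by apply: continuous_measurable_fun; exact: sqrt_continuous.
have m2 : measurable_fun setT (fun x => complex.Re (f x) ^+ 2 + complex.Im (f x) ^+ 2).
  by apply: measurable_funD; exact: measurable_funX.
exact: (measurableT_comp ms m2).
Qed.

Lemma measurable_normc_powR p f : cmeasurable f ->
  measurable_fun setT (fun x => normc (f x) `^ p).
Proof. by move=> mf; exact: (measurableT_comp (measurable_powR p) (measurable_normc mf)). Qed.

Lemma cLnormE p f : cLnorm nu p f = ((\int[nu]_x (normc (f x) `^ p)%:E) `^ p^-1)%E.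
Proof.
rewrite /cLnorm unlock.
have E x : (`|(normc (f x))%:E| `^ p = (normc (f x) `^ p)%:E)%E.
  by rewrite -poweR_EFin /= ger0_norm // normc_ge0.
by under eq_integral do rewrite E.
Qed.

Lemma inLpP p f : 1 <= p ->
  inLp nu p f <-> cmeasurable f /\ itg nu (fun x => normc (f x) `^ p).
Proof.
move=> p1; have pi : 0 < p^-1 by rewrite invr_gt0; lra.
have E : (\int[nu]_x `|(normc (f x) `^ p)%:E| = \int[nu]_x (normc (f x) `^ p)%:E)%E.
  by apply: eq_integral => x _; rewrite /= ger0_norm ?powR_ge0.
split=> -[mf h]; split => //.
  apply/integrableP; split; first exact/measurable_EFinP/measurable_normc_powR.
  by rewrite E; move: h; rewrite cLnormE => /lty_poweRy; apply; rewrite gt_eqF.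
rewrite cLnormE Rint_ereal // poweR_EFin; exact: ltry.
Qed.

Lemma cLnorm_cvg0 p (f : nat -> T -> R[i]) : 1 <= p ->
  (forall n, itg nu (fun x => normc (f n x) `^ p)) ->
  (fun n => \int[nu]_x normc (f n x) `^ p) @ \oo --> (0 : R) ->
  (fun n => cLnorm nu p (f n)) @ \oo --> 0%E.
Proof.
move=> p1 fi cf; have p0 : 0 < p by lra.
under eq_fun do rewrite cLnormE Rint_ereal // poweR_EFin.
apply: cvg_EFin; first exact: nearW.
apply: cvg0_le => [n|e e0]; first exact: powR_ge0.
have ep : 0 < e `^ p by rewrite powR_gt0.
apply: filterS (cvg0_near cf ep) => n h.
have -> : e = (e `^ p) `^ p^-1 by rewrite -powRrM divff ?gt_eqF // powRr1 // ltW.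
apply: le_powR => //; first by rewrite invr_ge0 ltW.
by apply: Rint_ge0 => x; exact: powR_ge0.
Qed.

End ComplexLp.

Section LpSpaces.
Context d (T : measurableType d) (R : realType) (nu : {measure set T -> \bar R}).
Implicit Types (f : T -> R[i]) (s : T -> R) (p : R).

Lemma normc_powR_le p (z : R[i]) : 0 < p ->
  normc z `^ p <= 3 `^ p * (`|complex.Re z| `^ p + `|complex.Im z| `^ p).
Proof.
move=> p0; apply: le_trans (le_powR (ltW p0) (normc_ge0 z) (normc_le z)) _.
by apply: powR_add2 => //; [exact: ltW|rewrite gt_eqF].
Qed.

Lemma itg_powR_normc p f : 1 <= p -> cmeasurable f ->
  itg nu (fun x => `|complex.Re (f x)| `^ p) -> itg nu (fun x => `|complex.Im (f x)| `^ p) ->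
  itg nu (fun x => normc (f x) `^ p).
Proof.
move=> p1 mf ir ii; have p0 : 0 < p by lra.
apply: (itg_dom _ (itgZ (3 `^ p) (itgD ir ii))); first exact: measurable_normc_powR.
by move=> x; rewrite ger0_norm ?powR_ge0 // normc_powR_le.
Qed.

Lemma inLp_ReIm p f : 1 <= p -> inLp nu p f <->
  [/\ cmeasurable f, itg nu (fun x => `|complex.Re (f x)| `^ p) &
      itg nu (fun x => `|complex.Im (f x)| `^ p)].
Proof.
move=> p1; have p0 : 0 <= p by lra.
split=> [/(inLpP _ _ p1)[[mr mi] h]|[mf ir ii]].
  split => //; apply: (itg_dom _ h); try exact: measurable_normr_powR; move=> x;
    rewrite ger0_norm ?powR_ge0 //; apply: le_powR => //.
  exact: Re_le_normc.
  exact: Im_le_normc.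
by apply/(inLpP _ _ p1); split => //; exact: itg_powR_normc.
Qed.

Lemma inLp_real1 s : inLp nu 1 (fun x => (s x)%:C) -> itg nu s.
Proof.
move=> /(inLp_ReIm _ (lexx 1))[[/= ms _] i _].
apply: (itg_dom ms i) => x; rewrite powRr1 //.
Qed.

Lemma inLp_real2 s : inLp nu 2 (fun x => (s x)%:C) -> itg nu (fun x => s x ^+ 2).
Proof.
move=> /(inLp_ReIm _ (ltac:(lra) : (1 : R) <= 2))[_ i _]; move: i.
congr (_.-integrable _ _); apply/funext => x /=.
by rewrite powR_mulrn // real_normK // num_real.
Qed.

End LpSpaces.

Section BerezinLp.
Context d (T : measurableType d) (R : realType).
Variables (nu mu : {measure set T -> \bar R}) (c : R).
Hypotheses (c0 : 0 < c)
  (scale : forall B, measurable B -> mu B = (c%:E * nu B)%E).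
Variables (H : hilbertSpace R) (k : T -> H).
Hypothesis fr : real_frame mu k.

Lemma berezin_inLp p (s : T -> R[i]) : 1 <= p -> inLp nu p s -> inLp nu p (berezin mu k s).
Proof.
move=> p1 /(inLp_ReIm _ _ p1)[[mr mi] ir ii]; apply/(inLp_ReIm _ _ p1).
have E : berezin mu k s =
    (fun x => bz mu k (fun y => complex.Re (s y)) x +i* bz mu k (fun y => complex.Im (s y)) x).
  by apply/funext => x; exact: berezinE.
rewrite E; split; first split => /=.
- exact: (bz_measurable_p c0 scale fr p1).
- exact: (bz_measurable_p c0 scale fr p1).
- by have [] := berezin_power c0 scale fr p1 mr ir.
- by have [] := berezin_power c0 scale fr p1 mi ii.
Qed.

End BerezinLp.

(** * From sequences to limits along the parameter *)

Section ParameterLimits.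
Variable R : realType.

(** The filter has a countable base: if a neighbourhood [V] were missed, points [a n > n] of [D]
    with [f (a n)] outside [V] would form a sequence contradicting the hypothesis. *)
Lemma cvg_within_pinfty (T : topologicalType) (D : set R) (f : R -> T) (l : T) :
  (forall a : nat -> R, (forall n, D (a n)) -> a @ \oo --> +oo ->
     (fun n => f (a n)) @ \oo --> l) ->
  f a @[a --> within D +oo_R] --> l.
Proof.
move=> h V Vl; apply: contrapT => nV.
have ex n : exists a, [/\ D a, n%:R < a & ~ V (f a)].
  apply: contrapT => na; apply: nV; exists n%:R; split; first exact: num_real.
  by move=> a na' Da; apply: contrapT => Va; apply: na; exists a.
have [a ha] := choice ex.
have a_oo : a @ \oo --> +oo.
  apply/cvgryPge => A; exists (Num.truncn A).+1 => // n /= nA.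
  have [_ /ltW an _] := ha n; apply: le_trans an.
  by apply: le_trans (ltW (truncnS_gt _)) _; rewrite ler_nat.
have [N _ hN] := h a (fun n => let: And3 Da _ _ := ha n in Da) a_oo V Vl.
by have [_ _] := ha N; apply; exact: (hN N (leqnn N)).
Qed.

Lemma cvg_within_seq (D : set R) (a : nat -> R) : (forall n, D (a n)) ->
  a @ \oo --> +oo -> a @ \oo --> within D +oo_R.
Proof.
move=> Da ca P hP; have h : \forall n \near \oo, D (a n) -> P (a n) by exact: (ca _ hP).
have : \forall n \near \oo, P (a n) by apply: filterS h => n; apply.
by [].
Qed.

Lemma cvg_ReIm (t : nat -> R[i]) (r : R) :
  (fun n => complex.Re (t n)) @ \oo --> r -> (fun n => complex.Im (t n)) @ \oo --> (0 : R) ->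
  t @ \oo --> (r%:C : R[i]^o).
Proof.
move=> /cvgrPdist_le cr /cvgrPdist_le ci; apply/(@cvgrPdist_le R[i] R[i]^o) => -[e e'].
rewrite ltcE /= => /andP[/eqP-> e0].
have e2 : 0 < e / 2 by rewrite divr_gt0.
apply: filterS2 (cr _ e2) (ci _ e2) => n h1 h2.
suff : normc (r%:C - t n) <= e by rewrite -lecR.
apply: le_trans (normc_le _) _.
have -> : complex.Re (r%:C - t n) = r - complex.Re (t n) by case: (t n).
have -> : complex.Im (r%:C - t n) = 0 - complex.Im (t n) by case: (t n).
lra.
Qed.

End ParameterLimits.

(** * Domains and measurable versions for the two alternatives on [psi] *)

Section Admissible.
Context d (T : measurableType d) (R : realType) (nu : {measure set T -> \bar R}).
Implicit Types (s : T -> R) (psi : R -> R).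

Lemma ess_segment s : (0 < nu setT)%E -> (exists M : R, \forall x \ae nu, `|s x| <= M) ->
  exists m M : R, [/\ m <= M, \forall x \ae nu, m <= s x <= M &
    [set t : R | (ess_inf nu (EFin \o s) <= t%:E <= ess_sup nu (EFin \o s))%E] = `[m, M]%classic].
Proof.
move=> nu0 [B sB].
have si := ess_inf_le nu (EFin \o s); have ss := ess_sup_ge nu (EFin \o s).
have hi : (ess_sup nu (EFin \o s) <= B%:E)%E.
  apply/ess_supP; apply: filterS sB => x; rewrite lee_fin; exact: le_trans (ler_norm _).
have lo : ((- B)%:E <= ess_inf nu (EFin \o s))%E.
  by apply/ess_infP; apply: filterS sB => x; rewrite lee_fin ler_norml => /andP[].
(* Positivity of the measure enters here: on a null space the essential infimum exceeds the
   essential supremum. *)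
have le : (ess_inf nu (EFin \o s) <= ess_sup nu (EFin \o s))%E.
  apply: ess_sup_gee => //; exact: si.
move: si ss hi lo le.
case: (ess_inf nu _) => [m| |]; case: (ess_sup nu _) => [M| |] //.
move=> si ss _ _ mM; exists m, M; split => //.
by apply: filterS2 si ss => x; rewrite !lee_fin => -> ->.
Qed.

Lemma admissible_domain s psi : (0 < nu setT)%E -> admissible nu s psi ->
  exists D, [/\ modulus D psi, measurable D, {within D, continuous psi} &
     (exists m M, [/\ D = `[m, M]%classic, \forall x \ae nu, m <= s x <= M &
        exists B : R, \forall x \ae nu, `|s x| <= B]) \/
     D = `[0, +oo[%classic /\ \forall x \ae nu, 0 <= s x].
Proof.
move=> nu0 [[bs cpsi]|[s0 cpsi [l pl]]].
  have [m [M [mM sm E]]] := ess_segment nu0 bs; rewrite E in cpsi.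
  exists `[m, M]%classic; split => //; first exact: modulus_segment.
  by left; exists m, M.
by exists `[0, +oo[%classic; split => //; [exact: modulus_ray pl|right].
Qed.

(** Extending [psi] by zero outside the measurable set [D] gives a Borel function that agrees with
    [psi] at almost every value of [s]. *)
Lemma measurable_version s psi (D : set R) : measurable_fun setT s -> measurable D ->
  {within D, continuous psi} -> (\forall x \ae nu, D (s x)) ->
  exists2 g, measurable_fun setT g & \forall x \ae nu, g x = psi (s x).
Proof.
move=> ms mD cpsi Ds; exists ((psi \_ D) \o s).
  apply: (measurableT_comp _ ms).
  by apply/(measurable_restrictT _ mD); exact: subspace_continuous_measurable_fun.
by apply: filterS Ds => x Dx /=; rewrite patchE mem_set.
Qed.

End Admissible.

(** * The three limits along a sequence of parameters *)

Section SequentialLimits.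
Variables (R : realType) (X : ptopologicalType).
Variable nu : {measure set (borel X) -> \bar R}.
Hypothesis nu_radon : radon_measure nu.
Variables (mu : nat -> {measure set (borel X) -> \bar R}) (c : nat -> R).
Hypotheses (c0 : forall n, 0 < c n) (scale : forall n (B : set (borel X)),
  measurable B -> mu n B = ((c n)%:E * nu B)%E).
Variables (H : nat -> hilbertSpace R) (k : forall n, borel X -> H n).
Hypothesis fr : forall n, real_frame (mu n) (k n).
Hypothesis loc : localized mu k.
Implicit Types (s eta g : borel X -> R) (n : nat).

Local Notation T_ n s := (toep (mu n) (k n) s).

Lemma berezin_cvg p (f : borel X -> R[i]) : 1 <= p -> inLp nu p f ->
  (fun n => cLnorm nu p (fun x => berezin (mu n) (k n) f x - f x)) @ \oo --> 0%E.
Proof.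
move=> p1 /(inLp_ReIm _ _ p1)[[mr mi] ir ii]; have p0 : 0 < p by lra.
have [jr cr] := Lpcvg nu_radon c0 scale fr loc p1 mr ir.
have [ji ci] := Lpcvg nu_radon c0 scale fr loc p1 mi ii.
pose h n x := berezin (mu n) (k n) f x - f x.
have hr n x : complex.Re (h n x) =
    bz (mu n) (k n) (fun y => complex.Re (f y)) x - complex.Re (f x).
  by rewrite /h berezinE; case: (f x).
have hi n x : complex.Im (h n x) =
    bz (mu n) (k n) (fun y => complex.Im (f y)) x - complex.Im (f x).
  by rewrite /h berezinE; case: (f x).
have mh n : cmeasurable (h n).
  split; under eq_fun do rewrite ?hr ?hi; apply: measurable_funB => //.
    exact: (bz_measurable_p (c0 n) (@scale n) (fr n) p1).
  exact: (bz_measurable_p (c0 n) (@scale n) (fr n) p1).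
have hri n : itg nu (fun x => `|complex.Re (h n x)| `^ p).
  by under eq_fun do rewrite hr; exact: jr.
have hii n : itg nu (fun x => `|complex.Im (h n x)| `^ p).
  by under eq_fun do rewrite hi; exact: ji.
have ih n := itg_powR_normc p1 (mh n) (hri n) (hii n).
apply: (cLnorm_cvg0 p1 ih).
have c3 : (fun n => 3 `^ p * (\int[nu]_x `|complex.Re (h n x)| `^ p +
    \int[nu]_x `|complex.Im (h n x)| `^ p)) @ \oo --> (0 : R).
  have -> : (0 : R) = 3 `^ p * (0 + 0) by rewrite addr0 mulr0.
  apply: cvgMr; apply: cvgD.
    by under eq_fun do under eq_Rintegral do rewrite hr; exact: cr.
  by under eq_fun do under eq_Rintegral do rewrite hi; exact: ci.
apply: cvg0_le => [n|e e0]; first by apply: Rint_ge0 => x; exact: powR_ge0.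
apply: filterS (cvg0_near c3 e0) => n; apply: le_trans.
rewrite -RintD // -RintZ; last exact: itgD.
apply: Rint_le => //; first by apply: itgZ; exact: itgD.
by move=> x; exact: normc_powR_le.
Qed.

(** The kernel at the base point of [X] has integral 1, which is impossible for the zero measure. *)
Lemma scaled_frame_gt0 : (0 < nu setT)%E.
Proof.
rewrite lt_neqAle measure_ge0 andbT eq_sym; apply/eqP => nu0.
have mu0 : mu 0%N setT = 0%E by rewrite scale // nu0 mule0.
have := kernel_int (fr 0%N) (point : X).
rewrite /Rintegral null_set_integral //=.
  by move=> /eqP; rewrite eq_sym oner_eq0.
by have /measurable_int := kernel_itg (fr 0%N) (point : X).
Qed.

Lemma form_bounds s psi : itg nu s -> admissible nu s psi ->
  exists D, [/\ modulus D psi, (\forall x \ae nu, D (s x)),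
    (exists2 g, measurable_fun setT g & \forall x \ae nu, g x = psi (s x)) &
    forall n, exists a b, [/\ `[a, b] `<=` D,
     forall f, a * sqn f <= rip (T_ n s f) f & forall f, rip (T_ n s f) f <= b * sqn f]].
Proof.
move=> si ad; have ms := itg_measurable si.
have sm n : itg (mu n) s by exact/(itg_scale (c0 n) (@scale n)).
have [D [mD mmD cD alt]] := admissible_domain scaled_frame_gt0 ad.
have Ds : \forall x \ae nu, D (s x).
  case: alt => [[m [M [-> h _]]]|[-> h]]; apply: filterS h => x.
    by rewrite /= in_itv.
  by rewrite /= in_itv /= andbT.
exists D; split => //; first exact: (measurable_version ms mmD cD Ds).
move=> n; case: alt => [[m [M [-> h _]]]|[-> h]].
  have hm : \forall x \ae mu n, m <= s x.
    by apply: (ae_scale (@scale n)); apply: filterS h => x /andP[].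
  have hM : \forall x \ae mu n, s x <= M.
    by apply: (ae_scale (@scale n)); apply: filterS h => x /andP[].
  by exists m, M; split => // f; [exact: toeplitz_form_lower|exact: toeplitz_form_upper].
have [h1 h2] := toeplitz_form_bounds fr (sm n) (ae_scale (@scale n) h).
exists 0, (\int[mu n]_x `|s x|); split => //.
by move=> z /=; rewrite !in_itv /= => /andP[-> _].
Qed.

Lemma cvg_scaled (t : nat -> R[i]) (r : R) :
  (fun n => (c n)^-1 * complex.Re (t n)) @ \oo --> r ->
  (fun n => (c n)^-1 * complex.Im (t n)) @ \oo --> (0 : R) ->
  (fun n => (c n)^-1%:C * t n) @ \oo --> (r%:C : R[i]^o).
Proof.
have re n : complex.Re ((c n)^-1%:C * t n) = (c n)^-1 * complex.Re (t n).
  by case: (t n) => u v /=; rewrite mul0r subr0.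
have im n : complex.Im ((c n)^-1%:C * t n) = (c n)^-1 * complex.Im (t n).
  by case: (t n) => u v /=; rewrite mul0r addr0.
by move=> cr ci; apply: cvg_ReIm; [under eq_fun do rewrite re|under eq_fun do rewrite im].
Qed.

Lemma trace_product_cvg s eta psi :
  itg nu s -> itg nu (fun x => s x ^+ 2) -> itg nu eta -> itg nu (fun x => eta x ^+ 2) ->
  (\forall x \ae nu, 0 <= eta x) -> admissible nu s psi ->
  (fun n => (c n)^-1%:C * trace (T_ n eta \o fun_calculus (T_ n s) psi)) @ \oo -->
    ((\int[nu]_x (eta x * psi (s x)))%:C : R[i]^o).
Proof.
move=> si s2i ei e2i eta0 ad; have [D [mD Ds [g mg gE] bnd]] := form_bounds si ad.
have [cr ci] := trace_product_limit nu_radon c0 scale fr loc si s2i ei e2i eta0 mD Ds bnd mg gE.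
have -> : \int[nu]_x (eta x * psi (s x)) = \int[nu]_x (eta x * g x).
  by apply: Rintegral_ae; apply: filterS gE => x ->.
exact: cvg_scaled cr ci.
Qed.

(** A bounded integrable symbol is square integrable, so the first alternative is the product
    formula with [eta = 1]; the second, where [s] may fail to be square integrable, requires the
    resolvent argument. *)
Lemma trace_cvg s psi : itg nu (fun=> 1) -> itg nu s -> admissible nu s psi ->
  (fun n => (c n)^-1%:C * trace (fun_calculus (T_ n s) psi)) @ \oo -->
    ((\int[nu]_x psi (s x))%:C : R[i]^o).
Proof.
move=> i1 si ad; have ms := itg_measurable si.
have i1m n : itg (mu n) (fun=> 1) by exact/(itg_scale (c0 n) (@scale n)).
have [D [mD mmD cD [[m [M [_ _ [B sB]]]]|[DE s0]]]] := admissible_domain scaled_frame_gt0 ad.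
  have s2i : itg nu (fun x => s x ^+ 2).
    apply: (itg_dom_ae (g := fun x => B * `|s x|)).
    - exact: measurable_funX.
    - by apply: itgZ; exact: itg_norm.
    by apply: filterS sB => x h; rewrite expr2 normrM ler_wpM2r.
  have one0 : \forall x \ae nu, 0 <= (1 : R) by apply: aeW => x; exact: ler01.
  have i11 : itg nu (fun=> 1 ^+ 2) by under eq_fun do rewrite expr1n.
  have := trace_product_cvg si s2i i1 i11 one0 ad.
  under eq_fun do rewrite (toeplitz_one (fr _) (i1m _)).
  by under eq_Rintegral do rewrite mul1r.
rewrite DE in mD cD mmD.
have Ds : \forall x \ae nu, `[0, +oo[%classic (s x).
  by apply: filterS s0 => x; rewrite /= in_itv /= andbT.
have [g mg gE] := measurable_version ms mmD cD Ds.
have [cr ci] := trace_finite_limit nu_radon c0 scale fr loc i1 si s0 mD mg gE.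
have -> : \int[nu]_x psi (s x) = \int[nu]_x g x.
  by apply: Rintegral_ae; apply: filterS gE => x ->.
exact: cvg_scaled cr ci.
Qed.

End SequentialLimits.

Theorem mainTheorem1 (R : realType) (X : ptopologicalType)
    (X_hausdorff : hausdorff_space X)
    (X_loc_compact : locally_compact [set: X])
    (Params : set R)
    (H : R -> hilbertSpace R)
    (k : forall a : R, X -> H a)
    (nu_ : R -> {measure set (borel X) -> \bar R})
    (frame : forall a, Params a -> normalized_parseval_frame (k a) (nu_ a))
    (c : R -> R) (c_gt0 : forall a, Params a -> 0 < c a)
    (nu : {measure set (borel X) -> \bar R}) (nu_radon : radon_measure nu)
    (scaling : forall a, Params a -> forall B : set (borel X), measurable B ->
       nu_ a B = ((c a)%:E * nu B)%E)
    (localization : forall (x : X) (U : set (borel X)),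
       measurable U -> nbhs x (U : set X) ->
       (\int[nu_ a]_(y in ~` U) (normc (hdot (H a) (k a x) (k a y)) ^+ 2)%:E)%E
         @[a --> within Params +oo_R] --> 0%E) :
  [/\ (* (A) *)
      forall (p : R) (sigma : borel X -> R[i]),
        1 <= p -> inLp nu p sigma ->
        (forall a, Params a -> inLp nu p (berezin (nu_ a) (k a) sigma)) /\
        cLnorm nu p (fun x => berezin (nu_ a) (k a) sigma x - sigma x)
          @[a --> within Params +oo_R] --> 0%E,
      (* (B) *)
      compact [set: X] ->
      (forall a, Params a -> exists2 n : nat, has_dim (H a) n & c a = n%:R) ->
      forall (sigma : borel X -> R) (psi : R -> R),
        inLp nu 1 (fun x => (sigma x)%:C) ->
        admissible nu sigma psi ->
        (c a)^-1%:C *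
          trace (fun_calculus
                   (toeplitz (nu_ a) (k a) (fun x => (sigma x)%:C)) psi)
          @[a --> within Params +oo_R] -->
          ((\int[nu]_x psi (sigma x))%:C : R[i]^o)
    & (* (C) *)
      forall (sigma eta : borel X -> R) (psi : R -> R),
        inLp nu 1 (fun x => (sigma x)%:C) ->
        inLp nu 2 (fun x => (sigma x)%:C) ->
        inLp nu 1 (fun x => (eta x)%:C) ->
        inLp nu 2 (fun x => (eta x)%:C) ->
        (\forall x \ae nu, 0 <= eta x) ->
        let Tsigma a := toeplitz (nu_ a) (k a) (fun x => (sigma x)%:C) in
        let Teta a := toeplitz (nu_ a) (k a) (fun x => (eta x)%:C) in
        (forall a, Params a -> Tsigma a \o Teta a = Teta a \o Tsigma a) ->
        admissible nu sigma psi ->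
        (c a)^-1%:C * trace (Teta a \o fun_calculus (Tsigma a) psi)
          @[a --> within Params +oo_R] -->
          ((\int[nu]_x (eta x * psi (sigma x)))%:C : R[i]^o)].
Proof.
have pf a Da := parseval_real_frame (frame a Da).
have pc a Da := c_gt0 a Da.
have ps a Da := scaling a Da.
have loc (a : nat -> R) : (forall n, Params (a n)) -> a @ \oo --> +oo ->
    localized (fun n => nu_ (a n)) (fun n => k (a n) : borel X -> H (a n)).
  move=> Da ca x U mU xU; under eq_fun do under eq_integral do rewrite fdot_normc.
  exact: cvg_comp (cvg_within_seq Da ca) (localization x U mU xU).
split.
- move=> p sigma p1 sp; split=> [a Da|].
    exact: (berezin_inLp (pc a Da) (ps a Da) (pf a Da) p1 sp).
  apply: cvg_within_pinfty => a Da ca.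
  exact: (berezin_cvg nu_radon (fun n => pc _ (Da n)) (fun n => ps _ (Da n))
    (fun n => pf _ (Da n)) (loc a Da ca) p1 sp).
- move=> cX _ sigma psi s1 ad; have si := inLp_real1 s1.
  (* Compactness of [X] makes the Radon measure finite. *)
  have i1 : itg nu (fun=> 1).
    have [fin _ _] := nu_radon.
    apply/integrableP; split; first exact: measurable_cst.
    rewrite (eq_integral (cst 1%E)) ?integral_cst ?mul1e; first exact: fin.
      by [].
    by move=> x _ /=; rewrite normr1.
  apply: (cvg_within_pinfty (T := R[i]^o)) => a Da ca.
  exact: (trace_cvg nu_radon (fun n => pc _ (Da n)) (fun n => ps _ (Da n))
    (fun n => pf _ (Da n)) (loc a Da ca) i1 si ad).
move=> sigma eta psi s1 s2 e1 e2 e0 Ts Te _ ad.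
apply: (cvg_within_pinfty (T := R[i]^o)) => a Da ca.
exact: (trace_product_cvg nu_radon (fun n => pc _ (Da n)) (fun n => ps _ (Da n))
  (fun n => pf _ (Da n)) (loc a Da ca) (inLp_real1 s1) (inLp_real2 s2)
  (inLp_real1 e1) (inLp_real2 e2) e0 ad).
Qed.
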